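(* The null section of the phase space of a spacetime in class $\mathcal{S}$ is partitioned, but not smoothly foliated, by the canonical lifts of the null bundles over all maximal spherically symmetric photon surfaces together with the canonical lifts of the null bundles over all maximal principal null hypersurfaces.
   Context: Class $\mathcal{S}$: spacetimes $\mathfrak{L}^{n+1}=\mathbb{R}\times\mathcal{I}\times\mathbb{S}^{n-1}$, $\mathfrak{g}=-f(r)dt^2+\frac{1}{f(r)}dr^2+r^2\Omega$, with $\mathcal{I}\subseteq(0,\infty)$ an open interval, $f\colon\mathcal{I}\to(0,\infty)$ smooth, $\Omega$ the round metric on $\mathbb{S}^{n-1}$. Phase space is the cotangent bundle $T^*\mathfrak{L}^{n+1}$; its null section is $\{\omega\in T^*\mathfrak{L}^{n+1}\mid\mathfrak{g}(\omega^\sharp,\omega^\sharp)=0\}$. Photon surface: a timelike hypersurface $P^n$ such that every null geodesic initially tangent to $P^n$ remains tangent to $P^n$ as long as it exists (equivalently, $P^n$ is totally umbilic). It is spherically symmetric if it is connected and each non-empty intersection $P^n\cap\{t=t_0\}$ equals $\{t_0\}\times\{r_0\}\times\mathbb{S}^{n-1}$ for some $r_0\in\mathcal{I}$. A connected spherically symmetric photon surface is maximal if it is not a subset of a strictly larger connected, spherically symmetric photon surface. A null geodesic $\gamma(s)=(t(s),r(s),\xi(s))$, $s\in J$, generates the hypersurface $\{(t(s),r(s),\xi_* )\mid s\in J,\ \xi_*\in\mathbb{S}^{n-1}\}$. A null geodesic is principal if its (total) angular momentum vanishes (i.e. $\xi$ is constant); the hypersurfaces generated by principal null geodesics are the principal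 null hypersurfaces, and they are maximal if the generating null geodesic is maximally extended. The null bundle over a hypersurface is the bundle of null vectors tangent to it; its canonical lift is its image in $T^*\mathfrak{L}^{n+1}$ under the canonical metric isomorphism. ''Not smoothly foliated'' means that the partition is not a smooth foliation.
   Formalization: Null vectors and covectors are taken nonzero (the zero covector would lie in every lift over its base point or in none, so the partition would fail); n ≥ 2; null geodesics tangent to a photon surface are followed until they meet its edge, matching total umbilicity. *)

(* Defs.v *)
From HB Require Import structures.
From mathcomp Require Export all_boot all_order all_algebra.
From mathcomp Require Export all_classical all_reals all_analysis.
Export Order.TTheory GRing.Theory Num.Theory.
Export numFieldNormedType.Exports.

Set Implicit Arguments.
Unset Strict Implicit.
Unset Printing Implicit Defensive.

Local Open Scope classical_set_scope.
Local Open Scope ring_scope.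

Section Smoothness.
Variable R : realType.

(** On an open subset of a finite-dimensional space this is the usual notion of
    a C^k map: all iterated directional derivatives of order at most [k] exist
    and are continuous. *)
Fixpoint Ck (E F : normedModType R) (U : set E) (k : nat) (h : E -> F) : Prop :=
  (forall x, U x -> {for x, continuous h}) /\
  if k is k'.+1 then
    (forall x v, U x -> derivable h x v) /\
    (forall v, Ck U k' (fun x => 'D_v h x))
  else True.

Definition smooth_on (E F : normedModType R) (U : set E) (h : E -> F) :=
  forall k, Ck U k h.

(** Velocities at [p] of the curves lying in [A]. If [A] is an embedded
    submanifold, these are exactly the vectors of its tangent space at [p],
    viewed inside the ambient vector space. *)
Definition tangent_space (E : normedModType R) (A : set E) (p : E) : set E :=
  [set v | exists c : R -> E,
    [/\ c 0 = p, \forall s \near (0 : R), A (c s) & is_derive (0 : R) (1 : R) c v]].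

(** A chart of [N] on [N `&` W] with image the open cube, with both directions
    smooth (for the structure [N] inherits from the ambient space), which is
    flat for the family [F]: each member of [F] is cut by the chart domain in a
    countable, possibly empty, union of slices [R^k x {c}]. *)
Definition flat_chart (E : normedModType R) (N : set E) (F : set (set E))
    (k q : nat) (W : set E)
    (phi : E -> ('rV[R]_k * 'rV[R]_q)%type)
    (psi : ('rV[R]_k * 'rV[R]_q)%type -> E) : Prop :=
  let cube := [set y : 'rV[R]_k * 'rV[R]_q | `|y| < 1] in
  [/\ open W /\ smooth_on W phi,
      smooth_on cube psi,
      forall x, N x -> W x -> cube (phi x) /\ psi (phi x) = x,
      forall y, cube y -> (N `&` W) (psi y) /\ phi (psi y) = y
    & forall A, F A -> exists2 D : set 'rV[R]_q, countable D &
        A `&` W = [set x | [/\ N x, W x & D (phi x).2]]].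

(** Connectedness of the members is deliberately not required here. The lift of
    a null bundle contains the duals of [v] and of [- v], on which [dt] has
    opposite signs, hence is never connected; failure of [flat_family] says
    that, even so, the lifts are not unions of leaves of a smooth foliation with
    countably many slices in each flat chart. *)
Definition flat_family (E : normedModType R) (N : set E) (F : set (set E)) :=
  exists k q : nat, forall x, N x ->
    exists W phi psi, W x /\ @flat_chart E N F k q W phi psi.

(** The leaves are automatically immersed submanifolds of dimension [k], with
    the plaques of the flat charts as charts. *)
Definition smooth_foliation (E : normedModType R) (N : set E)
    (F : set (set E)) :=
  [/\ partition F id N, forall A, F A -> connected A & flat_family N F].

End Smoothness.

Section ClassS.
Variable R : realType.

Record class_S (I : set R) (f : R -> R) : Prop := ClassS {
  class_S_open : open I;
  class_S_interval : is_interval I;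
  class_S_nonempty : I !=set0;
  class_S_pos : I `<=` [set r | 0 < r];
  class_S_smooth : smooth_on I f;
  class_S_f_gt0 : forall r, I r -> 0 < f r }.

Variable n : nat.

(** The spacetime [R x I x S^(n-1)] is realised inside the vector space
    [R x R x R^n], with elements [(t, r, x)]. *)
Definition ambient : normedModType R := (R * R * 'rV[R]_n)%type.

Definition tc (p : ambient) : R := p.1.1.
Definition rc (p : ambient) : R := p.1.2.
Definition xc (p : ambient) : 'rV[R]_n := p.2.

Definition dot (x y : 'rV[R]_n) : R := \sum_i x 0 i * y 0 i.

Definition unit_sphere : set 'rV[R]_n := [set x | dot x x = 1].

Variables (I : set R) (f : R -> R).

Definition spacetime : set ambient :=
  [set p | I (rc p) /\ unit_sphere (xc p)].

(** Defined on all of [R x I x R^n]; since the Euclidean inner product induces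
    the round metric on the sphere, its restriction to the tangent spaces of
    [spacetime] is the metric of the spacetime. *)
Definition metric (p u v : ambient) : R :=
  - f (rc p) * (tc u * tc v) + (f (rc p))^-1 * (rc u * rc v)
  + rc p ^+ 2 * dot (xc u) (xc v).

(** Koszul's formula for [metric p (nabla_u w) v] with [u], [v], [w] constant
    vector fields, [nabla] being the Levi-Civita connection of [metric] on
    [R x I x R^n]. *)
Definition koszul (p u w v : ambient) : R :=
  2^-1 * ('D_u (fun q => metric q w v) p + 'D_w (fun q => metric q u v) p
          - 'D_v (fun q => metric q u w) p).

(** The Levi-Civita connection of a submanifold is the tangential part of the
    ambient one, so a curve is a geodesic iff its ambient covariant acceleration
    is orthogonal to the tangent spaces of [spacetime]. Solutions of this
    equation are automatically smooth. *)
Definition geodesic (J : set R) (g : R -> ambient) : Prop :=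
  [/\ open J, is_interval J, J !=set0,
      forall s, J s ->
        [/\ spacetime (g s), derivable g s 1 & derivable (derive1 g) s 1]
    & forall s v, J s -> tangent_space spacetime (g s) v ->
        metric (g s) (derive1 (derive1 g) s) v
        + koszul (g s) (derive1 g s) (derive1 g s) v = 0].

Definition null_vector (p v : ambient) : Prop := v <> 0 /\ metric p v v = 0.

Definition null_geodesic (J : set R) (g : R -> ambient) : Prop :=
  geodesic J g /\ forall s, J s -> null_vector (g s) (derive1 g s).

Definition maximally_extended (J : set R) (g : R -> ambient) : Prop :=
  forall (J' : set R) (g' : R -> ambient), geodesic J' g' ->
    J `<=` J' -> (forall s, J s -> g' s = g s) -> J' = J.

Definition angular_momentum (g : R -> ambient) (s : R) : R :=
  rc (g s) ^+ 2 * Num.sqrt (dot (xc (derive1 g s)) (xc (derive1 g s))).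

Definition principal (J : set R) (g : R -> ambient) : Prop :=
  forall s, J s -> angular_momentum g s = 0.

Definition generated (J : set R) (g : R -> ambient) : set ambient :=
  [set p | exists s, [/\ J s, tc p = tc (g s), rc p = rc (g s)
                       & unit_sphere (xc p)]].

Definition maximal_principal_null_hypersurface (H : set ambient) : Prop :=
  exists J g, [/\ null_geodesic J g, principal J g, maximally_extended J g
                & H = generated J g].

(** Embedded smooth hypersurfaces of the spacetime, given locally as regular
    level sets. *)
Definition hypersurface (P : set ambient) : Prop :=
  [/\ P !=set0, P `<=` spacetime &
      forall p, P p -> exists (U : set ambient) (F : ambient -> R),
        [/\ open U, U p, smooth_on U F,
            P `&` U = [set q | [/\ spacetime q, U q & F q = 0]]
          & exists2 v, tangent_space spacetime p v & 'D_v F p <> 0]].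

(** The induced metric has signature [(-, +, .., +)]. *)
Definition timelike (P : set ambient) : Prop :=
  forall p, P p -> exists u, [/\ tangent_space P p u, metric p u u < 0 &
    forall v, tangent_space P p v -> metric p u v = 0 -> v <> 0 ->
      0 < metric p v v].

(** [P] need not be closed: every open part of a totally umbilic hypersurface is
    totally umbilic. Null geodesics are therefore followed as long as they do
    not run into the edge of [P], and, [J] being arbitrary, as long as they
    exist if [P] is closed. For embedded hypersurfaces this is equivalent to
    being totally umbilic. *)
Definition edge (P : set ambient) : set ambient := closure P `\` P.

Definition photon_surface (P : set ambient) : Prop :=
  [/\ hypersurface P, timelike P &
      forall (J : set R) (g : R -> ambient), null_geodesic J g ->
        (forall s, J s -> ~ edge P (g s)) ->
        forall s0, J s0 -> P (g s0) -> tangent_space P (g s0) (derive1 g s0) ->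
        forall s, J s -> P (g s) /\ tangent_space P (g s) (derive1 g s)].

Definition spherically_symmetric (P : set ambient) : Prop :=
  connected P /\
  forall t0 : R, P `&` [set p | tc p = t0] !=set0 ->
    exists2 r0, I r0 & P `&` [set p | tc p = t0] =
      [set p | [/\ tc p = t0, rc p = r0 & unit_sphere (xc p)]].

Definition symmetric_photon_surface (P : set ambient) : Prop :=
  photon_surface P /\ spherically_symmetric P.

Definition maximal_symmetric_photon_surface (P : set ambient) : Prop :=
  symmetric_photon_surface P /\
  forall P', symmetric_photon_surface P' -> P `<=` P' -> P' = P.

(** A point [(p, om)] of the cotangent bundle is a base point together with the
    components of a covector on [ambient], normalised to vanish on the Euclidean
    normal [(0, 0, x)] of [spacetime] at [p = (t, r, x)]. Covectors of
    [spacetime] at [p] correspond bijectively to such [om] by restriction of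
    [pairing om] to the tangent space. *)
Definition phase_space : set (ambient * ambient)%type :=
  [set z | spacetime z.1 /\ dot (xc z.2) (xc z.1) = 0].

Definition pairing (om v : ambient) : R :=
  tc om * tc v + rc om * rc v + dot (xc om) (xc v).

(** [om] is the metric dual of [v], i.e. [om = v^flat] and [v = om^sharp]. *)
Definition metric_dual (p v om : ambient) : Prop :=
  forall w, tangent_space spacetime p w -> pairing om w = metric p v w.

(** As for null vectors, the zero covector is not null: it would lie in the lift
    of every hypersurface through its base point. *)
Definition null_section : set (ambient * ambient)%type :=
  [set z | [/\ phase_space z, z.2 <> 0 &
    exists v, [/\ tangent_space spacetime z.1 v, metric_dual z.1 v z.2
                & metric z.1 v v = 0]]].

Definition null_bundle (P : set ambient) : set (ambient * ambient)%type :=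
  [set z | [/\ P z.1, tangent_space P z.1 z.2 & null_vector z.1 z.2]].

Definition canonical_lift (B : set (ambient * ambient)%type) :
    set (ambient * ambient)%type :=
  [set z | phase_space z /\
    exists2 v, B (z.1, v) & metric_dual z.1 v z.2].

Definition lifted_hypersurfaces : set (set ambient) :=
  [set P | maximal_symmetric_photon_surface P \/
           maximal_principal_null_hypersurface P].

Definition null_lift (P : set ambient) := canonical_lift (null_bundle P).

End ClassS.

(* Main.v *)
(** A spherically symmetric photon surface is the product of a curve [r = h(t)]
    with the sphere. Nullness eliminates energy and angular momentum from the
    geodesic equations: along a null geodesic [q = dr/dt] satisfies
    [dq/dt = V(r, q)] for a fixed [V]. Hence the symmetric photon surfaces are
    given by the solutions of [h'' = V(h, h')] with [|h'| < f(h)], the maximal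
    ones by the maximal solutions, and a null vector with non-zero angular part
    is tangent to exactly one of these, namely the one with slope [h' = dr/dt].
    The maximal principal null hypersurfaces are the surfaces [t = c + r*] and
    [t = c - r*] with [dr* = dr / f]; they account for the radial null vectors.

    The lift of a null bundle contains the duals of [v] and [- v], on which [dt]
    has opposite signs, and no covector on which [dt] vanishes, so it is not
    connected. For [n > 2], fix a radial null covector and change its angular
    part to [eps w], with [w] on a circle: these covectors lie in a single lift,
    hence in a single slice of a flat chart, whose label is thus an even function
    of [eps] and changes only by [o(eps)]. The slice of the radial covector lies
    in the lift of a principal hypersurface, on which angular parts vanish; as
    the inverse chart is Lipschitz, this forces [eps = o(eps)]. *)

Require Import Defs.
From mathcomp Require Import ring lra.

Set Implicit Arguments.
Unset Strict Implicit.
Unset Printing Implicit Defensive.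

Local Open Scope classical_set_scope.
Local Open Scope ring_scope.

(** * Real functions and ordinary differential equations *)

(** Existence and uniqueness are obtained by different means. The equation for [h] and the geodesic
    equation each have a first integral, so existence is a matter of quadrature: both are brought to
    Newton's form [u'' = G(u)], [u'^2 = Phi(u)]. Uniqueness cannot be read off the first integral,
    whose square root is not Lipschitz at turning points; it comes from a Gronwall estimate for the
    pair of radius and slope. A photon surface is given only as a set. It is tied to a profile by a
    null geodesic inside it: spherical symmetry turns a timelike tangent vector into a null one, the
    geodesic issuing from it stays in the surface, and its rotations sweep out the surface near that
    time. In the failure of flatness, a lift may meet a chart in countably many slices, so the label
    along a path in the lift has countably many possible values; being continuous, it is constant.
    The path must join opposite angular directions, which takes two dimensions of directions
    orthogonal to the base point: this is where [n > 2] enters. *)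

Section Pointwise.
Variables (R : realType) (E : normedModType R).
Implicit Types (f g : E -> R) (x v : E).

Lemma derive_addf f g x v a b : is_derive x v f a -> is_derive x v g b ->
  is_derive x v (fun y => f y + g y) (a + b).
Proof. exact: is_deriveD. Qed.

Lemma derive_subf f g x v a b : is_derive x v f a -> is_derive x v g b ->
  is_derive x v (fun y => f y - g y) (a - b).
Proof. exact: is_deriveB. Qed.

Lemma derive_oppf f x v a : is_derive x v f a -> is_derive x v (fun y => - f y) (- a).
Proof. exact: is_deriveN. Qed.

Lemma derive_mulf f g x v a b : is_derive x v f a -> is_derive x v g b ->
  is_derive x v (fun y => f y * g y) (a * g x + f x * b).
Proof.
move=> fa gb; rewrite (_ : _ + _ = f x *: b + g x *: a); first exact: is_deriveM.
by rewrite /GRing.scale/= addrC [g x * a]mulrC.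
Qed.

Lemma derive_invf f x v a : f x != 0 -> is_derive x v f a ->
  is_derive x v (fun y => (f y)^-1) (- a / f x ^+ 2).
Proof.
move=> f0 fa; constructor; first by apply: derivableV => //; exact: ex_derive.
by rewrite deriveV ?derive_val// /GRing.scale/= mulrC mulrN mulNr.
Qed.

Lemma derive_sqrf f x v a : is_derive x v f a ->
  is_derive x v (fun y => f y ^+ 2) (2 * f x * a).
Proof.
move=> fa; rewrite (_ : (fun y => f y ^+ 2) = fun y => f y * f y).
  by apply: (is_derive_eq (derive_mulf fa fa)); rewrite -mulrA mulr_natl mulr2n mulrC.
by apply/funext => y; rewrite expr2.
Qed.

Lemma derive_cstf (c : R) x v : is_derive x v (fun=> c) 0.
Proof. exact: is_derive_cst. Qed.

(** [f] is only assumed to have a derivative in the direction [v], so the chain rule is transported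
    from the real line along [s *: v + x]. *)
Lemma derive_compf (h : R -> R) f x v a b :
  is_derive (f x) (1 : R) h a -> is_derive x v f b ->
  is_derive x v (fun y => h (f y)) (a * b).
Proof.
move=> ha [fx fb].
have line (g : E -> R) c : is_derive x v g c <->
    is_derive (0 : R) (1 : R) (fun s : R => g (s *: v + x)) c.
  have E1 : 'D_v g x = 'D_1 (fun s : R => g (s *: v + x)) (0 : R).
    rewrite /derive; apply: (congr1 (fun F : R -> R => lim (F @ (0 : R)^'))).
    apply/funext => s /=.
    by rewrite /shift/= scale0r add0r addr0 [_%:A]mulr1.
  split=> -[gx gc]; apply: DeriveDef.
  - by case: (derivable1P g x v) => + _; apply.
  - by rewrite -E1.
  - by case: (derivable1P g x v) => _; apply.
  - by rewrite E1.
apply/(line (fun y => h (f y))).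
apply: is_derive1_comp; first by rewrite scale0r add0r.
by apply/line.
Qed.

End Pointwise.

(* Typeclass resolution is disabled: it would solve the subgoals with the
   instances of the library, which unify up to unfolding of [f + g], [f * g]. *)
Ltac derive_step :=
  first [ eassumption
        | notypeclasses refine (derive_cstf _ _ _)
        | notypeclasses refine (is_derive_id _ _)
        | notypeclasses refine (derive_sqrf _)
        | notypeclasses refine (derive_oppf _)
        | notypeclasses refine (derive_subf _ _)
        | notypeclasses refine (derive_addf _ _)
        | notypeclasses refine (derive_mulf _ _)
        | notypeclasses refine (derive_invf _ _)
        | notypeclasses refine (derive_compf _ _) ].
Ltac derive_tac :=
  notypeclasses refine (is_derive_eq _ _);
  [repeat derive_step | cbv beta; rewrite ?[id _]/= ].

(** * Neighbourhood consequences of continuity *)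

Lemma near_comp (T U : topologicalType) (g : T -> U) (x : T) (P : U -> Prop) :
  {for x, continuous g} -> (\forall y \near g x, P y) -> \forall z \near x, P (g z).
Proof. by move=> gc; exact: gc. Qed.

Lemma near_dist (T : topologicalType) (R : realType) (V : normedModType R)
    (g : T -> V) (x : T) (e : R) : {for x, continuous g} -> 0 < e ->
  \forall y \near x, `|g y - g x| < e.
Proof.
move=> gc e0; near=> y; rewrite distrC; near: y.
exact: (@cvgr_dist_lt _ _ _ (nbhs x) _ g (g x) gc e e0).
Unshelve. all: by end_near. Qed.

Lemma near_gt0 (T : topologicalType) (R : realType) (g : T -> R) (x : T) :
  {for x, continuous g} -> 0 < g x -> \forall y \near x, 0 < g y.
Proof. by move=> gc g0; exact: (@cvgr_gt _ _ (nbhs x) _ g (g x) gc 0 g0). Qed.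

Lemma near_neq0 (T : topologicalType) (R : realType) (g : T -> R) (x : T) :
  {for x, continuous g} -> g x != 0 -> \forall y \near x, g y != 0.
Proof. by move=> gc g0; exact: (@cvgr_neq0 _ _ _ (nbhs x) _ g (g x) gc g0). Qed.

(** * Continuation, quadrature, inversion and uniqueness on the real line *)

Section RealLine.
Variable R : realType.
Implicit Types (h : R -> R) (J : set R) (x y s : R).

(** Continuation principle, by connectedness of [J]. Global uniqueness, confinement of null
    geodesics to a surface and maximality of the principal curves are all deduced from it. *)
Lemma interval_clopen J (A : set R) (s0 : R) : is_interval J -> J s0 -> A s0 ->
  (forall s, J s -> A s -> \forall s' \near s, J s' -> A s') ->
  (forall s, J s -> closure (J `&` A) s -> A s) -> J `<=` A.
Proof.
move=> /connected_intervalP cJ Js0 As0 Aop Acl.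
have <- : J `&` A = J; last by move=> s [].
apply: cJ.
- by exists s0.
- exists (interior [set s' | J s' -> A s']); first exact: open_interior.
  apply/seteqP; split=> s [Js As]; split=> //; first exact: Aop.
  exact: (interior_subset As).
- exists (closure (J `&` A)); first exact: closed_closure.
  apply/seteqP; split=> s [Js As]; split=> //; last exact: Acl.
  exact: subset_closure.
Qed.

Lemma is_derive1_continuous (V : normedModType R) (g : R -> V) s d :
  is_derive s (1 : R) g d -> {for s, continuous g}.
Proof.
by move=> gd; apply/differentiable_continuous/derivable1_diffP; apply: ex_derive.
Qed.

Lemma antiderivative J h (s0 : R) : open J -> is_interval J -> J s0 ->
  (forall s, J s -> {for s, continuous h}) ->
  exists2 F : R -> R, F s0 = 0 & forall s, J s -> is_derive s (1 : R) F (h s).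
Proof.
move=> oJ iJ Js0 hc.
pose mu := @lebesgue_measure R.
pose F y := if s0 <= y then \int[mu]_(t in `]s0, y]) h t
            else - \int[mu]_(t in `]y, s0]) h t.
exists F; first by rewrite /F lexx set_itvoc0 Rintegral_set0.
move=> s Js.
have [e /= e0 sJ] : exists2 e : R, 0 < e &
    forall y, s - e <= y <= s + e \/ s0 - e <= y <= s0 + e -> J y.
  have /nbhs_ballP[e1 /= e10 b1] : nbhs s J by apply: open_nbhs_nbhs.
  have /nbhs_ballP[e2 /= e20 b2] : nbhs s0 J by apply: open_nbhs_nbhs.
  exists (Num.min e1 e2 / 2); first by rewrite divr_gt0// lt_min e10.
  have m1 : Num.min e1 e2 <= e1 by rewrite ge_min lexx.
  have m2 : Num.min e1 e2 <= e2 by rewrite ge_min lexx orbT.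
  have m0 : 0 < Num.min e1 e2 by rewrite lt_min e10.
  by move=> y [] /andP[y1 y2]; [apply: b1|apply: b2];
    rewrite /ball/= ltr_norml; apply/andP; split; lra.
(* With the common lower end [a] below both points, the signed integral from [s0] becomes a
   difference of two integrals, and the fundamental theorem on [[a, b]] applies on either side of
   [s0]. *)
pose a := Num.min s s0 - e; pose b := Num.max s s0 + e.
have as_ : a <= s - e by rewrite lerD2r ge_min lexx.
have as0 : a <= s0 - e by rewrite lerD2r ge_min lexx orbT.
have sb : s + e <= b by rewrite lerD2r le_max lexx.
have s0b : s0 + e <= b by rewrite lerD2r le_max lexx orbT.
have Ja : J a.
  rewrite /a; case: (lerP s s0) => _; apply: sJ; [left|right]; lra.
have Jb : J b.
  rewrite /b; case: (lerP s s0) => _; apply: sJ; [right|left]; lra.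
have Jab y : a <= y <= b -> J y by apply: iJ.
have hint y z : a <= y -> z <= b -> mu.-integrable `[y, z] (EFin \o h).
  move=> ay zb; apply: continuous_compact_integrable; first exact: segment_compact.
  apply: continuous_in_subspaceT => x; rewrite inE/= in_itv/= => /andP[yx xz].
  by apply: hc; apply: Jab; rewrite (le_trans ay yx) (le_trans xz zb).
have FE y : a <= y <= b ->
    F y = \int[mu]_(t in `[a, y]) h t - \int[mu]_(t in `[a, s0]) h t.
  move=> /andP[ay yb]; rewrite /F; case: lerP => s0y.
    by rewrite (@Rintegral_itvB _ h (BLeft a) (BRight y) s0)//= ?bnd_simp//;
      [exact: hint|lra].
  rewrite -(@Rintegral_itvB _ h (BLeft a) (BRight s0) y) ?bnd_simp// ?opprB//.
  - by apply: hint => //; lra.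
  - by lra.
have [|||dF F'E] := @continuous_FTC1_closed _ h a s b _ (hint _ _ (lexx a) (lexx b)).
- by lra.
- by lra.
- by apply: hc.
pose G y := \int[mu]_(t in `[a, y]) h t - \int[mu]_(t in `[a, s0]) h t.
apply: (@near_eq_is_derive _ _ _ G).
  near=> y; apply/esym/FE.
  have : `|s - y| < e by near: y; apply: nbhsx_ballx.
  by rewrite ltr_norml => /andP[? ?]; apply/andP; split; lra.
rewrite -[h s]subr0; apply: is_deriveB.
rewrite -F'E derive1E; exact: derivableP dF.
Unshelve. all: by end_near. Qed.

Lemma MVT_le h h1 (a b : R) : a <= b ->
  (forall x, a <= x <= b -> is_derive x (1 : R) h (h1 x)) ->
  exists2 c, a <= c <= b & h b - h a = h1 c * (b - a).
Proof.
move=> ab hd.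
have [||c cab ->] := @MVT_segment _ h h1 a b ab.
- by move=> x; rewrite in_itv/= => /andP[? ?]; apply: hd; rewrite !ltW.
- apply: continuous_in_subspaceT => x; rewrite inE/= in_itv/= => xab.
  by apply: is_derive1_continuous; apply: hd.
- by exists c => //; rewrite in_itv in cab.
Qed.

(** [e s * expR (- C * s)] is nonincreasing and [e s * expR (C * s)] is nondecreasing. Both are
    nonnegative and vanish at [s0], so the first vanishes to the right of [s0] and the second to the
    left. *)
Lemma gronwall_zero (e e1 : R -> R) (C s0 d : R) : 0 <= C -> e s0 = 0 ->
  (forall s, `|s - s0| < d -> [/\ 0 <= e s, is_derive s (1 : R) e (e1 s)
     & `|e1 s| <= C * e s]) ->
  forall s, `|s - s0| < d -> e s = 0.
Proof.
move=> C0 es0 H s sd; have [es _ _] := H s sd.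
apply/eqP; rewrite eq_le es andbT.
have ode c x : `|x - s0| < d ->
    is_derive x (1 : R) (fun y => e y * expR (c * y))
      (e1 x * expR (c * x) + e x * (expR (c * x) * c)).
  move=> xd; have [_ ed _] := H x xd.
  apply: derive_mulf => //; have := is_derive_expR (c * x) => xe.
  by derive_tac; ring.
have [s0s|ss0] := leP s0 s.
  have [x xs|c /andP[c1 c2]] := MVT_le s0s (fun x xs => ode (- C) x (_ x xs)).
    by move: sd xs; rewrite !ltr_norml => /andP[? ?] /andP[? ?]; apply/andP; split; lra.
  have cd : `|c - s0| < d.
    by move: sd; rewrite !ltr_norml => /andP[? ?]; apply/andP; split; lra.
  have [ec _ e1c] := H c cd.
  rewrite es0 mul0r subr0 => E.
  have : e s * expR (- C * s) <= 0.
    rewrite E [X in X * _](_ : _ = (e1 c - C * e c) * expR (- C * c)); last by ring.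
    rewrite mulr_le0_ge0 ?subr_ge0// mulr_le0_ge0 ?expR_ge0//.
    have := ler_norm (e1 c); lra.
  by rewrite pmulr_lle0 ?expR_gt0.
have [x xs|c /andP[c1 c2]] := MVT_le (ltW ss0) (fun x xs => ode C x (_ x xs)).
  by move: sd xs; rewrite !ltr_norml => /andP[? ?] /andP[? ?]; apply/andP; split; lra.
have cd : `|c - s0| < d.
  by move: sd; rewrite !ltr_norml => /andP[? ?]; apply/andP; split; lra.
have [ec _ e1c] := H c cd.
rewrite es0 mul0r sub0r => E.
have : 0 <= - (e s * expR (C * s)).
  rewrite E [X in X * _](_ : _ = (e1 c + C * e c) * expR (C * c)); last by ring.
  rewrite mulr_ge0 ?subr_ge0 ?(ltW ss0)// mulr_ge0 ?expR_ge0//.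
  have := ler_norm (- e1 c); rewrite normrN; lra.
by rewrite oppr_ge0 pmulr_lle0 ?expR_gt0.
Qed.

(** Continuity of [h1] at the single point [x0] fixes its sign nearby, which makes [h] strictly
    monotone there; the negative sign is reduced to the positive one by passing to [- h]. *)
Lemma local_inverse h h1 (x0 : R) :
  (\forall x \near x0, is_derive x (1 : R) h (h1 x)) ->
  {for x0, continuous h1} -> h1 x0 != 0 ->
  exists2 K : R -> R, K (h x0) = x0 &
    \forall y \near h x0, h (K y) = y /\ is_derive y (1 : R) K (h1 (K y))^-1.
Proof.
move=> hd h1c h1n.
wlog h1p : h h1 hd h1c h1n / 0 < h1 x0.
  move=> W; have [h1p|] := ltP 0 (h1 x0); first exact: (W h h1).
  rewrite le_eqVlt (negbTE h1n)/= => h1l.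
  have [||||K KE HK] := W (fun x => - h x) (fun x => - h1 x).
  - by apply: filterS hd => x ?; apply: is_deriveN.
  - by apply: continuousN.
  - by rewrite oppr_eq0.
  - by rewrite oppr_gt0.
  exists (fun y => K (- y)); first by rewrite KE.
  have {}HK : \forall y \near h x0, - h (K (- y)) = - y /\
      is_derive (- y) (1 : R) K (- h1 (K (- y)))^-1.
    exact: (@oppr_continuous _ _ (h x0) _ HK).
  apply: filterS HK => y [E D].
  split; first by apply: oppr_inj.
  have N : is_derive y (1 : R) (fun z : R => - z) (-1) by apply: is_deriveN.
  apply: is_derive_eq (derive_compf D N) _.
  by rewrite invrN mulrNN mulr1.
have [d /= d0 Hd] : exists2 d : R, 0 < d & forall x, `|x - x0| <= d ->
    is_derive x (1 : R) h (h1 x) /\ 0 < h1 x.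
  have /nbhs_ballP[d /= d0 Hd] :
      \forall x \near x0, is_derive x (1 : R) h (h1 x) /\ 0 < h1 x.
    have h1near : \forall x \near x0, 0 < h1 x by exact: near_gt0.
    by apply: filterS2 hd h1near => x ? ?; split.
  exists (d / 2); first exact: divr_gt0.
  by move=> x xd; apply: Hd; rewrite /ball/= distrC; lra.
have mono (x y : R) : `|x - x0| <= d -> `|y - x0| <= d -> x < y -> h x < h y.
  move=> xd yd xy.
  have sub z : x <= z <= y -> `|z - x0| <= d.
    by move: xd yd; rewrite !ler_norml => /andP[? ?] /andP[? ?] /andP[? ?];
      apply/andP; split; lra.
  have [z zd|c cd E] := @MVT_le h h1 x y (ltW xy).
    by have [] := Hd _ (sub _ zd).
  have [_ h1c0] := Hd _ (sub _ cd).
  by rewrite -subr_gt0 E mulr_gt0// subr_gt0.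
(* [K] selects the preimage in the closed ball, unique by [mono]; the default [x0] is taken only off
   the image of that ball. *)
pose K y := xget x0 [set x | `|x - x0| <= d /\ h x = y].
have hK (x : R) : `|x - x0| <= d -> K (h x) = x.
  move=> xd; rewrite /K; case: xgetP => [z _ [zd hz]|/(_ x)]; last by case.
  case: (ltgtP z x) => // zx.
    by have := mono _ _ zd xd zx; rewrite hz ltxx.
  by have := mono _ _ xd zd zx; rewrite hz ltxx.
have nearD (x : R) : `|x - x0| < d -> \forall z \near x, `|z - x0| < d.
  move=> xd; apply: (@open_nbhs_nbhs _ x [set z | `|z - x0| < d]); split=> //.
  rewrite (_ : [set z : R | _] = ball x0 d); first exact: ball_open.
  by apply/seteqP; split=> z/=; rewrite /ball/= distrC.
have canK (x : R) : `|x - x0| < d -> {near x, cancel h K}.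
  by move=> /nearD; apply: filterS => z zd; apply: hK; exact: ltW.
have ctsh (x : R) : `|x - x0| < d -> {near x, continuous h}.
  move=> /nearD; apply: filterS => z zd; have [hz _] := Hd z (ltW zd).
  exact: is_derive1_continuous hz.
have x0d : `|x0 - x0| < d by rewrite subrr normr0.
have Kx0 : K (h x0) = x0 by apply: hK; apply: ltW.
exists K => //.
have Kc : {for h x0, continuous K}.
  exact: nbhs_singleton (near_can_continuous (canK _ x0d) (ctsh _ x0d)).
near=> y.
have Kyd : `|K y - x0| < d.
  near: y; apply: (Kc [set z | `|z - x0| < d]); rewrite Kx0.
  exact: nearD.
have yE : h (K y) = y.
  by near: y; exact: near_continuous_can_sym (ctsh _ x0d) (canK _ x0d).
split=> //.
rewrite -{1}yE.
have [Dh hp] := Hd _ (ltW Kyd).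
apply: (is_derive_inverse (canK _ Kyd) (ctsh _ Kyd) Dh).
by rewrite gt_eqF.
Unshelve. all: by end_near. Qed.

(** Separation of variables: time as a function of position is an antiderivative of [1 / h], and the
    solution is its local inverse. *)
Lemma autonomous_ode h (y0 : R) :
  (\forall y \near y0, {for y, continuous h}) -> h y0 != 0 ->
  exists2 u : R -> R, u 0 = y0 & \forall s \near (0 : R), is_derive s (1 : R) u (h (u s)).
Proof.
move=> hc hn.
have /nbhs_ballP[d /= d0 Hd] :
    \forall y \near y0, {for y, continuous h} /\ h y != 0.
  have hnear : \forall y \near y0, h y != 0.
    by apply: near_neq0 => //; exact: nbhs_singleton hc.
  by apply: filterS2 hc hnear => y ? ?; split.
have hVc (y : R) : ball y0 d y -> {for y, continuous (fun y => (h y)^-1)}.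
  by move=> /Hd[? ?]; apply: continuousV.
have [||F F0 FE] := antiderivative _ _ (ballxx y0 d0) hVc.
- exact: ball_open.
- by rewrite ball_itv; exact: interval_is_interval.
have ny0 : \forall y \near y0, ball y0 d y by exact: nbhsx_ballx.
have [|||K K0 HK] := @local_inverse F (fun y => (h y)^-1) y0.
- by apply: filterS ny0 => y /FE.
- by apply: hVc; exact: ballxx.
- by rewrite invr_eq0.
rewrite F0 in K0 HK.
by exists K => //; apply: filterS HK => y [_]; rewrite invrK.
Unshelve. all: by end_near. Qed.

(** Separation of variables in [u] breaks down at a turning point [m = 0]. When [G y0] is nonzero
    the velocity is therefore taken as the unknown: [u] is the inverse of [Phi] at [u1 ^+ 2], and
    [u1] solves a first-order equation whose right-hand side does not vanish. *)
Lemma newton_ode (Phi G : R -> R) (y0 m : R) :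
  (\forall y \near y0, is_derive y (1 : R) Phi (2 * G y)) ->
  (\forall y \near y0, {for y, continuous G}) -> m ^+ 2 = Phi y0 ->
  exists u u1 : R -> R, [/\ u 0 = y0, u1 0 = m &
    \forall s \near (0 : R), [/\ is_derive s (1 : R) u (u1 s),
      is_derive s (1 : R) u1 (G (u s)) & u1 s ^+ 2 = Phi (u s)]].
Proof.
move=> Phid Gc mE.
have Gc0 := nbhs_singleton Gc.
have [G0|G0] := eqVneq (G y0) 0; last first.
  have [||K K0 HK] := @local_inverse Phi (fun y => 2 * G y) y0 Phid.
  - by apply: continuousM => //; exact: cst_continuous.
  - by rewrite mulf_neq0.
  rewrite -mE in K0 HK.
  have sqc x : {for x, continuous (fun x : R => x ^+ 2)}.
    exact: exprn_continuous.
  pose P x := [/\ Phi (K (x ^+ 2)) = x ^+ 2,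
     is_derive (x ^+ 2) (1 : R) K (2 * G (K (x ^+ 2)))^-1,
     {for K (x ^+ 2), continuous G} & G (K (x ^+ 2)) != 0].
  have Kc : {for m ^+ 2, continuous K}.
    by have [_ Kd] := nbhs_singleton HK; exact: is_derive1_continuous Kd.
  have nP : \forall x \near m, P x.
    have Gn : \forall y \near y0, {for y, continuous G} /\ G y != 0.
      have Gn : \forall y \near y0, G y != 0.
        exact: near_neq0.
      by apply: filterS2 Gc Gn => y ? ?; split.
    have nK : \forall y \near m ^+ 2, {for K y, continuous G} /\ G (K y) != 0.
      by rewrite -K0 in Gn; exact: (near_comp Kc Gn).
    apply: filterS (near_comp (sqc m) (filterI HK nK)).
    by move=> x /= [[? ?] [? ?]]; split.
  have nqc : \forall x \near m, {for x, continuous (fun x => G (K (x ^+ 2)))}.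
    apply: filterS nP => x [_ Kd KG _].
    apply: (@continuous_comp _ _ _ (fun x : R => x ^+ 2) (fun y => G (K y))).
      exact: sqc.
    by apply: continuous_comp => //; exact: is_derive1_continuous Kd.
  have [|q q0 qd] := autonomous_ode nqc; first by rewrite K0.
  exists (fun s => K (q s ^+ 2)), q; split=> //; first by rewrite q0.
  have qc : {for 0, continuous q}.
    by apply: is_derive1_continuous; exact: nbhs_singleton qd.
  rewrite -q0 in nP; have nPq := near_comp qc nP.
  apply: filterS2 qd nPq => s qs [E Kd _ Gn]; split=> //.
  derive_tac.
  by rewrite invfM; field.
(* Here [G y0 = 0]; with zero velocity this is an equilibrium, solved by a constant. *)
have [m0|m0] := eqVneq m 0.
  exists (fun=> y0), (fun=> 0); split=> //.
  near=> s; split; first exact: is_derive_cst.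
    by rewrite G0; exact: is_derive_cst.
  by rewrite -mE m0.
(* Away from turning points the velocity is the root of the first integral that has the sign of
   [m]. *)
pose h y := Num.sg m * Num.sqrt (Phi y).
have Phi0 : 0 < Phi y0 by rewrite -mE exprn_even_gt0.
have nPhi : \forall y \near y0, 0 < Phi y.
  apply: near_gt0 => //.
  exact: is_derive1_continuous (nbhs_singleton Phid).
have hd : \forall y \near y0, is_derive y (1 : R) h (Num.sg m * (G y / Num.sqrt (Phi y))).
  apply: filterS2 Phid nPhi => y Py Py0.
  have sd := is_derive1_sqrt Py0.
  rewrite /h; derive_tac.
  rewrite mul0r add0r; congr (_ * _).
  by rewrite invfM; field; rewrite gt_eqF ?sqrtr_gt0.
have hm : h y0 = m by rewrite /h -mE sqrtr_sqr -numEsg.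
have [||u u0 ud] := @autonomous_ode h y0.
- by apply: filterS hd => y; exact: is_derive1_continuous.
- by rewrite hm.
exists u, (fun s => h (u s)); split => //; first by rewrite u0.
have uc : {for 0, continuous u}.
  by apply: is_derive1_continuous; exact: nbhs_singleton ud.
rewrite -u0 in hd nPhi.
have nu : \forall s \near (0 : R), is_derive (u s) (1 : R) h
    (Num.sg m * (G (u s) / Num.sqrt (Phi (u s)))) /\ 0 < Phi (u s).
  exact: (near_comp uc (filterI hd nPhi)).
apply: filterS2 ud nu => s us [hs Ps]; split=> //.
  apply: (is_derive_eq (derive_compf hs us)).
  rewrite /h [LHS](_ : _ = Num.sg m ^+ 2 * (Num.sqrt (Phi (u s)) / Num.sqrt (Phi (u s))) * G (u s)).
    by rewrite divff ?gt_eqF ?sqrtr_gt0// sqr_sg m0 !mul1r.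
  by ring.
by rewrite /h exprMn sqr_sg m0 mul1r sqr_sqrtr ?ltW.
Unshelve. all: by end_near. Qed.

(* The factor [a] lets an integral curve be compared with a reparametrisation
   of another one. *)
Lemma ode_unique_local (V : R -> R -> R) (a r q y p : R -> R) (K d s0 : R) :
  0 <= K -> 0 < d -> r s0 = y s0 -> q s0 = p s0 ->
  (forall r1 q1 y1 p1, `|r1 - r s0| < d -> `|q1 - q s0| < d ->
     `|y1 - r s0| < d -> `|p1 - q s0| < d ->
     `|V r1 q1 - V y1 p1| <= K * (`|r1 - y1| + `|q1 - p1|)) ->
  {for s0, continuous a} ->
  (\forall s \near s0, [/\ is_derive s (1 : R) r (a s * q s),
     is_derive s (1 : R) q (a s * V (r s) (q s)),
     is_derive s (1 : R) y (a s * p s) &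
     is_derive s (1 : R) p (a s * V (y s) (p s))]) ->
  \forall s \near s0, r s = y s /\ q s = p s.
Proof.
move=> K0 d0 ry qp LV ac ode.
have [rc qc yc pc] : [/\ {for s0, continuous r}, {for s0, continuous q},
    {for s0, continuous y} & {for s0, continuous p}].
  by have [? ? ? ?] := nbhs_singleton ode; split; apply: is_derive1_continuous.
have close (g : R -> R) : {for s0, continuous g} -> \forall s \near s0, `|g s - g s0| < d.
  by move=> gc; exact: near_dist.
pose M := `|a s0| + 1.
have aM : \forall s \near s0, `|a s| < M.
  apply: filterS (near_dist ac ltr01) => s; rewrite /M => as1.
  have := ler_normD (a s - a s0) (a s0); rewrite subrK; lra.
have yc' := close _ yc; have pc' := close _ pc; rewrite -ry -qp in yc' pc'.
have [e /= e0 He] : exists2 e : R, 0 < e & forall s, `|s - s0| < e ->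
    [/\ is_derive s (1 : R) r (a s * q s),
     is_derive s (1 : R) q (a s * V (r s) (q s)),
     is_derive s (1 : R) y (a s * p s) &
     is_derive s (1 : R) p (a s * V (y s) (p s))] /\
    [/\ `|r s - r s0| < d, `|q s - q s0| < d, `|y s - r s0| < d,
     `|p s - q s0| < d & `|a s| < M].
  have /nbhs_ballP[e /= e0 He] : \forall s \near s0,
    [/\ is_derive s (1 : R) r (a s * q s),
     is_derive s (1 : R) q (a s * V (r s) (q s)),
     is_derive s (1 : R) y (a s * p s) &
     is_derive s (1 : R) p (a s * V (y s) (p s))] /\
    [/\ `|r s - r s0| < d, `|q s - q s0| < d, `|y s - r s0| < d,
     `|p s - q s0| < d & `|a s| < M].
    near=> s; split; first by near: s.
    split; near: s => //; exact: close.
  by exists e => // s se; apply: He; rewrite /ball/= distrC.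
pose w s := r s - y s; pose z s := q s - p s.
have key : forall s, `|s - s0| < e -> w s ^+ 2 + z s ^+ 2 = 0.
  (* The derivative is [a] times [2 w z + 2 z D], where [D] is the difference of the two values of
     [V], bounded by [K] times the sum of the absolute values of [w] and [z]. As twice the product
     of these is at most [w ^+ 2 + z ^+ 2], the factor is [1 + 3 K], and [M] bounds [a]. *)
  apply: (@gronwall_zero (fun s => w s ^+ 2 + z s ^+ 2)
    (fun s => a s * (2 * w s * z s + 2 * z s * (V (r s) (q s) - V (y s) (p s))))
    (M * (1 + 3 * K))).
  - by rewrite mulr_ge0 ?addr_ge0 ?mulr_ge0// /M addr_ge0.
  - by rewrite /w /z ry qp !subrr expr0n/= addr0.
  move=> s /He[[rd qd yd pd] [r1 q1 y1 p1 as1]]; split.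
  - by rewrite addr_ge0 ?sqr_ge0.
  - by rewrite /w /z; derive_tac; ring.
  have := LV _ _ _ _ r1 q1 y1 p1; rewrite -/(w s) -/(z s).
  set D := V _ _ - V _ _ => DK.
  rewrite normrM -[leRHS]mulrA; apply: ler_pM => //; first exact: (ltW as1).
  have -> : w s ^+ 2 + z s ^+ 2 = `|w s| ^+ 2 + `|z s| ^+ 2 by rewrite !real_normK ?num_real.
  apply: (le_trans (ler_normD _ _)); rewrite !normrM ger0_norm//.
  have : `|z s| * `|D| <= `|z s| * (K * (`|w s| + `|z s|)) by rewrite ler_wpM2l.
  have := normr_ge0 (w s); have := normr_ge0 (z s).
  have := sqr_ge0 (`|w s| - `|z s|).
  have : 0 <= K * (`|w s| - `|z s|) ^+ 2 by rewrite mulr_ge0 ?sqr_ge0.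
  have : 0 <= K * `|w s| ^+ 2 by rewrite mulr_ge0 ?sqr_ge0.
  nra.
have : \forall s \near s0, `|s - s0| < e.
  by apply: filterS (nbhsx_ballx s0 e e0) => s; rewrite /ball/= distrC.
apply: filterS => s /key /eqP.
rewrite paddr_eq0 ?sqr_ge0// !sqrf_eq0 !subr_eq0 => /andP[/eqP-> /eqP->].
by [].
Unshelve. all: by end_near. Qed.

End RealLine.

(** * Smooth functions *)

Lemma near_eq_continuous (T U : topologicalType) (g h : T -> U) (x : T) :
  (\forall y \near x, g y = h y) -> {for x, continuous g} -> {for x, continuous h}.
Proof.
move=> gh gc; have ghx := nbhs_singleton gh; move: gc.
rewrite /prop_for /continuous_at -ghx; apply: cvg_trans.
exact: near_eq_cvg.
Qed.

Section CkFunctions.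
Variables (R : realType) (E : normedModType R).
Implicit Types (U : set E) (g h : E -> R) (k : nat).

(** [Ck] speaks of the function ['D_v h] on all of [E], while a formula [h'] for it is valid on [U]
    only. Since [U] is open, [Ck U] depends only on values on [U], which is the inner claim
    [CkE]. *)
Lemma CkS U k h (h' : E -> E -> R) : open U ->
  (forall x, U x -> {for x, continuous h}) ->
  (forall x v, U x -> is_derive x v h (h' v x)) ->
  (forall v, Ck U k (h' v)) -> Ck U k.+1 h.
Proof.
move=> oU hc hd Ckh'; split=> //; split=> [x v Ux|v].
  by apply: ex_derive; exact: hd.
suff CkE : forall j (g1 g2 : E -> R), (forall x, U x -> g1 x = g2 x) ->
    Ck U j g1 -> Ck U j g2.
  by apply: CkE (Ckh' v) => x Ux; have /@derive_val -> := hd x v Ux.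
elim=> [|j IH] g1 g2 g12.
all: have g12x x : U x -> \forall y \near x, g1 y = g2 y by
  move=> Ux; apply: filterS (open_nbhs_nbhs (conj oU Ux)) => y; exact: g12.
  by move=> [g1c _]; split=> // x Ux; apply: near_eq_continuous (g1c x Ux); exact: g12x.
move=> [g1c [g1d g1D]]; split=> [x Ux|].
  by apply: near_eq_continuous (g1c x Ux); exact: g12x.
split=> [x w Ux|w].
  by apply: near_eq_derivable (g1d x w Ux); exact: g12x.
by apply: IH (g1D w) => x Ux; apply: near_eq_derive; exact: g12x.
Qed.

Lemma Ck_pred U k h : Ck U k.+1 h -> Ck U k h.
Proof.
elim: k h => [|k IH] h [hc [hd hD]]; first by split.
by split=> //; split=> // v; exact: IH.
Qed.

Lemma Ck_continuous U k h x : Ck U k h -> U x -> {for x, continuous h}.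
Proof. by case: k => [|k] []; auto. Qed.

Lemma Ck_is_derive U k h x v : Ck U k.+1 h -> U x -> is_derive x v h ('D_v h x).
Proof. by move=> [_ [hd _]] Ux; exact/derivableP/hd. Qed.

Lemma Ck_cst U k (c : R) : open U -> Ck U k (fun=> c).
Proof.
move=> oU; elim: k c => [|k IH] c; first by split=> // x _; exact: cst_continuous.
apply: (@CkS _ _ _ (fun _ _ => 0)) => //; first by move=> x _; exact: cst_continuous.
Qed.

Lemma Ck_add U k g h : open U -> Ck U k g -> Ck U k h ->
  Ck U k (fun x => g x + h x).
Proof.
move=> oU; elim: k g h => [|k IH] g h Cg Ch.
  by split=> // x Ux; apply: continuousD; apply: Ck_continuous Ux; eassumption.
apply: (@CkS _ _ _ (fun v x => 'D_v g x + 'D_v h x)) => //.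
- by move=> x Ux; apply: continuousD; apply: Ck_continuous Ux; eassumption.
- by move=> x v Ux; apply: derive_addf; apply: Ck_is_derive Ux; eassumption.
- by move=> v; apply: IH; [case: Cg|case: Ch] => _ [_]; apply.
Qed.

Lemma Ck_mul U k g h : open U -> Ck U k g -> Ck U k h ->
  Ck U k (fun x => g x * h x).
Proof.
move=> oU; elim: k g h => [|k IH] g h Cg Ch.
  by split=> // x Ux; apply: continuousM; apply: Ck_continuous Ux; eassumption.
apply: (@CkS _ _ _ (fun v x => 'D_v g x * h x + g x * 'D_v h x)) => //.
- by move=> x Ux; apply: continuousM; apply: Ck_continuous Ux; eassumption.
- by move=> x v Ux; apply: derive_mulf; apply: Ck_is_derive Ux; eassumption.
- move=> v; apply: Ck_add => //; apply: IH; try exact: Ck_pred.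
  + by case: Cg => _ [_]; apply.
  + by case: Ch => _ [_]; apply.
Qed.

Lemma Ck_sub U k g h : open U -> Ck U k g -> Ck U k h ->
  Ck U k (fun x => g x - h x).
Proof.
move=> oU Cg Ch; rewrite (_ : (fun x => _) = fun x => g x + (-1) * h x).
  by apply: Ck_add => //; apply: Ck_mul => //; exact: Ck_cst.
by apply/funext => x; rewrite mulN1r.
Qed.

Lemma Ck_inv U k h : open U -> (forall x, U x -> h x != 0) -> Ck U k h ->
  Ck U k (fun x => (h x)^-1).
Proof.
move=> oU h0; elim: k => [|k IH] Ch.
  by split=> // x Ux; apply: continuousV; [exact: h0|exact: (Ck_continuous Ch Ux)].
(* The derivative is again built from the inverse, now required to one order less, which the
   induction supplies. *)
apply: (@CkS _ _ _ (fun v x => (0 - 'D_v h x) * ((h x)^-1 * (h x)^-1))) => //.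
- by move=> x Ux; apply: continuousV; [exact: h0|exact: (Ck_continuous Ch Ux)].
- move=> x v Ux; apply: is_derive_eq.
    by apply: derive_invf; [exact: h0|exact: (Ck_is_derive v Ch Ux)].
  by rewrite sub0r expr2 invfM.
- move=> v; have CI := IH (Ck_pred Ch).
  apply: Ck_mul (Ck_mul oU CI CI) => //; apply: Ck_sub => //; first exact: Ck_cst.
  by case: Ch => _ [_]; apply.
Qed.

End CkFunctions.

Lemma Ck_comp (R : realType) (E : normedModType R) (U : set E) (W : set R) k
    (h : R -> R) (g : E -> R) : open U -> open W -> (forall x, U x -> W (g x)) ->
  Ck W k h -> Ck U k g -> Ck U k (fun x => h (g x)).
Proof.
move=> oU oW UW; elim: k h => [|k IH] h Ch Cg.
  split=> // x Ux; apply: (@continuous_comp _ _ _ g h).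
    exact: (Ck_continuous Cg Ux).
  by apply: (Ck_continuous Ch); exact: UW.
apply: (@CkS _ _ _ _ _ (fun v x => 'D_1 h (g x) * 'D_v g x)) => //.
- move=> x Ux; apply: (@continuous_comp _ _ _ g h).
    exact: (Ck_continuous Cg Ux).
  by apply: (Ck_continuous Ch); exact: UW.
- move=> x v Ux; apply: derive_compf; last exact: (Ck_is_derive v Cg Ux).
  by apply: (Ck_is_derive _ Ch); exact: UW.
- move=> v; apply: Ck_mul => //; last by case: Cg => _ [_]; apply.
  by apply: (IH ('D_1 h)); [case: Ch => _ [_]; apply|exact: Ck_pred].
Qed.

Lemma CkS_line (R : realType) (T : set R) k (h h1 : R -> R) : open T ->
  (forall t, T t -> is_derive t (1 : R) h (h1 t)) -> Ck T k h1 -> Ck T k.+1 h.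
Proof.
move=> oT hd Ch1; apply: (@CkS R R T k h (fun v t : R => v * h1 t) oT).
- by move=> t Tt; exact: is_derive1_continuous (hd t Tt).
- move=> t v Tt; rewrite mulrC.
  exact: (derive_compf (hd t Tt) (is_derive_id t v)).
- by move=> v; apply: Ck_mul => //; exact: Ck_cst.
Qed.

(** The mean value theorem, with the derivative bounded near [x0] by its absolute value at [x0] plus
    one. *)
Lemma Ck1_lipschitz (R : realType) (U : set R) (h : R -> R) (x0 : R) :
  open U -> U x0 -> Ck U 1 h -> exists K d : R, [/\ 0 <= K, 0 < d &
    forall x y : R, `|x - x0| < d -> `|y - x0| < d -> `|h x - h y| <= K * `|x - y|].
Proof.
move=> oU Ux0 Ch.
have hc : {for x0, continuous ('D_(1 : R) h)}.
  by case: Ch => _ [_ /(_ 1)] [Dc _]; exact: Dc.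
pose K := `|'D_(1 : R) h x0| + 1.
have hK : \forall x \near x0, U x /\ `|'D_(1 : R) h x| < K.
  apply: filterS2 (open_nbhs_nbhs (conj oU Ux0)) (near_dist hc ltr01) => x Ux hx1.
  split=> //.
  have := ler_normD ('D_(1 : R) h x - 'D_(1 : R) h x0) ('D_(1 : R) h x0).
  rewrite subrK /K; lra.
have /nbhs_ballP[d /= d0 Hd] := hK.
exists K, d; split=> //; first by rewrite /K addr_ge0.
move=> x y; wlog xy : x y / y <= x.
  move=> W xd yd; have [yx|xy] := leP y x; first exact: W.
  by rewrite distrC [`|x - y|]distrC; apply: W => //; exact: ltW.
move=> xd yd.
have sub (c : R) : y <= c <= x -> U c /\ `|'D_(1 : R) h c| < K.
  move=> cxy; apply: Hd; rewrite /ball/= distrC.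
  by move: xd yd cxy; rewrite !ltr_norml => /andP[? ?] /andP[? ?] /andP[? ?];
    apply/andP; split; lra.
have [c cxy|c cxy ->] := @MVT_le _ h ('D_(1 : R) h) y x xy.
  by apply: (Ck_is_derive _ Ch); have [] := sub c cxy.
by rewrite normrM ler_wpM2r// ltW//; have [] := sub c cxy.
Qed.

Lemma closure_eq_continuous (T : topologicalType) (R : realType) (g h : T -> R)
    (B : set T) x : closure B x -> {for x, continuous g} -> {for x, continuous h} ->
  (forall y, B y -> g y = h y) -> g x = h x.
Proof.
move=> Bx gc hc gh; apply/eqP; rewrite -subr_eq0; apply: contrapT => /negP n0.
have dc : {for x, continuous (fun y => g y - h y)} by exact: continuousB.
by have /Bx[y [/gh ->]] := near_neq0 dc n0; rewrite subrr eqxx.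
Qed.

(** * The slope field and uniqueness of its integral curves *)

Section Profiles.
Variables (R : realType) (I : set R) (f : R -> R).
Hypothesis hS : class_S I f.

Local Notation f1 := ('D_(1 : R) f).

Let openI : open I := class_S_open hS.

Lemma class_S_Ck k : Ck I k f.
Proof. exact: class_S_smooth hS k. Qed.

Lemma class_S_Ck_deriv k : Ck I k f1.
Proof. by have [_ [_ /(_ 1)]] := class_S_Ck k.+1. Qed.

Lemma class_S_neq0 r : I r -> f r != 0.
Proof. by move=> Ir; rewrite gt_eqF// (class_S_f_gt0 hS). Qed.

Lemma class_S_r_gt0 r : I r -> 0 < r.
Proof. exact: class_S_pos hS r. Qed.

Lemma class_S_r_neq0 r : I r -> r != 0.
Proof. by move=> /class_S_r_gt0 r0; rewrite gt_eqF. Qed.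

Lemma class_S_is_derive r : I r -> is_derive r (1 : R) f (f1 r).
Proof. by move=> Ir; exact: (Ck_is_derive (1 : R) (class_S_Ck 1%N) Ir). Qed.

Lemma class_S_continuous r : I r -> {for r, continuous f}.
Proof. by move=> Ir; exact: (Ck_continuous (class_S_Ck 0) Ir). Qed.

(* The null geodesics project to the integral curves of [r' = a q],
   [q' = a * slope_field r q], where [q = dr/dt] and [a = dt/ds]. *)
Definition slope_field (r q : R) : R :=
  (f r ^+ 2 - q ^+ 2) * (r^-1 - f1 r / (2 * f r)) + q ^+ 2 * (f1 r / f r).

(** The slope field is [A r + B r * q ^+ 2]; this form reduces its Lipschitz estimate to
    one-variable estimates for [A] and [B]. *)
Let A r := f r * (f r * r^-1 - f1 r * 2^-1).
Let B r := f1 r * (f r)^-1 * (3 * 2^-1) - r^-1.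

Let slope_fieldE r q : I r -> slope_field r q = A r + B r * q ^+ 2.
Proof.
move=> Ir; rewrite /slope_field /A /B; field.
by rewrite class_S_neq0// class_S_r_neq0.
Qed.

Let Ck_V k : Ck I k (fun r => r^-1).
Proof.
apply: (@Ck_inv R R I k id openI class_S_r_neq0).
case: k => [|k]; first by split=> // x _; exact: cvg_id.
apply: (@CkS_line R I k id (fun=> 1) openI).
exact: Ck_cst.
Qed.

Let Ck_A k : Ck I k A.
Proof.
apply: (Ck_mul openI (class_S_Ck k)); apply: Ck_sub; first exact: openI.
  exact: (Ck_mul openI (class_S_Ck k) (Ck_V k)).
exact: (Ck_mul openI (class_S_Ck_deriv k) (Ck_cst k _ openI)).
Qed.

Let Ck_B k : Ck I k B.
Proof.
apply: Ck_sub; [exact: openI| |exact: Ck_V].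
apply: Ck_mul; [exact: openI| |exact: Ck_cst].
apply: Ck_mul; [exact: openI|exact: class_S_Ck_deriv|].
by apply: Ck_inv; [exact: openI|exact: class_S_neq0|exact: class_S_Ck].
Qed.

Lemma slope_field_lipschitz r0 q0 : I r0 -> exists K d : R, [/\ 0 <= K, 0 < d &
  forall r1 q1 y1 p1, `|r1 - r0| < d -> `|q1 - q0| < d ->
     `|y1 - r0| < d -> `|p1 - q0| < d ->
     `|slope_field r1 q1 - slope_field y1 p1| <= K * (`|r1 - y1| + `|q1 - p1|)].
Proof.
move=> Ir0.
have [KA [dA [KA0 dA0 HA]]] := Ck1_lipschitz openI Ir0 (Ck_A 1).
have [KB [dB [KB0 dB0 HB]]] := Ck1_lipschitz openI Ir0 (Ck_B 1).
have /nbhs_ballP[dI /= dI0 HI] := open_nbhs_nbhs (conj openI Ir0).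
pose d := Num.min (Num.min dA dB) (Num.min dI 1).
(* Since [d <= 1], [Q] bounds both slopes on the ball; [BM] bounds [B] there by its Lipschitz
   constant. *)
pose Q := `|q0| + 1; pose BM := `|B r0| + KB * d.
have d0 : 0 < d by rewrite !lt_min dA0 dB0 dI0 ltr01.
have [ddA ddB ddI d1] : [/\ d <= dA, d <= dB, d <= dI & d <= 1].
  by rewrite /d !ge_min !lexx !orbT.
exists (KA + Q ^+ 2 * KB + 2 * BM * Q), d; split=> //.
  by rewrite !addr_ge0 ?mulr_ge0 ?sqr_ge0 ?addr_ge0 ?mulr_ge0// ltW.
move=> r q y p rd qd yd pd.
have Ir : I r by apply: HI; rewrite /ball/= distrC (lt_le_trans rd).
have Iy : I y by apply: HI; rewrite /ball/= distrC (lt_le_trans yd).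
rewrite !slope_fieldE//.
have -> : A r + B r * q ^+ 2 - (A y + B y * p ^+ 2) =
  (A r - A y) + p ^+ 2 * (B r - B y) + B r * (q - p) * (q + p) by ring.
have qQ : `|q| <= Q.
  have := ler_normD (q - q0) q0; rewrite subrK /Q; lra.
have pQ : `|p| <= Q.
  have := ler_normD (p - q0) q0; rewrite subrK /Q; lra.
have BMr : `|B r| <= BM.
  have := ler_normD (B r - B r0) (B r0); rewrite subrK /BM => h1.
  have := HB r r0 (lt_le_trans rd ddB); rewrite subrr normr0 => /(_ dB0) h2.
  have : KB * `|r - r0| <= KB * d by rewrite ler_wpM2l// ltW.
  lra.
have a1 : `|A r - A y| <= KA * (`|r - y| + `|q - p|).
  apply: (le_trans (HA r y (lt_le_trans rd ddA) (lt_le_trans yd ddA))).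
  by rewrite ler_wpM2l// lerDl.
have a2 : `|p ^+ 2 * (B r - B y)| <= Q ^+ 2 * KB * (`|r - y| + `|q - p|).
  rewrite normrM normrX -mulrA ler_pM ?exprn_ge0//.
    by rewrite ler_pXn2r// ?nnegrE// /Q addr_ge0.
  apply: (le_trans (HB r y (lt_le_trans rd ddB) (lt_le_trans yd ddB))).
  by rewrite ler_wpM2l// lerDl.
have a3 : `|B r * (q - p) * (q + p)| <= 2 * BM * Q * (`|r - y| + `|q - p|).
  rewrite !normrM.
  have -> : 2 * BM * Q * (`|r - y| + `|q - p|) =
    BM * (`|r - y| + `|q - p|) * (Q + Q) by ring.
  apply: ler_pM; rewrite ?mulr_ge0//; last first.
    by apply: (le_trans (ler_normD _ _)); exact: lerD.
  by apply: ler_pM => //; rewrite lerDr.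
rewrite !mulrDl in a1 a2 a3 *.
apply: (le_trans (ler_normD _ _)); apply: lerD => //.
by apply: (le_trans (ler_normD _ _)); apply: lerD => //.
Qed.

(** Local uniqueness propagated along [J]. It serves twice: with [a = 1] it compares two profiles,
    with [a = dt/ds] a null geodesic and a profile. *)
Lemma slope_ode_unique (J : set R) (a r q y p : R -> R) (s0 : R) :
  open J -> is_interval J -> J s0 -> r s0 = y s0 -> q s0 = p s0 ->
  (forall s, J s -> [/\ {for s, continuous a}, I (r s) & I (y s)]) ->
  (forall s, J s -> [/\ is_derive s (1 : R) r (a s * q s),
     is_derive s (1 : R) q (a s * slope_field (r s) (q s)),
     is_derive s (1 : R) y (a s * p s) &
     is_derive s (1 : R) p (a s * slope_field (y s) (p s))]) ->
  forall s, J s -> r s = y s /\ q s = p s.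
Proof.
move=> oJ iJ Js0 ry qp aI ode.
apply: (interval_clopen (A := [set s | r s = y s /\ q s = p s]) iJ Js0) => //.
  move=> s Js /= [rys qps]; have [ac Irs Iys] := aI s Js.
  have [K [d [K0 d0 HK]]] := slope_field_lipschitz (q s) Irs.
  have H := ode_unique_local K0 d0 rys qps HK ac.
  have {}H : \forall z \near s, r z = y z /\ q z = p z.
    by apply: H; apply: filterS (open_nbhs_nbhs (conj oJ Js)) => z; exact: ode.
  by apply: filterS H => z.
move=> s Js cl; have [? ? ? ?] := ode s Js; split.
- apply: (closure_eq_continuous cl); first exact: is_derive1_continuous.
    exact: is_derive1_continuous.
  by move=> z [_ []].
- apply: (closure_eq_continuous cl); first exact: is_derive1_continuous.
    exact: is_derive1_continuous.
  by move=> z [_ []].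
Qed.

End Profiles.

(** * Solutions of the profile equation *)

Section Profile.
Variables (R : realType) (I : set R) (f : R -> R).
Hypothesis hS : class_S I f.

Local Notation f1 := ('D_(1 : R) f).
Local Notation V := (slope_field f).

Definition profile (T : set R) (h h1 : R -> R) : Prop :=
  [/\ open T, is_interval T & forall t, T t ->
    [/\ I (h t), `|h1 t| < f (h t), is_derive t (1 : R) h (h1 t)
      & is_derive t (1 : R) h1 (V (h t) (h1 t))]].

Lemma near_class_S (r : R) : I r -> \forall y \near r, I y.
Proof. by move=> Ir; exact: open_nbhs_nbhs (conj (class_S_open hS) Ir). Qed.

Lemma profile_local (t0 r0 m : R) : I r0 -> `|m| < f r0 ->
  exists T h h1, [/\ profile T h h1, T t0, h t0 = r0 & h1 t0 = m].
Proof.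
move=> Ir0 mf.
have f0 := class_S_f_gt0 hS Ir0.
have r00 := class_S_r_gt0 hS Ir0.
(* [lam] is the value of L^2/E^2 on the geodesics generating the surface. *)
pose lam := (1 - m ^+ 2 / f r0 ^+ 2) * r0 ^+ 2 / f r0.
(* Nullness reads [h1 ^+ 2 = Phi h], and [lam] is such that this holds for the initial data; [G] is
   half the derivative of [Phi]. *)
pose Phi r := f r ^+ 2 - lam * (f r * f r ^+ 2) * (r^-1) ^+ 2.
pose G r := f r * f1 r - lam * (3 * 2^-1 * f r ^+ 2 * f1 r * (r^-1) ^+ 2
  - f r * f r ^+ 2 * (r^-1 * (r^-1) ^+ 2)).
have PhiG r : I r -> is_derive r (1 : R) Phi (2 * G r).
  move=> Ir; have fd := class_S_is_derive hS Ir.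
  have rn := class_S_r_neq0 hS Ir.
  have idd := is_derive_id r (1 : R).
  have rd := derive_invf (f := id) rn idd.
  rewrite /Phi; derive_tac; rewrite /G; field.
  by rewrite rn.
have Gc r : I r -> {for r, continuous G}.
  move=> Ir; have fc := class_S_continuous hS Ir.
  have f1c : {for r, continuous f1}.
    exact: (Ck_continuous (class_S_Ck_deriv hS 0) Ir).
  have vc : {for r, continuous (fun r : R => r^-1)}.
    by apply: continuousV; [exact: (class_S_r_neq0 hS Ir)|exact: cvg_id].
  have mulc (g h : R -> R) : {for r, continuous g} -> {for r, continuous h} ->
    {for r, continuous (fun y => g y * h y)} by exact: continuousM.
  have subc (g h : R -> R) : {for r, continuous g} -> {for r, continuous h} ->
    {for r, continuous (fun y => g y - h y)} by exact: continuousB.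
  have cc (c : R) : {for r, continuous (fun=> c)} by exact: cst_continuous.
  have f2c : {for r, continuous (fun y => f y ^+ 2)} by exact: (mulc _ _ fc fc).
  have v2c : {for r, continuous (fun y : R => y^-1 ^+ 2)} by exact: (mulc _ _ vc vc).
  apply: (subc _ _ (mulc _ _ fc f1c) (mulc _ _ (cc lam) _)).
  apply: (subc _ _ (mulc _ _ (mulc _ _ (mulc _ _ (cc _) f2c) f1c) v2c)).
  exact: (mulc _ _ (mulc _ _ fc f2c) (mulc _ _ vc v2c)).
have nI := near_class_S Ir0.
have [|||h [h1 [h0 h10 H]]] := @newton_ode R Phi G r0 m.
- by apply: filterS nI => r; exact: PhiG.
- by apply: filterS nI => r; exact: Gc.
- by rewrite /Phi /lam; field; rewrite !gt_eqF.
have [h0d h10d _] := nbhs_singleton H.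
have nf : \forall s \near (0 : R), I (h s).
  by apply: near_comp; [exact: is_derive1_continuous h0d|rewrite h0].
have nm : \forall s \near (0 : R), 0 < f (h s) - `|h1 s|.
  apply: near_gt0; last by rewrite h0 h10 subr_gt0.
  apply: continuousB.
    apply: (@continuous_comp _ _ _ h f); first exact: is_derive1_continuous h0d.
    by apply: (class_S_continuous hS); rewrite h0.
  apply: continuous_comp; first exact: is_derive1_continuous h10d.
  exact: norm_continuous.
have /nbhs_ballP[d /= d0 Hd] : \forall s \near (0 : R),
    [/\ is_derive s (1 : R) h (h1 s), is_derive s (1 : R) h1 (G (h s)),
     h1 s ^+ 2 = Phi (h s), I (h s) & 0 < f (h s) - `|h1 s|].
  near=> s; have [? ? ?] : [/\ is_derive s (1 : R) h (h1 s),
      is_derive s (1 : R) h1 (G (h s)) & h1 s ^+ 2 = Phi (h s)] by near: s.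
  by split=> //; near: s.
exists (ball t0 d), (fun t => h (t - t0)), (fun t => h1 (t - t0)).
rewrite subrr; split=> //; last exact: ballxx.
split; [exact: ball_open|by rewrite ball_itv; exact: interval_is_interval|].
move=> t td.
have sd : is_derive t (1 : R) (fun t => t - t0) 1.
  apply: (is_derive_eq (derive_subf (is_derive_id t (1:R)) (derive_cstf t0 t (1:R)))).
  by rewrite subr0.
have [|hd h1d hE It] := Hd (t - t0).
  by move: td; rewrite /ball/= sub0r normrN distrC.
rewrite subr_gt0 => hf; split=> //.
  by apply: (is_derive_eq (derive_compf (f := fun t => t - t0) hd sd)); rewrite mulr1.
apply: (is_derive_eq (derive_compf (f := fun t => t - t0) h1d sd)); rewrite mulr1.
(* The slope field depends on the velocity and [G] does not. They agree on the level
   [h1 ^+ 2 = Phi h], which is why the first integral is carried along with the solution. *)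
rewrite /slope_field hE /Phi /G; field.
by rewrite (class_S_neq0 hS)// (class_S_r_neq0 hS).
Unshelve. all: by end_near. Qed.

Lemma profile_unique (T T' : set R) h h1 g g1 (t0 : R) :
  profile T h h1 -> profile T' g g1 -> T t0 -> T' t0 ->
  h t0 = g t0 -> h1 t0 = g1 t0 ->
  forall t, T t -> T' t -> h t = g t /\ h1 t = g1 t.
Proof.
move=> [oT iT hT] [oT' iT' gT'] Tt0 T't0 hg hg1 t Tt T't.
apply: (@slope_ode_unique R I f hS (T `&` T') (fun=> 1) h h1 g g1 t0) => //.
- exact: openI.
- move=> x y [? ?] [? ?] z xyz; split; [exact: (iT x y)|exact: (iT' x y)].
- move=> s [/hT[? _ _ _] /gT'[? _ _ _]]; split=> //; exact: cst_continuous.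
- by move=> s [/hT[? _ ? ?] /gT'[? _ ? ?]]; rewrite !mul1r.
Qed.

Lemma maximal_profile (t0 r0 m : R) : I r0 -> `|m| < f r0 ->
  exists T h h1, [/\ profile T h h1, T t0, h t0 = r0, h1 t0 = m &
    forall T' g g1, profile T' g g1 -> T' t0 -> g t0 = r0 -> g1 t0 = m ->
      T' `<=` T /\ forall t, T' t -> g t = h t /\ g1 t = h1 t].
Proof.
move=> Ir0 mf.
pose sol (S : set R) g g1 := [/\ profile S g g1, S t0, g t0 = r0 & g1 t0 = m].
pose T : set R := [set t | exists S g g1, sol S g g1 /\ S t].
pose val (t : R) : set (R * R) :=
  [set x | exists S g g1, [/\ sol S g g1, S t & x = (g t, g1 t)]].
(* The maximal solution is the union of all solutions with the given data. They agree wherever two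
   of them are defined, so [val t] has at most one element, and the default [(0, 0)] occurs only off
   [T]. *)
pose u t := xget (0, 0) (val t).
have uE S g g1 t : sol S g g1 -> S t -> u t = (g t, g1 t).
  move=> sS St; rewrite /u; case: xgetP => [x _|/(_ (g t, g1 t))]; last first.
    by case; exists S, g, g1.
  move=> [S' [g' [g1' [sS' S't ->]]]].
  move: sS sS' => [p a b c] [p' a' b' c'].
  by have [||-> ->] := profile_unique p' p a' a _ _ S't St; rewrite ?b ?b' ?c ?c'.
have [S0 [g0 [g10 s0]]] := profile_local t0 Ir0 mf.
have T0 : T t0 by exists S0, g0, g10; split=> //; case: s0.
exists T, (fun t => (u t).1), (fun t => (u t).2); split=> //.
- split.
  + rewrite openE => t [S [g [g1 [sS St]]]].
    have [[oS _ _] _ _ _] := sS.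
    by apply: filterS (open_nbhs_nbhs (conj oS St)) => z Sz; exists S, g, g1.
  + move=> x y [Sx [gx [gx1 [sx Sxx]]]] [Sy [gy [gy1 [sy Syy]]]] z /andP[xz zy].
    have [zt|tz] := leP z t0.
      exists Sx, gx, gx1; split=> //; case: sx => -[_ iS _] St _ _.
      by apply: (iS x t0) => //; rewrite xz.
    exists Sy, gy, gy1; split=> //; case: sy => -[_ iS _] St _ _.
    by apply: (iS t0 y) => //; rewrite zy ltW.
  + move=> t [S [g [g1 [sS St]]]]; rewrite (uE _ _ _ _ sS St).
    have [[oS iS gS] _ _ _] := sS; have [Ig mg gd g1d] := gS t St.
    have nE : \forall z \near t, u z = (g z, g1 z).
      by apply: filterS (open_nbhs_nbhs (conj oS St)) => z; exact: uE.
    split=> //.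
      by apply: near_eq_is_derive gd; apply: filterS nE => z ->.
    by apply: near_eq_is_derive g1d; apply: filterS nE => z ->.
- by rewrite (uE _ _ _ _ s0); case: s0.
- by rewrite (uE _ _ _ _ s0); case: s0.
move=> T' g g1 pT' T't0 gt0 g1t0.
have sT' : sol T' g g1 by [].
split=> [t T't|t T't]; first by exists T', g, g1.
by rewrite (uE _ _ _ _ sT' T't).
Qed.

(** Bootstrapping: the derivatives of [h] and [h1] are expressions in [h] and [h1], so the pair
    gains one order at each step. *)
Lemma profile_Ck (T : set R) h h1 : profile T h h1 -> forall k, Ck T k h.
Proof.
move=> [oT iT hT] k; suff : Ck T k h /\ Ck T k h1 by case.
elim: k => [|k [IH IH1]].
  by split; split=> // t Tt; have [_ _ hd h1d] := hT t Tt;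
    [exact: is_derive1_continuous hd|exact: is_derive1_continuous h1d].
have hI t : T t -> I (h t) by case/hT.
split; first by apply: (CkS_line oT _ IH1) => t /hT[].
apply: (@CkS_line R T k h1 (fun t => V (h t) (h1 t)) oT).
  by move=> t /hT[].
have oI := class_S_open hS.
have Cf : Ck T k (fun t => f (h t)) by exact: (Ck_comp oT oI hI (class_S_Ck hS k)).
have Cf1 : Ck T k (fun t => f1 (h t)).
  exact: (Ck_comp (h := f1) oT oI hI (class_S_Ck_deriv hS k)).
have CV : Ck T k (fun t => (h t)^-1).
  by apply: (Ck_inv oT _ IH) => t /hI; exact: (class_S_r_neq0 hS).
have CfV : Ck T k (fun t => (f (h t))^-1).
  by apply: (Ck_inv oT _ Cf) => t /hI; exact: (class_S_neq0 hS).
have C2fV : Ck T k (fun t => (2 * f (h t))^-1).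
  apply: (Ck_inv oT); first by move=> t /hI Ih; rewrite mulf_neq0// (class_S_neq0 hS).
  exact: (Ck_mul oT (Ck_cst k _ oT) Cf).
have Ch2 := Ck_mul oT IH1 IH1.
rewrite /slope_field; apply: (Ck_add oT).
  apply: (Ck_mul oT); first exact: (Ck_sub oT (Ck_mul oT Cf Cf) Ch2).
  exact: (Ck_sub oT CV (Ck_mul oT Cf1 C2fV)).
exact: (Ck_mul oT Ch2 (Ck_mul oT Cf1 CfV)).
Qed.

End Profile.

(** * Vector-valued derivatives and the sphere *)

Section VectorDerivatives.
Variables (R : realType) (E : normedModType R).
Implicit Types (x v : E).

Lemma is_deriveP (F : normedModType R) (g : E -> F) x v d :
  is_derive x v g d <-> h^-1 *: (g (h *: v + x) - g x) @[h --> (0 : R)^'] --> d.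
Proof.
split=> [[gx <-] //|gd]; apply: DeriveDef; first by apply/cvg_ex; exists d.
exact/cvg_lim.
Qed.

Lemma is_derive_fst (F G : normedModType R) (g : E -> F * G) x v d :
  is_derive x v g d -> is_derive x v (fun y => (g y).1) d.1.
Proof. by move=> /is_deriveP gd; apply/is_deriveP; exact: (cvg_comp _ _ gd cvg_fst). Qed.

Lemma is_derive_snd (F G : normedModType R) (g : E -> F * G) x v d :
  is_derive x v g d -> is_derive x v (fun y => (g y).2) d.2.
Proof. by move=> /is_deriveP gd; apply/is_deriveP; exact: (cvg_comp _ _ gd cvg_snd). Qed.

Lemma is_derive_pair (F G : normedModType R) (g : E -> F) (h : E -> G) x v d e :
  is_derive x v g d -> is_derive x v h e ->
  is_derive x v (fun y => (g y, h y)) (d, e).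
Proof.
by move=> /is_deriveP gd /is_deriveP hd; apply/is_deriveP; exact: (cvg_pair gd hd).
Qed.

Lemma is_derive_coord m n (g : E -> 'M[R]_(m, n)) x v d i j :
  is_derive x v g d -> is_derive x v (fun y => g y i j) (d i j).
Proof.
move=> [gx <-]; have gij : derivable (fun y => g y i j) x v by exact: ((derivable_mxP g x v).1 gx).
by apply: DeriveDef => //; rewrite derive_mx// mxE.
Qed.

Lemma is_derive_addv (F : normedModType R) (g h : E -> F) x v d e :
  is_derive x v g d -> is_derive x v h e ->
  is_derive x v (fun y => g y + h y) (d + e).
Proof. exact: is_deriveD. Qed.

Lemma is_derive_scalev (F : normedModType R) (k : E -> R) (w : F) x v d :
  is_derive x v k d -> is_derive x v (fun y => k y *: w) (d *: w).
Proof.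
move=> /is_deriveP kd; apply/is_deriveP.
have -> : (fun h : R => h^-1 *: (k (h *: v + x) *: w - k x *: w)) =
    (fun h : R => (h^-1 *: (k (h *: v + x) - k x)) *: w).
  by apply/funext => h; rewrite -scalerBl scalerA.
exact: cvgZl.
Qed.

Lemma is_derive_cstv (F : normedModType R) (c : F) x v : is_derive x v (fun=> c) 0.
Proof. exact: is_derive_cst. Qed.

End VectorDerivatives.

Lemma is_derive_translate (R : realType) (F : normedModType R) (g : R -> F) (s : R) d :
  is_derive s (1 : R) g d -> is_derive (0 : R) (1 : R) (fun z => g (s + z)) d.
Proof.
move=> /is_deriveP gd; apply/is_deriveP; move: gd.
rewrite (_ : (fun h : R => h^-1 *: (g (s + (h *: 1 + 0)) - g (s + 0))) =
  (fun h : R => h^-1 *: (g (h *: 1 + s) - g s)))//.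
by apply/funext => h; rewrite !addr0 [s + _]addrC.
Qed.

Lemma is_derive_compv (R : realType) (F : normedModType R) (g : R -> F) (a : R -> R)
    (x : R) d e :
  is_derive (a x) (1 : R) g d -> is_derive x (1 : R) a e ->
  is_derive x (1 : R) (fun z => g (a z)) (e *: d).
Proof.
move=> [/derivable1_diffP gd <-] [/derivable1_diffP ad <-].
apply: DeriveDef; first by apply/derivable1_diffP; exact: (differentiable_comp ad gd).
rewrite (deriveE (f := g \o a) _ (differentiable_comp ad gd)) diff_comp//=.
by rewrite !deriveE// -[X in 'd _ _ X = _]mulr1 [LHS]linearZ.
Qed.

(** * The Euclidean inner product and great circles *)

Section Dot.
Variables (R : realType) (n : nat).
Implicit Types x y z : 'rV[R]_n.

Lemma dotC x y : dot x y = dot y x.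
Proof. by apply: eq_bigr => i _; rewrite mulrC. Qed.

Lemma dotDl x y z : dot (x + y) z = dot x z + dot y z.
Proof. by rewrite -big_split; apply: eq_bigr => i _; rewrite mxE mulrDl. Qed.

Lemma dotZl a x y : dot (a *: x) y = a * dot x y.
Proof. by rewrite mulr_sumr; apply: eq_bigr => i _; rewrite mxE mulrA. Qed.

Lemma dotDr x y z : dot x (y + z) = dot x y + dot x z.
Proof. by rewrite dotC dotDl !(dotC x). Qed.

Lemma dotZr a x y : dot x (a *: y) = a * dot x y.
Proof. by rewrite dotC dotZl dotC. Qed.

Lemma dot0l x : dot 0 x = 0.
Proof. by rewrite -(scale0r x) dotZl mul0r. Qed.

Lemma dot0r x : dot x 0 = 0.
Proof. by rewrite dotC dot0l. Qed.

Lemma dot_ge0 x : 0 <= dot x x.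
Proof. by apply: sumr_ge0 => i _; rewrite -expr2 sqr_ge0. Qed.

Lemma dot_eq0 x : dot x x = 0 -> x = 0.
Proof.
move=> x0; apply/rowP => i; rewrite mxE.
have /psumr_eq0P H : forall i : 'I_n, true -> 0 <= x 0 i * x 0 i.
  by move=> j _; rewrite -expr2 sqr_ge0.
by apply/eqP; rewrite -sqrf_eq0 expr2; apply/eqP/H.
Qed.

Lemma dot_gt0 x : x <> 0 -> 0 < dot x x.
Proof. by move=> x0; rewrite lt_def dot_ge0 andbT; apply/eqP => /dot_eq0. Qed.

Lemma is_derive_dot (E : normedModType R) (g h : E -> 'rV[R]_n) p v d e :
  is_derive p v g d -> is_derive p v h e ->
  is_derive p v (fun q => dot (g q) (h q)) (dot d (h p) + dot (g p) e).
Proof.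
move=> gd hd; rewrite /dot -big_split/=.
have -> : (fun q => \sum_(i < n) g q 0 i * h q 0 i) =
    \sum_(i < n) (fun q => g q 0 i * h q 0 i).
  by apply/funext => q; rewrite fct_sumE.
apply: is_derive_sum => i.
by apply: derive_mulf; exact: is_derive_coord.
Qed.

(** Some coordinate has [x_i^2] different from 1, since two coordinates of square 1 would make the
    norm at least 2. The [i]-th basis vector minus its component along [x] then has squared length
    [1 - x_i^2], which is nonzero. *)
Lemma unit_orthogonal (x : 'rV[R]_n) : (1 < n)%N -> unit_sphere x ->
  exists2 e : 'rV[R]_n, unit_sphere e & dot e x = 0.
Proof.
move=> n1 x1; pose i0 := Ordinal (ltnW n1); pose i1 := Ordinal n1.
pose d (i : 'I_n) : 'rV[R]_n := delta_mx 0 i.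
have dx i y : dot (d i) y = y 0 i.
  rewrite /dot (bigD1 i)//= big1 ?addr0; first by rewrite mxE !eqxx mul1r.
  by move=> j ji; rewrite mxE (negbTE ji) andbF mul0r.
have : exists i, x 0 i ^+ 2 != 1.
  apply: contrapT => /forallNP H.
  have e i : x 0 i ^+ 2 = 1 by have /negP := H i; rewrite negbK => /eqP.
  have : dot x x >= 2.
    rewrite /dot (bigD1 i0)//= (bigD1 i1)//= -!expr2 !e addrA lerDl.
    by apply: sumr_ge0 => i _; rewrite -expr2 sqr_ge0.
  by rewrite x1 leNgt ltrDl ltr01.
move=> [i xi].
pose w : 'rV[R]_n := d i - x 0 i *: x.
have wx : dot w x = 0.
  by rewrite /w -scaleN1r dotDl !dotZl x1 dx; ring.
have ww : dot w w = 1 - x 0 i ^+ 2.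
  rewrite {2}/w -scaleN1r dotDr !dotZr wx mulr0 mulr0 addr0.
  by rewrite dotC dx /w !mxE !eqxx/=; ring.
have w0 : 0 < dot w w.
  by rewrite lt_def dot_ge0 andbT ww subr_eq0 eq_sym.
exists ((Num.sqrt (dot w w))^-1 *: w); last by rewrite dotZl wx mulr0.
rewrite /unit_sphere/= dotZl dotZr mulrA -invfM -expr2 sqr_sqrtr ?ltW//.
by rewrite mulVf// gt_eqF.
Qed.

(** For [w = 0] any unit vector orthogonal to [x] serves as direction, so that no case distinction
    is left to later constructions. *)
Lemma orthogonal_direction (x w : 'rV[R]_n) : (1 < n)%N -> unit_sphere x ->
  dot w x = 0 -> exists k e, [/\ 0 <= k, unit_sphere e, dot e x = 0 & w = k *: e].
Proof.
move=> n1 x1 wx; have [w0|/eqP w0] := eqVneq w 0.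
  have [e e1 ex] := unit_orthogonal n1 x1.
  by exists 0, e; rewrite scale0r.
have ww := dot_gt0 w0.
exists (Num.sqrt (dot w w)), ((Num.sqrt (dot w w))^-1 *: w); split.
- exact: sqrtr_ge0.
- rewrite /unit_sphere/= dotZl dotZr mulrA -invfM -expr2 sqr_sqrtr ?ltW//.
  by rewrite mulVf// gt_eqF.
- by rewrite dotZl wx mulr0.
- by rewrite scalerA divff ?scale1r// gt_eqF// sqrtr_gt0.
Qed.

(** For orthonormal [x] and [e] this is the great circle leaving [x] in the direction [e]. Its
    velocity is the same formula for [e] and [- x]. *)
Definition circle (x e : 'rV[R]_n) (a : R) := cos a *: x + sin a *: e.

Lemma circle_unit x e a : unit_sphere x -> unit_sphere e -> dot e x = 0 ->
  unit_sphere (circle x e a).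
Proof.
move=> x1 e1 ex; rewrite /unit_sphere/= /circle !(dotDl, dotDr, dotZl, dotZr).
by rewrite x1 e1 (dotC x) ex -[RHS](cos2Dsin2 a); ring.
Qed.

Lemma circle0 x e : circle x e 0 = x.
Proof. by rewrite /circle cos0 sin0 scale1r scale0r addr0. Qed.

Lemma is_derive_circle (E : normedModType R) (x e : 'rV[R]_n) (a : E -> R) p v d :
  is_derive p v a d ->
  is_derive p v (fun q => circle x e (a q)) (d *: circle e (- x) (a p)).
Proof.
move=> ad; have cd := derive_compf (is_derive_cos (a p)) ad.
have sd := derive_compf (is_derive_sin (a p)) ad.
apply: is_derive_eq.
  exact: (is_derive_addv (is_derive_scalev x cd) (is_derive_scalev e sd)).
rewrite /circle scalerDr !scalerA scalerN addrC; congr (_ + _).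
  by rewrite mulrC.
by rewrite -scaleNr; congr (_ *: _); ring.
Qed.

Lemma sphere_curve x w : (1 < n)%N -> unit_sphere x -> dot w x = 0 ->
  exists y : R -> 'rV[R]_n, [/\ y 0 = x, forall s, unit_sphere (y s)
    & is_derive (0 : R) (1 : R) y w].
Proof.
move=> n1 x1 wx; have [k [e [_ e1 ex ->]]] := orthogonal_direction n1 x1 wx.
exists (fun s => circle x e (k * s)); split.
- by rewrite mulr0 circle0.
- by move=> s; exact: circle_unit.
have kd : is_derive (0 : R) (1 : R) (fun s : R => k * s) k by derive_tac; ring.
by apply: (is_derive_eq (is_derive_circle x e kd)); rewrite mulr0 circle0.
Qed.

End Dot.

(** * Geodesic equations *)

Section Components.
Variables (R : realType) (n : nat) (E : normedModType R).
Implicit Types (g : E -> ambient R n) (x v : E).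

Definition point (t r : R) (x : 'rV[R]_n) : ambient R n := ((t, r), x).

Lemma is_derive_tc g x v d : is_derive x v g d ->
  is_derive x v (fun y => tc (g y)) (tc d).
Proof. by move=> gd; exact: (is_derive_fst (is_derive_fst gd)). Qed.

Lemma is_derive_rc g x v d : is_derive x v g d ->
  is_derive x v (fun y => rc (g y)) (rc d).
Proof. by move=> gd; exact: (is_derive_snd (is_derive_fst gd)). Qed.

Lemma is_derive_xc g x v d : is_derive x v g d ->
  is_derive x v (fun y => xc (g y)) (xc d).
Proof. by move=> gd; exact: (is_derive_snd gd). Qed.

Lemma is_derive_point (t r : E -> R) (y : E -> 'rV[R]_n) x v dt dr dy :
  is_derive x v t dt -> is_derive x v r dr -> is_derive x v y dy ->
  is_derive x v (fun z => point (t z) (r z) (y z)) (point dt dr dy).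
Proof. by move=> td rd yd; exact: (is_derive_pair (is_derive_pair td rd) yd). Qed.

End Components.

Lemma tc_continuous (R : realType) n : continuous (@tc R n).
Proof.
by move=> p; apply: (@continuous_comp _ _ _ fst fst); exact: cvg_fst.
Qed.

Lemma rc_continuous (R : realType) n : continuous (@rc R n).
Proof.
by move=> p; apply: (@continuous_comp _ _ _ fst snd); [exact: cvg_fst|exact: cvg_snd].
Qed.

Lemma xc_continuous (R : realType) n : continuous (@xc R n).
Proof. by move=> p; exact: cvg_snd. Qed.

Lemma point_eta (R : realType) n (p : ambient R n) : p = point (tc p) (rc p) (xc p).
Proof. by case: p => -[]. Qed.

Section PointProjections.
Variables (R : realType) (n : nat) (t r : R) (x : 'rV[R]_n).

Lemma tc_point : tc (point t r x) = t. Proof. by []. Qed.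
Lemma rc_point : rc (point t r x) = r. Proof. by []. Qed.
Lemma xc_point : xc (point t r x) = x. Proof. by []. Qed.

Definition pointE := (tc_point, rc_point, xc_point).

End PointProjections.

Section Geodesics.
Variables (R : realType) (n : nat) (I : set R) (f : R -> R).
Hypothesis hS : class_S I f.
Hypothesis hn : (1 < n)%N.
Implicit Types p u v w : ambient R n.

Local Notation f1 := ('D_(1 : R) f).

Lemma tangent_spaceS (A B : set (ambient R n)) p v : A `<=` B ->
  tangent_space A p v -> tangent_space B p v.
Proof.
move=> AB [c [c0 cA cv]]; exists c; split=> //.
by apply: filterS cA => s /AB.
Qed.

(** One direction differentiates [dot x x = 1] along the curve. For the other, a straight line in
    [(t, r)], which keeps [r] in the open set [I] for a short time, is combined with a great
    circle. *)
Lemma tangent_spacetimeP p v : spacetime I p ->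
  tangent_space (spacetime I) p v <-> dot (xc v) (xc p) = 0.
Proof.
move=> [Ip x1]; split=> [[c [c0 cS cv]]|vx].
  have xd := is_derive_xc cv; have dd := is_derive_dot xd xd.
  have d1 : is_derive (0 : R) (1 : R) (fun s => dot (xc (c s)) (xc (c s))) 0.
    apply: (@near_eq_is_derive R R R (fun=> 1)).
    by apply: filterS cS => s [_ ->].
  have := @derive_val _ _ _ _ _ _ _ dd; rewrite (@derive_val _ _ _ _ _ _ _ d1) c0.
  by rewrite (dotC (xc p)) => e; lra.
have [y [y0 y1 yd]] := sphere_curve hn x1 vx.
have td := derive_addf (derive_cstf (tc p) (0 : R) (1 : R))
  (derive_mulf (is_derive_id (0 : R) (1 : R)) (derive_cstf (tc v) (0 : R) (1 : R))).
have rd := derive_addf (derive_cstf (rc p) (0 : R) (1 : R))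
  (derive_mulf (is_derive_id (0 : R) (1 : R)) (derive_cstf (rc v) (0 : R) (1 : R))).
exists (fun s => point (tc p + s * tc v) (rc p + s * rc v) (y s)); split.
- by rewrite !mul0r !addr0 y0 -point_eta.
- have : \forall s \near (0 : R), I (rc p + s * rc v).
    apply: (near_comp (g := fun s : R => rc p + s * rc v)).
      exact: is_derive1_continuous rd.
    by rewrite mul0r addr0; exact: (near_class_S hS Ip).
  by apply: filterS => s Is; split=> //=; exact: y1.
- apply: (is_derive_eq (is_derive_point td rd yd)).
  by rewrite [RHS]point_eta; congr (point _ _ _); rewrite mulr0 mul1r addr0 add0r.
Qed.

Lemma metricE p v : metric f p v v =
  - f (rc p) * tc v ^+ 2 + (f (rc p))^-1 * rc v ^+ 2
  + rc p ^+ 2 * dot (xc v) (xc v).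
Proof. by rewrite /metric !expr2. Qed.

Lemma null_norm p v : I (rc p) -> metric f p v v = 0 ->
  (f (rc p) * tc v) ^+ 2 =
  rc v ^+ 2 + f (rc p) * rc p ^+ 2 * dot (xc v) (xc v).
Proof.
rewrite metricE => Ip v0; have f0 := class_S_neq0 hS Ip.
have -> : (f (rc p) * tc v) ^+ 2 = rc v ^+ 2
    + f (rc p) * rc p ^+ 2 * dot (xc v) (xc v)
    - f (rc p) * (- f (rc p) * tc v ^+ 2 + (f (rc p))^-1 * rc v ^+ 2
  + rc p ^+ 2 * dot (xc v) (xc v)) by field.
by rewrite v0 mulr0 subr0.
Qed.

(** With [tc v = 0] the null equation is a vanishing sum of nonnegative terms. The slope
    [rc v / tc v] is thereby meaningful for every null vector. *)
Lemma null_tc_neq0 p v : I (rc p) -> null_vector f p v -> tc v != 0.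
Proof.
move=> Ip [v0 vv]; apply/eqP => t0.
have := null_norm Ip vv; rewrite t0 mulr0 expr0n/=.
have f0 := class_S_f_gt0 hS Ip; have r0 := class_S_r_gt0 hS Ip.
have h0 : 0 <= f (rc p) * rc p ^+ 2 * dot (xc v) (xc v).
  by rewrite mulr_ge0 ?dot_ge0// mulr_ge0 ?sqr_ge0 ?(ltW f0).
move=> /esym/eqP; rewrite paddr_eq0 ?sqr_ge0//.
rewrite sqrf_eq0 !mulf_eq0 (gt_eqF f0) (gt_eqF r0)/= => /andP[/eqP r1 /eqP x0].
by apply: v0; rewrite [v]point_eta t0 r1 (dot_eq0 x0).
Qed.

Lemma is_derive_metric p u w v : I (rc p) ->
  is_derive p u (fun q => metric f q w v)
    (rc u * (- f1 (rc p) * (tc w * tc v)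
      - f1 (rc p) / f (rc p) ^+ 2 * (rc w * rc v) + 2 * rc p * dot (xc w) (xc v))).
Proof.
move=> Ip; have fd := class_S_is_derive hS Ip.
have rd : is_derive p u (@rc R n) (rc u) by exact: is_derive_rc (is_derive_id p u).
have fr := derive_compf fd rd.
have fi := derive_invf (class_S_neq0 hS Ip) fr.
rewrite /metric; derive_tac; field.
exact: (class_S_neq0 hS Ip).
Qed.

(** The connection written out: the coefficients of [tc v] and [rc v] are the time and radial
    geodesic equations, and the last summand is the equation on the sphere. *)
Lemma geodesic_equationE p a u v : I (rc p) ->
  metric f p a v + koszul f p u u v =
  tc v * (- f (rc p) * tc a - f1 (rc p) * rc u * tc u)
  + rc v * (rc a / f (rc p) - f1 (rc p) * rc u ^+ 2 / (2 * f (rc p) ^+ 2)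
     + f1 (rc p) * tc u ^+ 2 / 2 - rc p * dot (xc u) (xc u))
  + (rc p ^+ 2 * dot (xc a) (xc v) + 2 * rc p * rc u * dot (xc u) (xc v)).
Proof.
move=> Ip; have D w z y := @derive_val _ _ _ _ _ _ _ (is_derive_metric w z y Ip).
rewrite /koszul !D /metric; field.
exact: (class_S_neq0 hS Ip).
Qed.

Lemma geodesic_equation_tr p a u : I (rc p) ->
  (forall v, dot (xc v) (xc p) = 0 -> metric f p a v + koszul f p u u v = 0) ->
  f (rc p) * tc a = - f1 (rc p) * rc u * tc u /\
  rc a = f (rc p) * (f1 (rc p) * rc u ^+ 2 / (2 * f (rc p) ^+ 2)
    - f1 (rc p) * tc u ^+ 2 / 2 + rc p * dot (xc u) (xc u)).
Proof.
move=> Ip H; have f0 := class_S_neq0 hS Ip; split.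
  have := H (point 1 0 0); rewrite xc_point dot0l => /(_ erefl).
  rewrite (geodesic_equationE _ _ _ Ip) !pointE !dot0r => e.
  by lra.
have := H (point 0 1 0); rewrite xc_point dot0l => /(_ erefl).
rewrite (geodesic_equationE _ _ _ Ip) !pointE !dot0r => e.
have <- : rc a / f (rc p) = f1 (rc p) * rc u ^+ 2 / (2 * f (rc p) ^+ 2)
  - f1 (rc p) * tc u ^+ 2 / 2 + rc p * dot (xc u) (xc u) by lra.
by rewrite mulrC divfK.
Qed.

Lemma null_geodesic_acceleration p a u : I (rc p) -> metric f p u u = 0 ->
  (forall v, dot (xc v) (xc p) = 0 -> metric f p a v + koszul f p u u v = 0) ->
  tc a = - (f1 (rc p) / f (rc p)) * rc u * tc u /\
  rc a = ((f (rc p) * tc u) ^+ 2 - rc u ^+ 2)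
    * ((rc p)^-1 - f1 (rc p) / (2 * f (rc p))).
Proof.
move=> Ip nul /(geodesic_equation_tr Ip)[et er].
have f0 := class_S_neq0 hS Ip; have r0 := class_S_r_neq0 hS Ip.
have nn := null_norm Ip nul.
split; first by apply: (mulfI f0); rewrite et; field; exact: f0.
rewrite er nn; set X := dot _ _ in nn *.
have -> : tc u ^+ 2 = (rc u ^+ 2 + f (rc p) * rc p ^+ 2 * X) / f (rc p) ^+ 2.
  by rewrite -nn exprMn mulrC mulKf// expf_neq0.
by field; rewrite f0 r0.
Qed.

Lemma geodesic_is_derive J (g : R -> ambient R n) s : geodesic I f J g -> J s ->
  is_derive s (1 : R) g (derive1 g s) /\
  is_derive s (1 : R) (derive1 g) (derive1 (derive1 g) s).
Proof.
move=> [_ _ _ H _] /H[_ gd gd1].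
rewrite [derive1 g s]derive1E [derive1 (derive1 g) s]derive1E.
split; [exact: derivableP gd|exact: derivableP gd1].
Qed.

Lemma null_geodesic_ode J (g : R -> ambient R n) s : null_geodesic I f J g -> J s ->
  let r := rc (g s) in let dt := tc (derive1 g s) in let dr := rc (derive1 g s) in
  [/\ is_derive s (1 : R) (fun s => tc (g s)) dt,
      is_derive s (1 : R) (fun s => rc (g s)) dr,
      is_derive s (1 : R) (fun s => tc (derive1 g s)) (- (f1 r / f r) * dr * dt)
    & is_derive s (1 : R) (fun s => rc (derive1 g s))
        (((f r * dt) ^+ 2 - dr ^+ 2) * (r^-1 - f1 r / (2 * f r)))].
Proof.
move=> [gg gn] Js r dt dr.
have [gd gd1] := geodesic_is_derive gg Js.
have [_ _ _ /(_ s Js)[[Ir x1] _ _] G] := gg.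
have [_ nul] := gn s Js.
have [et er] := null_geodesic_acceleration Ir nul (fun v vx =>
  G s v Js ((tangent_spacetimeP v (conj Ir x1)).2 vx)).
split; [exact: (is_derive_tc gd)|exact: (is_derive_rc gd)| |].
- exact: (is_derive_eq (is_derive_tc gd1) et).
- exact: (is_derive_eq (is_derive_rc gd1) er).
Qed.

Lemma geodesic_criterion (J : set R) (t t1 t2 r r1 r2 : R -> R)
    (x x1 x2 : R -> 'rV[R]_n) :
  open J -> is_interval J -> J !=set0 ->
  (forall s, J s -> I (r s) /\ unit_sphere (x s)) ->
  (forall s, J s -> [/\ is_derive s (1 : R) t (t1 s), is_derive s (1 : R) r (r1 s)
     & is_derive s (1 : R) x (x1 s)]) ->
  (forall s, J s -> [/\ is_derive s (1 : R) t1 (t2 s), is_derive s (1 : R) r1 (r2 s)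
     & is_derive s (1 : R) x1 (x2 s)]) ->
  (forall s, J s ->
    [/\ - f (r s) * t2 s - f1 (r s) * r1 s * t1 s = 0,
        r2 s / f (r s) - f1 (r s) * r1 s ^+ 2 / (2 * f (r s) ^+ 2)
          + f1 (r s) * t1 s ^+ 2 / 2 - r s * dot (x1 s) (x1 s) = 0
      & forall w : 'rV[R]_n, dot w (x s) = 0 ->
          r s ^+ 2 * dot (x2 s) w + 2 * r s * r1 s * dot (x1 s) w = 0]) ->
  let g s := point (t s) (r s) (x s) in
  geodesic I f J g /\ forall s, J s -> derive1 g s = point (t1 s) (r1 s) (x1 s).
Proof.
move=> oJ iJ J0 Jx d1 d2 eqn g.
have gd s : J s -> is_derive s (1 : R) g (point (t1 s) (r1 s) (x1 s)).
  by move=> /d1[? ? ?]; exact: is_derive_point.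
have g1E s : J s -> derive1 g s = point (t1 s) (r1 s) (x1 s).
  by move=> /gd; rewrite derive1E => /@derive_val.
have gd1 s : J s -> is_derive s (1 : R) (derive1 g) (point (t2 s) (r2 s) (x2 s)).
  move=> Js; apply: (@near_eq_is_derive R R (ambient R n) (fun s => point (t1 s) (r1 s) (x1 s))).
    by apply: filterS (open_nbhs_nbhs (conj oJ Js)) => z /g1E ->.
  by have [? ? ?] := d2 s Js; exact: is_derive_point.
split=> //; split=> //.
  move=> s Js; split; first exact: Jx.
    by apply: ex_derive; exact: gd.
  by apply: ex_derive; exact: gd1.
move=> s v Js; have [Is xs1] := Jx s Js.
have gs : spacetime I (g s) by split.
move=> /(tangent_spacetimeP v gs) vx.
rewrite geodesic_equationE// (g1E s Js).
have -> : derive1 (derive1 g) s = point (t2 s) (r2 s) (x2 s).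
  by rewrite derive1E; exact: (@derive_val _ _ _ _ _ _ _ (gd1 s Js)).
have [e1 e2 e3] := eqn s Js.
by rewrite [X in tc v * X]e1 [X in rc v * X]e2 [X in _ + X]e3// !mulr0 !addr0.
Qed.

End Geodesics.

(** * Surfaces of revolution over a profile *)

Section Sphere.
Variables (R : realType) (n : nat).
Hypothesis hn : (1 < n)%N.

Lemma circle_through (x y : 'rV[R]_n) : unit_sphere x -> unit_sphere y ->
  exists e a, [/\ unit_sphere e, dot e x = 0 & circle x e a = y].
Proof.
move=> x1 y1; pose c := dot y x.
have wx : dot (y - c *: x) x = 0.
  by rewrite -scaleNr dotDl dotZl x1 -/c mulr1 subrr.
have [k [e [k0 e1 ex we]]] := orthogonal_direction hn x1 wx.
have yE : y = c *: x + k *: e by rewrite -we addrC subrK.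
have ck : c ^+ 2 + k ^+ 2 = 1.
  rewrite -y1 yE !(dotDl, dotDr, dotZl, dotZr) x1 e1 (dotC x) ex; ring.
have c1 : -1 <= c <= 1.
  have := sqr_ge0 k; have : c ^+ 2 <= 1 by rewrite -ck lerDl sqr_ge0.
  by move=> ? ?; apply/andP; split; nra.
exists e, (acos c); split=> //.
rewrite /circle acosK ?in_itv//= sin_acos// [RHS]yE; congr (_ + _ *: _).
by rewrite -ck addrC addKr sqrtr_sqr ger0_norm.
Qed.

Lemma circle_continuous (x e : 'rV[R]_n) : continuous (circle x e).
Proof.
move=> a; exact: is_derive1_continuous (is_derive_circle x e (is_derive_id a (1 : R))).
Qed.

(** The sphere is the union of the great circles through [x]. *)
Lemma unit_sphere_connected (x : 'rV[R]_n) : unit_sphere x ->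
  connected (@unit_sphere R n).
Proof.
move=> x1; pose D := [set e : 'rV[R]_n | unit_sphere e /\ dot e x = 0].
have -> : @unit_sphere R n = \bigcup_(e in D) range (circle x e).
  apply/seteqP; split=> [y y1|y [e [e1 ex] [a _ <-]]]; last exact: circle_unit.
  by have [e [a [e1 ex <-]]] := circle_through x1 y1; exists e => //; exists a.
apply: bigcup_connected; first by exists x => e _; exists 0 => //; exact: circle0.
move=> e _; apply: connected_continuous_connected.
  by apply/connected_intervalP => ? ? _ _ ? _.
by apply: continuous_subspaceT; exact: circle_continuous.
Qed.

End Sphere.

(** The quotient rule for [dr / dt] with [t''] and [r''] of a null geodesic inserted: the result is
    [dt] times the slope field. *)
Lemma slope_algebra (R : fieldType) (F F1 r dt dr : R) :
  2 != 0 :> R -> dt != 0 -> F != 0 -> r != 0 ->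
  ((F * dt) ^+ 2 - dr ^+ 2) * (r^-1 - F1 / (2 * F)) * dt^-1
    + dr * (- (- (F1 / F) * dr * dt) / dt ^+ 2) =
  dt * ((F ^+ 2 - (dr / dt) ^+ 2) * (r^-1 - F1 / (2 * F))
    + (dr / dt) ^+ 2 * (F1 / F)).
Proof. by move=> n2 dt0 F0 r0; field; rewrite F0 r0 dt0 n2. Qed.

Section Surface.
Variables (R : realType) (n : nat) (I : set R) (f : R -> R).
Hypothesis hS : class_S I f.
Hypothesis hn : (1 < n)%N.
Implicit Types p u v w : ambient R n.

Local Notation V := (slope_field f).

Definition surface (T : set R) (h : R -> R) : set (ambient R n) :=
  [set p | [/\ T (tc p), rc p = h (tc p) & unit_sphere (xc p)]].

Lemma surface_spacetime T h h1 : profile I f T h h1 ->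
  surface T h `<=` spacetime I.
Proof. by move=> [_ _ H] p [/H[Ih _ _ _] pE x1]; split=> //; rewrite pE. Qed.

Lemma tangent_surfaceP T h h1 p v : profile I f T h h1 -> surface T h p ->
  tangent_space (surface T h) p v <->
  dot (xc v) (xc p) = 0 /\ rc v = h1 (tc p) * tc v.
Proof.
move=> hT Pp; have pS := surface_spacetime hT Pp.
have [oT _ H] := hT; have [Tp pE x1] := Pp; have [_ _ hd _] := H _ Tp.
split=> [tv|[vx vr]].
  have /(tangent_spacetimeP hS hn v pS) vx := tangent_spaceS (surface_spacetime hT) tv.
  split=> //; have [c [c0 cP cv]] := tv.
  have td := is_derive_tc cv; have rd := is_derive_rc cv.
  rewrite -c0 in hd.
  have rd' : is_derive (0 : R) (1 : R) (fun s => rc (c s)) (h1 (tc (c 0)) * tc v).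
    apply: (@near_eq_is_derive R R R (fun s => h (tc (c s)))).
      by apply: filterS cP => s [_ ->].
  rewrite -(@derive_val _ _ _ _ _ _ _ rd) (@derive_val _ _ _ _ _ _ _ rd').
  by rewrite c0.
have [y [y0 y1 yd]] := sphere_curve hn x1 vx.
have td := derive_addf (derive_cstf (tc p) (0 : R) (1 : R))
  (derive_mulf (is_derive_id (0 : R) (1 : R)) (derive_cstf (tc v) (0 : R) (1 : R))).
have t0 : tc p + (0 : R) * tc v = tc p by rewrite mul0r addr0.
have rd : is_derive (0 : R) (1 : R) (fun s => h (tc p + s * tc v)) (rc v).
  rewrite -{}t0 in hd.
  apply: (is_derive_eq (derive_compf (f := fun s : R => tc p + s * tc v) hd td)).
  by rewrite vr mulr0 addr0 mul1r add0r mul0r addr0.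
exists (fun s => point (tc p + s * tc v) (h (tc p + s * tc v)) (y s)); split.
- by rewrite mul0r addr0 y0 -pE -point_eta.
- have : \forall s \near (0 : R), T (tc p + s * tc v).
    apply: (near_comp (g := fun s : R => tc p + s * tc v)).
      exact: is_derive1_continuous td.
    by rewrite mul0r addr0; exact: open_nbhs_nbhs (conj oT Tp).
  by apply: filterS => s Ts; split=> //=; exact: y1.
- apply: (is_derive_eq (is_derive_point td rd yd)).
  by rewrite [RHS]point_eta mulr0 addr0 mul1r add0r.
Qed.

Lemma surface_hypersurface T h h1 : profile I f T h h1 -> T !=set0 ->
  (exists x : 'rV[R]_n, unit_sphere x) -> hypersurface I (surface T h).
Proof.
move=> hT [t0 Tt0] [x0 x01]; have PS := surface_spacetime hT.
have [oT _ H] := hT.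
split=> //; first by exists (point t0 (h t0) x0).
move=> p Pp; have [Tp pE x1] := Pp.
have oU : open (@tc R n @^-1` T).
  by apply: open_comp => // q _; exact: tc_continuous.
pose F (q : ambient R n) := rc q - h (tc q).
exists (@tc R n @^-1` T), F; split=> //.
- have dtc q w : is_derive q w (@tc R n) (tc w) by exact: is_derive_tc (is_derive_id q w).
  have drc q w : is_derive q w (@rc R n) (rc w) by exact: is_derive_rc (is_derive_id q w).
  have Clin (l : ambient R n -> R) k : (forall q w, is_derive q w l (l w)) ->
      continuous l -> Ck (@tc R n @^-1` T) k l.
    move=> dl cl; case: k => [|k]; first by split=> [q _|]; [exact: cl|].
    apply: (@CkS _ _ _ _ _ (fun v _ => l v) oU); first by move=> q _; exact: cl.
    by move=> w; exact: Ck_cst.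
  move=> k; apply: Ck_sub => //; first by apply: Clin => //; exact: rc_continuous.
  apply: (Ck_comp (W := T) (g := @tc R n)) => //; first exact: (profile_Ck hS hT k).
  by apply: Clin => //; exact: tc_continuous.
- apply/seteqP; split=> q; first by move=> [[Tq qE q1] _]; split=> //;
    [apply: PS|rewrite /F qE subrr].
  by move=> [[_ q1] Tq /eqP]; rewrite subr_eq0 => /eqP qE.
- exists (point 0 1 0).
    by apply/(tangent_spacetimeP hS hn _ (PS _ Pp)); rewrite xc_point dot0l.
  have [_ _ hd _] := H _ Tp.
  have Fd : is_derive p (point 0 1 0) F (1 - h1 (tc p) * 0).
    apply: derive_subf; first exact: (is_derive_rc (is_derive_id p (point 0 1 0))).
    apply: derive_compf => //.
    exact: (is_derive_tc (is_derive_id p (point 0 1 0))).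
  rewrite (@derive_val _ _ _ _ _ _ _ Fd) mulr0 subr0.
  by apply/eqP; exact: oner_neq0.
Qed.

(** The velocity [(1, h1, 0)] of the profile is timelike because the absolute value of [h1] is below
    [f], and the tangent vectors orthogonal to it are exactly those tangent to the spheres, where
    the metric is positive. *)
Lemma surface_timelike T h h1 : profile I f T h h1 -> timelike f (surface T h).
Proof.
move=> hT p Pp; have [Tp pE x1] := Pp; have [_ _ H] := hT.
have [Ir mf _ _] := H _ Tp; rewrite -pE in Ir mf.
have f0 := class_S_f_gt0 hS Ir; have r0 := class_S_r_gt0 hS Ir.
set m := h1 (tc p) in mf.
have m2 : m ^+ 2 < f (rc p) ^+ 2 by rewrite -real_normK ?num_real// ltr_pXn2r ?nnegrE ?(ltW f0).
have mm : - f (rc p) + (f (rc p))^-1 * m ^+ 2 < 0.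
  rewrite addrC subr_lt0 mulrC ltr_pdivrMr// -expr2//.
exists (point 1 m 0); split.
- by apply/(tangent_surfaceP _ hT Pp); rewrite !pointE dot0l mulr1.
- rewrite metricE !pointE dot0l mulr0 addr0 expr1n mulr1 //.
move=> v /(tangent_surfaceP _ hT Pp)[vx vr]; rewrite -/m in vr.
have -> : metric f p (point 1 m 0) v = (- f (rc p) + (f (rc p))^-1 * m ^+ 2) * tc v.
  by rewrite /metric !pointE dot0l vr; ring.
move=> /eqP; rewrite mulf_eq0 (lt_eqF mm)/= => /eqP vt v0.
have vr0 : rc v = 0 by rewrite vr vt mulr0.
rewrite metricE vt vr0 expr0n !mulr0 !add0r mulr_gt0 ?exprn_gt0//.
by apply: dot_gt0 => x0; apply: v0; rewrite [v]point_eta vt vr0 x0.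
Qed.

Lemma null_geodesic_slope J (g : R -> ambient R n) s : null_geodesic I f J g -> J s ->
  let q s := rc (derive1 g s) / tc (derive1 g s) in
  let a s := tc (derive1 g s) in
  [/\ {for s, continuous a}, I (rc (g s)),
    is_derive s (1 : R) (fun s => tc (g s)) (a s),
    is_derive s (1 : R) (fun s => rc (g s)) (a s * q s) &
    is_derive s (1 : R) q (a s * V (rc (g s)) (q s))].
Proof.
move=> gn Js q a; have [td rd t1d r1d] := null_geodesic_ode hS hn gn Js.
have [[_ _ _ /(_ s Js)[[Ir _] _ _] _] /(_ s Js) nv] := gn.
have a0 := null_tc_neq0 hS Ir nv.
split.
- exact: (is_derive1_continuous t1d).
- exact: Ir.
- exact: td.
- apply: (is_derive_eq rd); rewrite /a /q mulrC divfK//; exact: a0.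
- apply: (is_derive_eq (derive_mulf r1d (derive_invf (f := a) a0 t1d))).
  apply: (slope_algebra _ _ _ a0 (class_S_neq0 hS Ir) (class_S_r_neq0 hS Ir)).
  by rewrite pnatr_eq0.
Qed.

Lemma null_geodesic_restrict J J' (g : R -> ambient R n) : null_geodesic I f J g ->
  J' `<=` J -> open J' -> is_interval J' -> J' !=set0 -> null_geodesic I f J' g.
Proof.
move=> [[oJ iJ J0 H G] N] J'J oJ' iJ' J'0; split; last by move=> s /J'J; exact: N.
by split=> // [s /J'J|s v /J'J]; [exact: H|exact: G].
Qed.

(** Radius and slope of the geodesic, and [h] and [h1] evaluated at its time, solve the same system
    with the factor [dt/ds]. *)
Lemma null_geodesic_follows J (g : R -> ambient R n) T h h1 s0 :
  null_geodesic I f J g -> profile I f T h h1 -> J s0 ->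
  (forall s, J s -> T (tc (g s))) -> rc (g s0) = h (tc (g s0)) ->
  rc (derive1 g s0) / tc (derive1 g s0) = h1 (tc (g s0)) ->
  forall s, J s -> rc (g s) = h (tc (g s)) /\
    rc (derive1 g s) / tc (derive1 g s) = h1 (tc (g s)).
Proof.
move=> gn [oT iT H] Js0 JT r0 q0; have [[oJ iJ _ _ _] _] := gn.
apply: (slope_ode_unique hS (a := fun s => tc (derive1 g s)) oJ iJ Js0 r0 q0).
  move=> s Js; have [ac Ir _ _ _] := null_geodesic_slope gn Js.
  by split=> //; have [] := H _ (JT s Js).
move=> s Js; have [_ _ td rd qd] := null_geodesic_slope gn Js.
have [_ _ hd h1d] := H _ (JT s Js); split=> //.
  by rewrite mulrC; exact: (derive_compf (f := fun s => tc (g s)) hd td).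
by rewrite mulrC; exact: (derive_compf (f := fun s => tc (g s)) h1d td).
Qed.

(** The parameters at which [g] lies on the surface with the slope of the profile form an open set,
    since the geodesic follows the profile locally, and a closed one, since a limit of surface
    points that is off the surface would lie on its edge. Tangency is then equality of slopes. *)
Lemma surface_photon T h h1 : profile I f T h h1 -> T !=set0 ->
  (exists x : 'rV[R]_n, unit_sphere x) -> photon_surface I f (surface T h).
Proof.
move=> hT T0 S0; split.
- exact: surface_hypersurface hT T0 S0.
- exact: surface_timelike hT.
move=> J g gn nedge s0 Js0 Pg0 tg0.
have [oT iT H] := hT; have [[oJ iJ _ GS _] N] := gn.
have g_cont s : J s -> {for s, continuous g}.
  by case: gn => gg _ /(geodesic_is_derive gg)[gd _]; exact: is_derive1_continuous gd.
have a0 s : J s -> tc (derive1 g s) != 0.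
  by move=> Js; have [[Ir _] _ _] := GS s Js; exact: (null_tc_neq0 hS Ir (N s Js)).
pose q s := rc (derive1 g s) / tc (derive1 g s).
have key : J `<=` [set s | surface T h (g s) /\ q s = h1 (tc (g s))].
  apply: (interval_clopen iJ Js0).
  - split=> //; have /(tangent_surfaceP _ hT Pg0)[_ vr] := tg0.
    by rewrite /q vr mulfK// a0.
  - move=> s Js [Ps qs]; have [Ts rs _] := Ps.
    have tc_cont : {for s, continuous (fun s => tc (g s))}.
      by apply: (@continuous_comp _ _ _ g (@tc R n)); [exact: g_cont|exact: tc_continuous].
    have nT := near_comp tc_cont (open_nbhs_nbhs (conj oT Ts)).
    have /nbhs_ballP[d /= d0 Hd] : \forall z \near s, J z /\ T (tc (g z)).
      by apply: filterS2 (open_nbhs_nbhs (conj oJ Js)) nT => z ? ?; split.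
    have gb : null_geodesic I f (ball s d) g.
      apply: (null_geodesic_restrict gn); first by move=> z /Hd[].
      - exact: ball_open.
      - by rewrite ball_itv; exact: interval_is_interval.
      - by exists s; exact: ballxx.
    have F := null_geodesic_follows gb hT (ballxx s d0) (fun z zd => (Hd z zd).2) rs qs.
    apply: filterS (nbhsx_ballx s d d0) => z zd Jz.
    have [rz qz] := F z zd; have [_ Tz] := Hd z zd.
    by split=> //; split=> //; have [[]] := GS z Jz.
  - move=> s Js cl.
    have Ps : surface T h (g s).
      apply: contrapT => nP; apply: (nedge s Js); split=> // B nB.
      have [z [[_ [Pz _]] Bz]] := cl _ (g_cont s Js _ nB).
      by exists (g z).
    have [Ts _ _] := Ps.
    split=> //; have [ac _ td _ qd] := null_geodesic_slope gn Js.
    have [_ _ _ h1d] := H _ Ts.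
    apply: (closure_eq_continuous (g := q) (h := fun z => h1 (tc (g z))) cl).
    + exact: is_derive1_continuous qd.
    + exact: is_derive1_continuous (derive_compf (f := fun s => tc (g s)) h1d td).
    + by move=> z [_ []].
move=> s Js; have [Ps qs] := key s Js; split; first exact: Ps.
apply/(tangent_surfaceP _ hT Ps).
have [gsp gd _] := GS s Js.
have /(tangent_spacetimeP hS hn _ gsp) : tangent_space (spacetime I) (g s) (derive1 g s).
  exists (fun z => g (s + z)); split; first by rewrite addr0.
  - have sc : {for (0 : R), continuous (fun z : R => s + z)}.
      by apply: is_derive1_continuous (derive_addf (derive_cstf s (0:R) (1:R)) (is_derive_id _ _)).
    have nJ : \forall z \near (0 : R), J (s + z).
      by apply: (near_comp sc); rewrite addr0; exact: open_nbhs_nbhs (conj oJ Js).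
    by apply: filterS nJ => z /GS[].
  - case: gn => gg _; have [gds _] := geodesic_is_derive gg Js.
    exact: is_derive_translate.
move=> ->; split; first by [].
by rewrite -qs /q divfK ?a0.
Qed.

Lemma surface_symmetric T h h1 : profile I f T h h1 ->
  (exists x : 'rV[R]_n, unit_sphere x) -> spherically_symmetric I (surface T h).
Proof.
move=> hT [x0 x01]; have [oT iT H] := hT.
split; last first.
  move=> t0 [p [[Tp pE x1] /= pt]]; rewrite pt in Tp pE; exists (h t0).
    by have [] := H _ Tp.
  apply/seteqP; split=> q; first by move=> [[Tq qE q1] /= qt]; split=> //; rewrite qE qt.
  by move=> [qt qr q1]; split=> //; split=> //; rewrite qt.
have [T0|/set0P[t0 Tt0]] := eqVneq T set0.
  rewrite (_ : surface T h = set0); first exact: connected0.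
  by apply/seteqP; split=> // p []; rewrite T0.
(* A comb: every member of the union contains all of [line], so the members share a point. *)
pose line := (fun t => point t (h t) x0) @` T.
pose slice t := (fun x => point t (h t) x) @` @unit_sphere R n.
have -> : surface T h = \bigcup_(t in T) (line `|` slice t).
  apply/seteqP; split=> [p [Tp pE x1]|p [t Tt [[z Tz <-]|[x x1 <-]]]]; last 2 first.
  - by split.
  - by split.
  by exists (tc p) => //; right; exists (xc p) => //; rewrite -pE -point_eta.
apply: bigcup_connected.
  by exists (point t0 (h t0) x0) => t Tt; left; exists t0.
move=> t Tt; apply: connectedU.
- by exists (point t (h t) x0); split; [exists t|exists x0].
- apply: connected_continuous_connected; first exact/connected_intervalP.
  apply: continuous_in_subspaceT => z; rewrite inE => Tz.
  have [_ _ hd _] := H _ Tz.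
  apply: is_derive1_continuous.
  exact: is_derive_point (is_derive_id z (1:R)) hd (is_derive_cstv x0 z (1:R)).
- apply: connected_continuous_connected; first exact: unit_sphere_connected x01.
  apply: continuous_subspaceT => x.
  have c1 : {for x, continuous (fun _ : 'rV[R]_n => (t, h t) : R * R)}.
    exact: cst_continuous.
  have c2 : y @[y --> x] --> (x : 'rV[R]_n) by exact: cvg_id.
  exact: (cvg_pair c1 c2).
Qed.

End Surface.

(** * Existence of null geodesics *)

Lemma is_derive_scale_circle (R : realType) n (E : normedModType R)
    (x e : 'rV[R]_n) (k a : E -> R) p v dk da :
  is_derive p v k dk -> is_derive p v a da ->
  is_derive p v (fun q => k q *: circle x e (a q))
    (dk *: circle x e (a p) + (k p * da) *: circle e (- x) (a p)).
Proof.
move=> kd ad; have cd := derive_compf (is_derive_cos (a p)) ad.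
have sd := derive_compf (is_derive_sin (a p)) ad.
have -> : (fun q => k q *: circle x e (a q)) =
    (fun q => (k q * cos (a q)) *: x + (k q * sin (a q)) *: e).
  by apply/funext => q; rewrite /circle scalerDr !scalerA.
apply: (is_derive_eq (is_derive_addv (is_derive_scalev x (derive_mulf kd cd))
  (is_derive_scalev e (derive_mulf kd sd)))).
by rewrite /circle; apply/rowP => i; rewrite !mxE; ring.
Qed.

Section GeodesicExistence.
Variables (R : realType) (n : nat) (I : set R) (f : R -> R).
Hypothesis hS : class_S I f.
Hypothesis hn : (1 < n)%N.
Implicit Types p u v w : ambient R n.

Local Notation f1 := ('D_(1 : R) f).

(* [E = f t'] and [L = r^2 theta'] are the conserved energy and angular
   momentum. *)
Lemma null_geodesic_exists p (vt vr k : R) (e : 'rV[R]_n) :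
  spacetime I p -> unit_sphere e -> dot e (xc p) = 0 ->
  null_vector f p (point vt vr (k *: e)) ->
  exists (d : R) (g : R -> ambient R n), [/\ 0 < d, null_geodesic I f (ball 0 d) g,
    g 0 = p & derive1 g 0 = point vt vr (k *: e)].
Proof.
move=> [Ip x1] e1 ep nv.
have vt0 := null_tc_neq0 hS Ip nv; rewrite tc_point in vt0.
have nn := null_norm hS Ip nv.2.
rewrite !pointE dotZl dotZr e1 mulr1 in nn.
have f0 := class_S_neq0 hS Ip; have r0 := class_S_r_neq0 hS Ip.
set x0 := xc p in x1 ep; set ro := rc p in Ip nn f0 r0.
pose En := f ro * vt; pose L := ro ^+ 2 * k.
(* The radial first integral [r'^2 = E^2 - L^2 f / r^2]. Once [r] is known, time and angle are
   antiderivatives of [E / f] and [L / r^2]. *)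
pose Phi r := En ^+ 2 - L ^+ 2 * (f r * (r^-1) ^+ 2).
pose G r := L ^+ 2 * (f r * (r^-1 * (r^-1) ^+ 2) - 2^-1 * f1 r * (r^-1) ^+ 2).
have PhiG r : I r -> is_derive r (1 : R) Phi (2 * G r).
  move=> Ir; have fd := class_S_is_derive hS Ir.
  have rn := class_S_r_neq0 hS Ir.
  have rd := derive_invf (f := id) rn (is_derive_id r (1 : R)).
  rewrite /Phi; derive_tac; rewrite /G; field.
  by rewrite rn.
have Gc r : I r -> {for r, continuous G}.
  move=> Ir; have oI := class_S_open hS.
  have CV : Ck I 0 (fun r : R => r^-1).
    apply: (@Ck_inv R R I 0 id oI (class_S_r_neq0 hS)).
    by split=> // z _; exact: cvg_id.
  have CV2 := Ck_mul oI CV CV.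
  apply: (Ck_continuous _ Ir (k := 0%N)).
  apply: (Ck_mul oI (Ck_cst 0 _ oI)); apply: (Ck_sub oI).
    exact: (Ck_mul oI (class_S_Ck hS 0) (Ck_mul oI CV CV2)).
  apply: (Ck_mul oI _ CV2).
  exact: (Ck_mul oI (Ck_cst 0 _ oI) (class_S_Ck_deriv hS 0)).
have nI := near_class_S hS Ip.
have [|||r [r1 [r_0 r1_0 H]]] := @newton_ode R Phi G ro vr.
- by apply: filterS nI => z; exact: PhiG.
- by apply: filterS nI => z; exact: Gc.
- rewrite /Phi /En nn /L; field; exact: r0.
have [r0d _ _] := nbhs_singleton H.
have nIr : \forall s \near (0 : R), I (r s).
  by apply: near_comp; [exact: is_derive1_continuous r0d|rewrite r_0].
have /nbhs_ballP[d /= d0 Hd] : \forall s \near (0 : R),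
    [/\ is_derive s (1 : R) r (r1 s), is_derive s (1 : R) r1 (G (r s)),
     r1 s ^+ 2 = Phi (r s) & I (r s)].
  near=> s; have [? ? ?] : [/\ is_derive s (1 : R) r (r1 s),
      is_derive s (1 : R) r1 (G (r s)) & r1 s ^+ 2 = Phi (r s)] by near: s.
  by split=> //; near: s.
pose J := ball (0 : R) d.
have oJ : open J by exact: ball_open.
have iJ : is_interval J by rewrite /J ball_itv; exact: interval_is_interval.
have J0 : J 0 by exact: ballxx.
pose t1 s := En / f (r s); pose k1 s := L / r s ^+ 2.
have t1d s : J s -> is_derive s (1 : R) t1 (- (En * f1 (r s) * r1 s) / f (r s) ^+ 2).
  move=> /Hd[rd _ _ Ir]; have fd := derive_compf (class_S_is_derive hS Ir) rd.
  have iv := derive_invf (class_S_neq0 hS Ir) fd.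
  apply: (is_derive_eq (derive_mulf (derive_cstf En s (1:R)) iv)); field.
  exact: (class_S_neq0 hS Ir).
have k1d s : J s -> is_derive s (1 : R) k1 (- (2 * L * r1 s) / r s ^+ 3).
  move=> /Hd[rd _ _ Ir].
  have r2n : r s ^+ 2 != 0 by rewrite expf_neq0// (class_S_r_neq0 hS Ir).
  have iv := derive_invf (f := fun s => r s ^+ 2) r2n (derive_sqrf rd).
  apply: (is_derive_eq (derive_mulf (derive_cstf L s (1:R)) iv)); field.
  exact: (class_S_r_neq0 hS Ir).
have [t tE td] := antiderivative oJ iJ J0 (fun s Js => is_derive1_continuous (t1d s Js)).
have [th thE thd] := antiderivative oJ iJ J0 (fun s Js => is_derive1_continuous (k1d s Js)).
pose x s := circle x0 e (th s).
pose g s := point (tc p + t s) (r s) (x s).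
have en : dot x0 e = 0 by rewrite dotC.
have x1' : unit_sphere (- x0) by rewrite /unit_sphere/= -scaleN1r dotZl dotZr x1; ring.
have ex' : dot (- x0) e = 0 by rewrite -scaleN1r dotZl en mulr0.
have [gg g1E] : geodesic I f J g /\ forall s, J s ->
    derive1 g s = point (t1 s) (r1 s) (k1 s *: circle e (- x0) (th s)).
  apply: (@geodesic_criterion R n I f hS hn J (fun s => tc p + t s) t1
    (fun s => - (En * f1 (r s) * r1 s) / f (r s) ^+ 2) r r1 (fun s => G (r s))
    x (fun s => k1 s *: circle e (- x0) (th s))
    (fun s => (- (2 * L * r1 s) / r s ^+ 3) *: circle e (- x0) (th s)
       + (k1 s * k1 s) *: circle (- x0) (- e) (th s)) oJ iJ).
  - by exists 0.
  - by move=> s /Hd[_ _ _ Ir]; split; [exact: Ir|exact: circle_unit].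
  - move=> s Js; have [rd _ _ _] := Hd s Js; split.
    + apply: (is_derive_eq (derive_addf (derive_cstf (tc p) s (1:R)) (td s Js))).
      by rewrite add0r.
    + exact: rd.
    + exact: is_derive_circle (thd s Js).
  - move=> s Js; have [_ r1d _ _] := Hd s Js; split.
    + exact: t1d.
    + exact: r1d.
    + exact: is_derive_scale_circle (k1d s Js) (thd s Js).
  - move=> s Js; have [_ _ rE Ir] := Hd s Js.
    have fs := class_S_neq0 hS Ir; have rs := class_S_r_neq0 hS Ir.
    split.
    + by rewrite /t1; field; exact: fs.
    + rewrite dotZl dotZr (circle_unit (th s) e1 x1' ex') rE /Phi /G /t1 /k1.
      by field; rewrite fs rs.
    + move=> w wx; rewrite dotDl !dotZl.
      have -> : circle (- x0) (- e) (th s) = - x s.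
        by rewrite /x /circle !scalerN opprD.
      rewrite -(scaleN1r (x s)) dotZl (dotC (x s)) wx /k1; field.
      exact: rs.
exists d, g; split=> //.
- split; first exact: gg.
  move=> s Js; have [_ _ rE Ir] := Hd s Js; rewrite (g1E s Js).
  have fs := class_S_neq0 hS Ir; have rs := class_S_r_neq0 hS Ir.
  split.
    move=> z0; have : tc (point (t1 s) (r1 s) (k1 s *: circle e (- x0) (th s))) = 0.
      by rewrite z0.
    by apply/eqP; rewrite tc_point /t1 /En !mulf_neq0// invr_neq0.
  have gr : rc (g s) = r s by [].
  rewrite metricE gr !pointE dotZl dotZr (circle_unit (th s) e1 x1' ex') rE.
  by rewrite /Phi /t1 /k1; field; rewrite fs rs.
- by rewrite /g tE addr0 r_0 /x thE circle0 -point_eta.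
- rewrite (g1E 0 J0) r1_0 /t1 r_0 /k1 thE circle0 /En /L r_0.
  by congr (point _ _ (_ *: _)); field.
Unshelve. all: by end_near. Qed.

End GeodesicExistence.

(** * Symmetric photon surfaces are given by profiles *)

Section PhotonSurfaces.
Variables (R : realType) (n : nat) (I : set R) (f : R -> R).
Hypothesis hS : class_S I f.
Hypothesis hn : (1 < n)%N.
Implicit Types (p q u v w : ambient R n) (P : set (ambient R n)).

Lemma symmetric_slice P p q : spherically_symmetric I P -> P p -> tc q = tc p ->
  P q <-> rc q = rc p /\ unit_sphere (xc q).
Proof.
move=> [_ sl] Pp qp; have [|r0 _ E] := sl (tc p); first by exists p.
have [_ rp _] : [set p' | [/\ tc p' = tc p, rc p' = r0 & unit_sphere (xc p')]] p.
  by rewrite -E.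
split=> [Pq|[rq xq]].
  have [_ rq xq] : [set p' | [/\ tc p' = tc p, rc p' = r0 & unit_sphere (xc p')]] q.
    by rewrite -E.
  by rewrite rq rp.
have : [set p' | [/\ tc p' = tc p, rc p' = r0 & unit_sphere (xc p')]] q.
  by split=> //; rewrite rq.
by rewrite -E => -[].
Qed.

(* Rotating the angular part of a timelike tangent vector yields a null one. *)
Lemma symmetric_null_tangent P p : P `<=` spacetime I -> spherically_symmetric I P ->
  timelike f P -> P p ->
  exists vt vr k e, [/\ unit_sphere e, dot e (xc p) = 0,
    tangent_space P p (point vt vr (k *: e)),
    null_vector f p (point vt vr (k *: e)) & `|vr / vt| < f (rc p)].
Proof.
move=> PS sP tP Pp; have [Ip x1] := PS p Pp.
have f0 := class_S_f_gt0 hS Ip; have r0 := class_S_r_gt0 hS Ip.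
have [u [tu um _]] := tP p Pp.
have [e e1 ep] := unit_orthogonal hn x1.
(* As [u] is timelike, [f t'^2 - r'^2 / f] is positive; an angular part of length [k] compensates it
   exactly. *)
pose k := Num.sqrt ((f (rc p) * tc u ^+ 2 - rc u ^+ 2 / f (rc p)) / rc p ^+ 2).
have up : 0 < f (rc p) * tc u ^+ 2 - rc u ^+ 2 / f (rc p).
  have : 0 <= rc p ^+ 2 * dot (xc u) (xc u) by rewrite mulr_ge0 ?sqr_ge0 ?dot_ge0.
  by move: um; rewrite metricE [_^-1 * _]mulrC; lra.
have k2 : k ^+ 2 = (f (rc p) * tc u ^+ 2 - rc u ^+ 2 / f (rc p)) / rc p ^+ 2.
  by rewrite sqr_sqrtr// divr_ge0 ?sqr_ge0// ltW.
have t0 : tc u != 0.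
  apply/eqP => t0; move: up; rewrite t0 expr0n/= mulr0 sub0r oppr_gt0.
  by rewrite ltNge divr_ge0 ?sqr_ge0 ?ltW.
exists (tc u), (rc u), k, e; split=> //.
- have [c [c0 cP cu]] := tu.
  have kd : is_derive (0 : R) (1 : R) (fun s : R => k * s) k by derive_tac; ring.
  (* The curve of [u] with its angular part replaced: by symmetry [P] contains the whole sphere
     through [c s]. *)
  exists (fun s => point (tc (c s)) (rc (c s)) (circle (xc p) e (k * s))); split.
  + by rewrite mulr0 circle0 c0 -point_eta.
  + apply: filterS cP => s Pcs.
    by apply/(symmetric_slice sP Pcs) => //; split=> //; exact: circle_unit.
  + have cd := is_derive_circle (xc p) e kd.
    apply: (is_derive_eq (is_derive_point (is_derive_tc cu) (is_derive_rc cu) cd)).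
    by rewrite mulr0 circle0.
- split; first by move=> /(congr1 (@tc R n)); rewrite tc_point => /eqP; rewrite (negbTE t0).
  rewrite metricE !pointE dotZl dotZr e1 mulr1 -expr2 k2; field.
  by rewrite !gt_eqF.
- rewrite normrM normfV ltr_pdivrMr ?normr_gt0//.
  rewrite -(ltr_pXn2r (n := 2))// ?nnegrE ?mulr_ge0 ?(ltW f0)//.
  rewrite exprMn !real_normK ?num_real// -subr_gt0.
  have -> : f (rc p) ^+ 2 * tc u ^+ 2 - rc u ^+ 2 =
    f (rc p) * (f (rc p) * tc u ^+ 2 - rc u ^+ 2 / f (rc p)).
    by field; rewrite gt_eqF.
  exact: mulr_gt0.
Qed.

(** Near [p], [P] is the zero set of a continuous function on the spacetime, hence relatively closed
    there. Geodesics through [p] therefore avoid the edge for a short time. *)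
Lemma hypersurface_edge P p : hypersurface I P -> P p ->
  \forall q \near p, spacetime I q -> ~ edge P q.
Proof.
move=> [_ _ H] Pp; have [U [F [oU Up sF PU _]]] := H p Pp.
apply: filterS (open_nbhs_nbhs (conj oU Up)) => q Uq Sq [cPq nPq]; apply: nPq.
have PUq : (P `&` U) q; last by case: PUq.
rewrite PU; split=> //.
apply: (closure_eq_continuous (B := P `&` U) (g := F) (h := fun=> 0)).
- move=> B nB; have [z [Pz [Uz Bz]]] := cPq _ (filterI (open_nbhs_nbhs (conj oU Uq)) nB).
  by exists z.
- exact: (Ck_continuous (sF 0%N) Uq).
- exact: cst_continuous.
- by move=> z; rewrite PU => -[].
Qed.

(** A null geodesic tangent to [P] at [p] stays in [P] by the photon property and on the profile
    with its initial data by uniqueness. Its time runs through a neighbourhood of [tc p], and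
    symmetry fills in the spheres. *)
Lemma photon_surface_local P p : symmetric_photon_surface I f P -> P p ->
  exists T h h1, profile I f T h h1 /\ \forall t \near tc p, T t /\
    forall q, tc q = t -> P q <-> rc q = h t /\ unit_sphere (xc q).
Proof.
move=> [[hP tP gP] sP] Pp; have [P0 PS _] := hP; have [Ip x1] := PS p Pp.
have [vt [vr [k [e [e1 ep tv nv mf]]]]] := symmetric_null_tangent PS sP tP Pp.
have vt0 := null_tc_neq0 hS Ip nv; rewrite tc_point in vt0.
have [T [h [h1 [hT Tp hp h1p]]]] := profile_local hS (tc p) Ip mf.
have [oT _ _] := hT.
have [d [g [d0 gn g0 g10]]] := null_geodesic_exists hS hn (conj Ip x1) e1 ep nv.
have [gg _] := gn.
have b0 := ballxx (0 : R) d0.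
have [gd gd1] := geodesic_is_derive gg b0.
have gc := is_derive1_continuous gd.
have tcc := is_derive1_continuous (is_derive_tc gd).
have nedge : \forall s \near (0 : R), spacetime I (g s) -> ~ edge P (g s).
  have pedge := hypersurface_edge hP Pp; rewrite -g0 in pedge.
  exact: (near_comp gc pedge).
have nT : \forall s \near (0 : R), T (tc (g s)).
  have nTp := open_nbhs_nbhs (conj oT Tp); rewrite -g0 in nTp.
  exact: (near_comp tcc nTp).
have /nbhs_ballP[d' /= d'0 Hd'] : \forall s \near (0 : R), ball 0 d s /\
    ((spacetime I (g s) -> ~ edge P (g s)) /\ T (tc (g s))).
  have nb := nbhsx_ballx (0 : R) d d0.
  near=> s; split; first by near: s.
  by split; near: s.
pose J := ball (0 : R) d'.
have J0 : J 0 by exact: ballxx.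
have oJ : open J by exact: ball_open.
have gJ : null_geodesic I f J g.
  apply: (null_geodesic_restrict gn); first by move=> s /Hd'[].
  - exact: oJ.
  - by rewrite /J ball_itv; exact: interval_is_interval.
  - by exists 0.
have JP s : J s -> P (g s).
  move=> Js; apply: (gP J g gJ _ 0 J0 _ _ s Js).1.
  - move=> z Jz; have [_ [ne _]] := Hd' z Jz; apply: ne.
    by have [[_ _ _ /(_ z Jz)[]]] := gJ.
  - by rewrite g0.
  - by rewrite g0 g10.
have JF : forall s, J s -> rc (g s) = h (tc (g s)) /\
    rc (derive1 g s) / tc (derive1 g s) = h1 (tc (g s)).
  apply: (null_geodesic_follows hS hn gJ hT J0).
  - by move=> s /Hd'[_ []].
  - by rewrite g0 hp.
  - by rewrite g0 g10 !pointE h1p.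
have ode s (Js : J s) := null_geodesic_slope hS hn gJ Js.
(* [K] expresses the parameter of the geodesic through time, possible because [dt/ds] is nonzero at
   [p]. *)
have [K K0 HK] : exists2 K : R -> R, K (tc (g 0)) = 0 & \forall t \near tc (g 0),
    tc (g (K t)) = t /\ is_derive t (1 : R) K (tc (derive1 g (K t)))^-1.
  apply: (@local_inverse R (fun s => tc (g s)) (fun s => tc (derive1 g s))).
  - by apply: filterS (open_nbhs_nbhs (conj oJ J0)) => s /ode[].
  - by have [] := ode 0 J0.
  - by rewrite g10 tc_point.
rewrite g0 in K0 HK.
have Kc : {for tc p, continuous K}.
  by have [_ Kd] := nbhs_singleton HK; exact: is_derive1_continuous Kd.
have nK : \forall t \near tc p, J (K t).
  have nJ := open_nbhs_nbhs (conj oJ J0); rewrite -K0 in nJ.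
  exact: (near_comp Kc nJ).
exists T, h, h1; split; first exact: hT.
apply: filterS2 HK nK => t [tK _] JK; split.
  by have [_ [_]] := Hd' _ JK; rewrite tK.
move=> q qt; have [rK _] := JF _ JK; rewrite tK in rK.
have := @symmetric_slice P (g (K t)) q sP (JP _ JK).
by rewrite tK rK; apply.
Unshelve. all: by end_near. Qed.

(** Symmetry leaves one radius over each time, and the set of times is an interval because [P] is
    connected. Openness and the differential equation are local and come from the geodesics inside
    [P]. *)
Lemma photon_surfaceE P : symmetric_photon_surface I f P ->
  exists T h h1, [/\ profile I f T h h1, T !=set0 & P = surface T h].
Proof.
move=> hP; have [[[[p0 Pp0] PS _] _ _] sP] := hP.
pose T := @tc R n @` P.
pose h t := xget 0 [set r | exists2 p, P p & tc p = t /\ rc p = r].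
have hE p : P p -> h (tc p) = rc p.
  move=> Pp; rewrite /h; case: xgetP => [r _ [q Pq [qp <-]]|/(_ (rc p))].
    by have /(symmetric_slice sP Pp qp)[] := Pq.
  by case; exists p.
have PE : P = surface T h.
  apply/seteqP; split=> p.
    by move=> Pp; have [_ x1] := PS p Pp; split=> //; [exists p|rewrite hE].
  move=> [[q Pq qp] ph x1]; apply/(symmetric_slice sP Pq) => //.
  by split=> //; rewrite ph -qp hE.
have loc p : P p -> exists S g g1, profile I f S g g1 /\
    \forall t \near tc p, [/\ S t, T t & h t = g t].
  move=> Pp; have [S [g [g1 [hg nS]]]] := photon_surface_local hP Pp.
  exists S, g, g1; split; first exact: hg.
  have [_ x1] := PS p Pp.
  apply: filterS nS => t [St H].
  have Pt : P (point t (g t) (xc p)) by apply/H => //; split.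
  split=> //; first by exists (point t (g t) (xc p)).
  by have := hE _ Pt; rewrite !pointE.
pose h1 := 'D_(1 : R) h.
exists T, h, h1; split=> //; last by exists (tc p0); exists p0.
split.
- rewrite openE => t [p Pp <-]; have [S [g [g1 [_ nS]]]] := loc p Pp.
  by apply: filterS nS => z [].
- apply/connected_intervalP; apply: connected_continuous_connected; first by case: sP.
  by apply: continuous_subspaceT; exact: tc_continuous.
move=> t [p Pp <-]; have [S [g [g1 [[oS iS Hg] nS]]]] := loc p Pp.
(* To inherit the second-order equation, the derivative [h1] has to agree with [g1] on a
   neighbourhood and not only at the point. *)
have nnS : \forall t \near tc p, \forall z \near t, [/\ S z, T z & h z = g z].
  by apply: nbhs_interior; exact: nS.
have dh z : (\forall z' \near z, [/\ S z', T z' & h z' = g z']) ->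
    is_derive z (1 : R) h (g1 z).
  move=> nz; have [Sz _ _] := nbhs_singleton nz; have [_ _ gd _] := Hg z Sz.
  by apply: near_eq_is_derive gd; apply: filterS nz => z' [].
have h1g : \forall z \near tc p, h1 z = g1 z.
  by apply: filterS nnS => z /dh /@derive_val.
have [Sp _ hp] := nbhs_singleton nS; have h1p := nbhs_singleton h1g.
have [Ig mg gd g1d] := Hg _ Sp.
rewrite hp h1p; split=> //; first exact: dh.
by apply: near_eq_is_derive g1d; apply: filterS h1g.
Qed.

End PhotonSurfaces.

(** * Principal null hypersurfaces *)

Lemma derive0_constant (R : realType) (J : set R) (k : R -> R) s s' :
  is_interval J -> (forall z, J z -> is_derive z (1 : R) k 0) -> J s -> J s' ->
  k s = k s'.
Proof.
move=> iJ kd; wlog ss' : s s' / s <= s'.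
  by move=> W Js Js'; have [/W|/ltW/W e] := leP s s'; [apply|apply/esym/e].
move=> Js Js'; have [z zs|c _] := @MVT_le R k (fun=> 0) s s' ss'.
  by apply: kd; exact: (iJ s s').
by rewrite mul0r => /eqP; rewrite subr_eq0 => /eqP.
Qed.

Section Principal.
Variables (R : realType) (n : nat) (I : set R) (f : R -> R).
Hypothesis hS : class_S I f.
Hypothesis hn : (1 < n)%N.
(* The tortoise coordinate. *)
Variable rstar : R -> R.
Hypothesis rstarE : forall r, I r -> is_derive r (1 : R) rstar (f r)^-1.
Implicit Types p q u v w : ambient R n.

Local Notation f1 := ('D_(1 : R) f).

Definition null_surface (sg kp : R) : set (ambient R n) :=
  [set p | [/\ I (rc p), tc p = kp + sg * rstar (rc p) & unit_sphere (xc p)]].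

Lemma tangent_null_surfaceP sg kp p v : null_surface sg kp p ->
  tangent_space (null_surface sg kp) p v <->
  dot (xc v) (xc p) = 0 /\ tc v = sg * rc v / f (rc p).
Proof.
move=> Hp; have [Ip tE x1] := Hp; have Td := rstarE Ip.
have pS : spacetime I p by split.
split=> [tv|[vx vt]].
  have HS : null_surface sg kp `<=` spacetime I by move=> q [? _ ?]; split.
  have /(tangent_spacetimeP hS hn v pS) vx := tangent_spaceS HS tv.
  split=> //; have [c [c0 cP cv]] := tv.
  have td := is_derive_tc cv; have rd := is_derive_rc cv.
  rewrite -c0 in Td.
  have cd := derive_compf (f := fun s => rc (c s)) Td rd.
  have td' : is_derive (0 : R) (1 : R) (fun s => tc (c s))
      (0 + (0 * rstar (rc (c 0)) + sg * ((f (rc (c 0)))^-1 * rc v))).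
    have D := derive_addf (derive_cstf kp (0:R) (1:R))
      (derive_mulf (derive_cstf sg (0:R) (1:R)) cd).
    by apply: near_eq_is_derive D; apply: filterS cP => s [_ ->].
  have := @derive_val _ _ _ _ _ _ _ td; rewrite (@derive_val _ _ _ _ _ _ _ td') => <-.
  by rewrite c0; field; exact: (class_S_neq0 hS Ip).
have [y [y0 y1 yd]] := sphere_curve hn x1 vx.
have rd := derive_addf (derive_cstf (rc p) (0 : R) (1 : R))
  (derive_mulf (is_derive_id (0 : R) (1 : R)) (derive_cstf (rc v) (0 : R) (1 : R))).
have r0 : rc p + (0 : R) * rc v = rc p by rewrite mul0r addr0.
rewrite -{1}r0 in Td.
have cd := derive_compf (f := fun s : R => rc p + s * rc v) Td rd.
have td := derive_addf (derive_cstf kp (0:R) (1:R))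
      (derive_mulf (derive_cstf sg (0:R) (1:R)) cd).
exists (fun s : R => point (kp + sg * rstar (rc p + s * rc v)) (rc p + s * rc v) (y s)).
split.
- by rewrite mul0r addr0 y0 -tE -point_eta.
- have nI : \forall s \near (0 : R), I (rc p + s * rc v).
    apply: (near_comp (g := fun s : R => rc p + s * rc v)).
      exact: is_derive1_continuous rd.
    by rewrite mul0r addr0; exact: (near_class_S hS Ip).
  by apply: filterS nI => s Is; split=> //=; exact: y1.
- apply: (is_derive_eq (is_derive_point td rd yd)).
  by rewrite [RHS]point_eta vt; congr (point _ _ _);
    [field; exact: (class_S_neq0 hS Ip)|rewrite mulr0 addr0 mul1r add0r].
Qed.

Section Geodesic.
Variables (b c sg kp : R) (x0 : 'rV[R]_n).
Hypotheses (c0 : c != 0) (sg1 : sg ^+ 2 = 1) (x01 : unit_sphere x0).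

(** On a principal null geodesic [r] is affine in the parameter, so the geodesic extends exactly as
    long as [b + c * s] stays in [I]. *)
Definition principal_domain : set R := [set s | I (b + c * s)].

Definition principal_curve (s : R) : ambient R n :=
  point (kp + sg * rstar (b + c * s)) (b + c * s) x0.

Let rd s : is_derive s (1 : R) (fun s : R => b + c * s) c.
Proof.
apply: (is_derive_eq (derive_addf (derive_cstf b s (1:R))
  (derive_mulf (derive_cstf c s (1:R)) (is_derive_id s (1:R))))).
by rewrite add0r mul0r add0r mulr1.
Qed.

Lemma principal_domain_open : open principal_domain.
Proof.
apply: (open_comp (f := fun s : R => b + c * s)); last exact: class_S_open hS.
by move=> s _; exact: is_derive1_continuous (rd s).
Qed.

Lemma principal_domain_interval : is_interval principal_domain.
Proof.
move=> s s' Js Js' z /andP[sz zs']; rewrite /principal_domain/=.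
have iI := class_S_interval hS.
have [cp|cn] := leP 0 c.
  by apply: (iI _ _ Js Js'); rewrite !lerD2l !ler_wpM2l.
by apply: (iI _ _ Js' Js); rewrite !lerD2l !ler_wnM2l// ltW.
Qed.

Lemma principal_domain_hits r : I r -> principal_domain ((r - b) / c).
Proof. by move=> Ir; rewrite /principal_domain/= mulrC divfK// addrC subrK. Qed.

Lemma principal_curve_geodesic : geodesic I f principal_domain principal_curve /\
  forall s, principal_domain s -> derive1 principal_curve s =
    point (sg * c / f (b + c * s)) c 0.
Proof.
have [r0 Ir0] := class_S_nonempty hS.
apply: (@geodesic_criterion R n I f hS hn principal_domain
  (fun s => kp + sg * rstar (b + c * s)) (fun s => sg * c / f (b + c * s))
  (fun s => - (sg * c * (f1 (b + c * s) * c)) / f (b + c * s) ^+ 2)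
  (fun s => b + c * s) (fun=> c) (fun=> 0) (fun=> x0) (fun=> 0) (fun=> 0)
  principal_domain_open principal_domain_interval).
- by exists ((r0 - b) / c); exact: principal_domain_hits.
- by move=> s Js; split.
- move=> s Js; split.
  + have Td := derive_compf (f := fun s : R => b + c * s) (rstarE Js) (rd s).
    apply: (is_derive_eq (derive_addf (derive_cstf kp s (1:R))
      (derive_mulf (derive_cstf sg s (1:R)) Td))).
    by rewrite add0r mul0r add0r -mulrA; congr (_ * _); rewrite mulrC.
  + exact: rd.
  + exact: is_derive_cstv.
- move=> s Js; split.
  + have fd := derive_compf (f := fun s : R => b + c * s) (class_S_is_derive hS Js) (rd s).
    have iv := derive_invf (class_S_neq0 hS Js) fd.
    apply: (is_derive_eq (derive_mulf (derive_cstf (sg * c) s (1:R)) iv)).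
    by field; exact: (class_S_neq0 hS Js).
  + exact: derive_cstf.
  + exact: is_derive_cstv.
- move=> s Js; have fs := class_S_neq0 hS Js; split.
  + by field; exact: fs.
  + rewrite dot0l mulr0 subr0 !exprMn sg1; field; exact: fs.
  + by move=> w _; rewrite !dot0l !mulr0 addr0.
Qed.

Lemma principal_curve_null : null_geodesic I f principal_domain principal_curve.
Proof.
have [gg g1] := principal_curve_geodesic.
split; first exact: gg.
move=> s Js; rewrite (g1 s Js); have fs := class_S_neq0 hS Js; split.
  by move=> /(congr1 (@rc R n)); rewrite rc_point => /eqP; rewrite (negbTE c0).
rewrite metricE !pointE dot0l mulr0 addr0.
by rewrite !exprMn sg1; field; exact: fs.
Qed.

Lemma principal_curve_principal : principal principal_domain principal_curve.
Proof.
have [gg g1] := principal_curve_geodesic.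
by move=> s Js; rewrite /angular_momentum (g1 s Js) xc_point dot0l sqrtr0 mulr0.
Qed.

(** At a limit of the domain inside [J'], the radius of the extension equals [b + c * s] by
    continuity and lies in [I], so the limit already belongs to the domain. *)
Lemma principal_curve_maximal :
  maximally_extended I f principal_domain principal_curve.
Proof.
move=> J' g' gg' JJ' gE; have [oJ' iJ' _ G' _] := gg'.
have [r0 Ir0] := class_S_nonempty hS.
have J0 := principal_domain_hits Ir0.
apply/seteqP; split=> //.
apply: (interval_clopen iJ' (JJ' _ J0) J0).
  move=> s _ Js; have := open_nbhs_nbhs (conj principal_domain_open Js).
  by apply: filterS.
move=> s J's cl.
have [[Ir _] _ _] := G' s J's.
have [gd _] := geodesic_is_derive gg' J's.
suff E : rc (g' s) = b + c * s by rewrite /principal_domain/= -E.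
apply: (closure_eq_continuous (g := fun s => rc (g' s)) (h := fun s => b + c * s) cl).
- exact: is_derive1_continuous (is_derive_rc gd).
- exact: is_derive1_continuous (rd s).
- by move=> z [_ Jz]; rewrite (gE z Jz).
Qed.

Lemma principal_curve_generated :
  generated principal_domain principal_curve = null_surface sg kp.
Proof.
apply/seteqP; split=> p.
  by move=> [s [Js pt pr x1]]; split=> //; rewrite pr// pt.
move=> [Ir pt x1]; exists ((rc p - b) / c).
have E : b + c * ((rc p - b) / c) = rc p by rewrite mulrC divfK// addrC subrK.
split; [exact: principal_domain_hits| | |exact: x1].
- by rewrite /principal_curve tc_point E.
- by rewrite /principal_curve rc_point E.
Qed.

End Geodesic.

Lemma null_surface_maximal sg kp : sg ^+ 2 = 1 ->
  (exists x : 'rV[R]_n, unit_sphere x) ->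
  maximal_principal_null_hypersurface I f (null_surface sg kp).
Proof.
move=> sg1 [x x1]; have n1 : (1 : R) != 0 by exact: oner_neq0.
exists (principal_domain 0 1), (principal_curve 0 1 sg kp x).
split.
- exact: principal_curve_null.
- exact: principal_curve_principal.
- exact: principal_curve_maximal.
- by rewrite principal_curve_generated.
Qed.

(** The constants are conserved quantities: without angular part nullness makes [r''] vanish, so [c]
    is the radial velocity; [sg] is the energy [f t'] divided by [c]; and [kp] is
    [t - sg * rstar r]. *)
Lemma principal_geodesicE J (g : R -> ambient R n) : null_geodesic I f J g ->
  principal J g -> exists b c sg kp x, [/\ c != 0, sg ^+ 2 = 1, unit_sphere x &
    forall s, J s -> I (b + c * s) /\ g s = principal_curve b c sg kp x s].
Proof.
move=> gn gp; have [gg N] := gn; have [oJ iJ [s0 Js0] GS _] := gg.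
have Ir s : J s -> I (rc (g s)) by case/GS => -[].
have xc0 s : J s -> xc (derive1 g s) = 0.
  move=> Js; apply: dot_eq0; have /eqP := gp s Js.
  rewrite /angular_momentum mulf_eq0 sqrf_eq0 (negbTE (class_S_r_neq0 hS (Ir s Js)))/=.
  by rewrite sqrtr_eq0 => h; apply/eqP; rewrite eq_le h dot_ge0.
have nn s (Js : J s) := null_norm hS (Ir s Js) (N s Js).2.
have ode s (Js : J s) := null_geodesic_ode hS hn gn Js.
pose a s := tc (derive1 g s); pose d s := rc (derive1 g s).
have fad s : J s -> (f (rc (g s)) * a s) ^+ 2 = d s ^+ 2.
  by move=> Js; have := nn s Js; rewrite (xc0 s Js) dot0l mulr0 addr0.
have dd s : J s -> is_derive s (1 : R) d 0.
  move=> Js; have [_ _ _ h] := ode s Js; apply: (is_derive_eq h).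
  by have := fad s Js; rewrite /a /d => ->; rewrite subrr mul0r.
pose c := d s0.
have dc s : J s -> d s = c by move=> Js; exact: (derive0_constant iJ dd).
have a0 s : J s -> a s != 0 by move=> Js; exact: (null_tc_neq0 hS (Ir s Js) (N s Js)).
have f0 s : J s -> f (rc (g s)) != 0 by move=> Js; exact: (class_S_neq0 hS (Ir s Js)).
have c0 : c != 0.
  by rewrite -sqrf_eq0 /c -(fad s0 Js0) sqrf_eq0 mulf_neq0 ?f0 ?a0.
pose b := rc (g s0) - c * s0.
have rE s : J s -> rc (g s) = b + c * s.
  move=> Js; pose k s := rc (g s) - c * s.
  have kd z : J z -> is_derive z (1 : R) k 0.
    move=> Jz; have [_ rd _ _] := ode z Jz.
    apply: (is_derive_eq (derive_subf rd
      (derive_mulf (derive_cstf c z (1:R)) (is_derive_id z (1:R))))).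
    by have := dc z Jz; rewrite /d => ->; rewrite mul0r add0r mulr1 subrr.
  have := derive0_constant iJ kd Js Js0; rewrite /k /b => <-.
  by rewrite subrK.
pose sg := f (rc (g s0)) * a s0 / c.
have sgE s : J s -> f (rc (g s)) * a s = sg * c.
  move=> Js; pose k s := f (rc (g s)) * a s.
  have kd z : J z -> is_derive z (1 : R) k 0.
    move=> Jz; have [_ rd ad _] := ode z Jz.
    have fd := derive_compf (f := fun s => rc (g s)) (class_S_is_derive hS (Ir z Jz)) rd.
    apply: (is_derive_eq (derive_mulf fd ad)); rewrite -/(a z).
    by field; exact: f0.
  by have := derive0_constant iJ kd Js Js0; rewrite /k /sg divfK.
have sg1 : sg ^+ 2 = 1.
  by rewrite /sg expr_div_n fad// divff// expf_neq0.
pose kp := tc (g s0) - sg * rstar (rc (g s0)).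
have tE s : J s -> tc (g s) = kp + sg * rstar (rc (g s)).
  move=> Js; pose k s := tc (g s) - sg * rstar (rc (g s)).
  have kd z : J z -> is_derive z (1 : R) k 0.
    move=> Jz; have [td rd _ _] := ode z Jz.
    have Td := derive_compf (f := fun s => rc (g s)) (rstarE (Ir z Jz)) rd.
    apply: (is_derive_eq (derive_subf td (derive_mulf (derive_cstf sg z (1:R)) Td))).
    have := dc z Jz; rewrite /d => ->; rewrite -/(a z) mul0r add0r.
    apply: (mulfI (f0 z Jz)); rewrite mulr0 mulrBr (sgE z Jz).
    by field; exact: f0.
  by have := derive0_constant iJ kd Js Js0; rewrite /k /kp => <-; rewrite subrK.
have xE s : J s -> xc (g s) = xc (g s0).
  move=> Js; apply/rowP => i; apply: (derive0_constant (k := fun s => xc (g s) 0 i) iJ) => //.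
  move=> z Jz; have [gd _] := geodesic_is_derive gg Jz.
  apply: (is_derive_eq (is_derive_coord 0 i (is_derive_xc gd))).
  by rewrite (xc0 z Jz) mxE.
exists b, c, sg, kp, (xc (g s0)); split=> //; first by have [[]] := GS s0 Js0.
move=> s Js; split; first by rewrite -(rE s Js); exact: Ir.
by rewrite [g s]point_eta /principal_curve -(rE s Js) -(tE s Js) (xE s Js).
Qed.

(** The given geodesic is a restriction of a principal curve, so by its maximality the domains
    coincide and it passes through every radius in [I]. *)
Lemma maximal_principalE H : maximal_principal_null_hypersurface I f H ->
  exists sg kp, sg ^+ 2 = 1 /\ H = null_surface sg kp.
Proof.
move=> [J [g [gn gp gm ->]]].
have [b [c [sg [kp [x [c0 sg1 x1 E]]]]]] := principal_geodesicE gn gp.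
exists sg, kp; split=> //.
have [gg _] := principal_curve_geodesic b kp c0 sg1 x1.
have JE : principal_domain b c = J.
  apply: (gm _ _ gg); first by move=> s /E[].
  by move=> s /E[].
rewrite -(principal_curve_generated b sg kp x c0) JE.
apply/seteqP; split=> p [s [Js pt pr x1']]; exists s.
  by have [_ <-] := E s Js.
by have [_ ->] := E s Js.
Qed.

End Principal.

(** * Lifts of null bundles *)

Section Lifts.
Variables (R : realType) (n : nat) (I : set R) (f : R -> R).
Hypothesis hS : class_S I f.
Hypothesis hn : (1 < n)%N.
Implicit Types (p u v w om : ambient R n) (P : set (ambient R n)).

Definition flat p v : ambient R n :=
  point (- f (rc p) * tc v) (rc v / f (rc p)) (rc p ^+ 2 *: xc v).

Lemma exists_unit : exists x : 'rV[R]_n, unit_sphere x.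
Proof.
pose i : 'I_n := Ordinal (ltnW hn); exists (delta_mx 0 i).
rewrite /unit_sphere/= /dot (bigD1 i)//= big1 ?addr0 ?mxE ?eqxx ?mulr1//.
by move=> j ji; rewrite mxE (negbTE ji) andbF mul0r.
Qed.

Lemma pairing_flat p v w : pairing (flat p v) w = metric f p v w.
Proof. by rewrite /pairing /metric /flat !pointE dotZl; ring. Qed.

(** The normalisation of [om] makes the dual unique: the difference of the two angular parts is
    orthogonal to [xc p] and hence itself an admissible test vector. *)
Lemma metric_dualP p v om : spacetime I p -> dot (xc v) (xc p) = 0 ->
  dot (xc om) (xc p) = 0 -> metric_dual I f p v om <-> om = flat p v.
Proof.
move=> pS vx omx; split=> [D|-> w _]; last exact: pairing_flat.
have D' w : dot (xc w) (xc p) = 0 -> pairing om w = pairing (flat p v) w.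
  by move=> wx; rewrite pairing_flat; apply/D/(tangent_spacetimeP hS hn w pS).
have Et : tc om = tc (flat p v).
  have := D' (point 1 0 0); rewrite pointE dot0l => /(_ erefl).
  by rewrite /pairing !pointE !dot0r !mulr0 !mulr1 !addr0.
have Er : rc om = rc (flat p v).
  have := D' (point 0 1 0); rewrite pointE dot0l => /(_ erefl).
  by rewrite /pairing !pointE !dot0r !mulr0 !mulr1 !addr0 !add0r.
have Ex : xc om = xc (flat p v).
  pose x := xc om - xc (flat p v).
  have fx : dot (xc (flat p v)) (xc p) = 0 by rewrite xc_point dotZl vx mulr0.
  have xx : dot x (xc p) = 0.
    by rewrite /x -scaleN1r dotDl dotZl omx fx mulr0 addr0.
  have := D' (point 0 0 x); rewrite xc_point => /(_ xx).
  rewrite /pairing !tc_point !rc_point !xc_point !mulr0 !add0r => e.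
  have : dot x x = 0 by rewrite {1}/x -scaleN1r dotDl dotZl e mulN1r subrr.
  by move=> /dot_eq0/eqP; rewrite subr_eq0 => /eqP.
by rewrite [om]point_eta Et Er Ex -point_eta.
Qed.

Lemma flat_inj p v v' : I (rc p) -> flat p v = flat p v' -> v = v'.
Proof.
move=> Ip E; have f0 := class_S_neq0 hS Ip; have r0 := class_S_r_neq0 hS Ip.
have Et : tc v = tc v'.
  have /(congr1 (@tc R n)) := E; rewrite !pointE => /mulfI; apply.
  by rewrite oppr_eq0.
have Er : rc v = rc v'.
  have /(congr1 (@rc R n)) := E; rewrite !pointE => /mulIf; apply.
  by rewrite invr_eq0.
have Ex : xc v = xc v'.
  have /(congr1 (@xc R n)) := E; rewrite !pointE => /scalerI; apply.
  by rewrite expf_neq0.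
by rewrite [v]point_eta Et Er Ex -point_eta.
Qed.

Lemma null_liftP P z : P `<=` spacetime I -> null_lift I f P z <->
  exists v, [/\ P z.1, tangent_space P z.1 v, null_vector f z.1 v & z.2 = flat z.1 v].
Proof.
case: z => p om /= PS; split.
  move=> [[pS omx] [v [/= Pp tv nv] D]]; exists v; split=> //.
  apply/(metric_dualP pS) => //.
  by apply/(tangent_spacetimeP hS hn v pS); exact: tangent_spaceS PS _.
move=> [v [Pp tv nv ->]]; have pS := PS p Pp.
have vx : dot (xc v) (xc p) = 0.
  by apply/(tangent_spacetimeP hS hn v pS); exact: tangent_spaceS PS _.
have fx : dot (xc (flat p v)) (xc p) = 0 by rewrite xc_point dotZl vx mulr0.
split; first by split.
by exists v; [split|apply/(metric_dualP pS)].
Qed.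

Lemma null_sectionP z : null_section I f z <->
  exists v, [/\ spacetime I z.1, dot (xc v) (xc z.1) = 0, null_vector f z.1 v
    & z.2 = flat z.1 v].
Proof.
case: z => p om /=; split.
  move=> [[/= pS omx] om0 [v [/(tangent_spacetimeP hS hn v pS) vx D vv]]].
  have E : om = flat p v by apply/(metric_dualP pS).
  exists v; split=> //; split=> // v0; apply: om0.
  by rewrite E v0 /flat mulr0 mul0r scaler0.
move=> [v [pS vx [v0 vv] E]].
have omx : dot (xc om) (xc p) = 0 by rewrite E xc_point dotZl vx mulr0.
split; first by split.
- move=> /= om0; apply: v0; apply: (@flat_inj p); first by case: pS.
  by rewrite -E om0 /flat mulr0 mul0r scaler0.
- exists v; split=> //; first exact/(tangent_spacetimeP hS hn v pS).
  exact/(metric_dualP pS).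
Qed.

(** This strict inequality for nonzero angular part, against the equality for radial vectors, is
    what separates the lifts of photon surfaces from those of principal hypersurfaces. *)
Lemma null_slope_lt p v : I (rc p) -> null_vector f p v -> xc v <> 0 ->
  `|rc v / tc v| < f (rc p).
Proof.
move=> Ip nv x0; have t0 := null_tc_neq0 hS Ip nv.
have f0 := class_S_f_gt0 hS Ip; have r0 := class_S_r_gt0 hS Ip.
rewrite normrM normfV ltr_pdivrMr ?normr_gt0//.
rewrite -(ltr_pXn2r (n := 2))// ?nnegrE ?mulr_ge0 ?(ltW f0)//.
rewrite exprMn !real_normK ?num_real// -exprMn (null_norm hS Ip nv.2) ltrDl.
by rewrite mulr_gt0 ?dot_gt0// mulr_gt0// exprn_gt0.
Qed.

Lemma null_slope_eq p v : I (rc p) -> null_vector f p v -> xc v = 0 ->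
  exists2 sg : R, sg ^+ 2 = 1 & tc v = sg * rc v / f (rc p).
Proof.
move=> Ip nv x0; have t0 := null_tc_neq0 hS Ip nv.
have f0 := class_S_neq0 hS Ip.
have nn := null_norm hS Ip nv.2; rewrite x0 dot0l mulr0 addr0 in nn.
have r0 : rc v != 0 by rewrite -sqrf_eq0 -nn sqrf_eq0 mulf_neq0.
exists (f (rc p) * tc v / rc v).
  by rewrite expr_div_n nn divff// expf_neq0.
by field; rewrite f0 r0.
Qed.

Definition maximal_profile_at (t0 r0 m : R) T h h1 :=
  [/\ profile I f T h h1, T t0, h t0 = r0, h1 t0 = m &
    forall T' g g1, profile I f T' g g1 -> T' t0 -> g t0 = r0 -> g1 t0 = m ->
      T' `<=` T /\ forall t, T' t -> g t = h t /\ g1 t = h1 t].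

Lemma surface_symmetric_photon T h h1 : profile I f T h h1 -> T !=set0 ->
  symmetric_photon_surface I f (surface T h : set (ambient R n)).
Proof.
move=> hT T0; split; first exact: (surface_photon hS hn hT T0 exists_unit).
exact: (surface_symmetric hn hT exists_unit).
Qed.

(** A larger symmetric photon surface has a profile [g] that extends [h]. Agreement on the open set
    [T] forces equal derivatives at [t0], and maximality of [h] then confines the domain of [g]. *)
Lemma surface_maximal t0 r0 m T h h1 : maximal_profile_at t0 r0 m T h h1 ->
  maximal_symmetric_photon_surface I f (surface T h : set (ambient R n)).
Proof.
move=> [hT T0 h0 h10 M]; split; first by apply: (surface_symmetric_photon hT); exists t0.
move=> P' sP' PP'; have [T' [g [g1 [hT' _ P'E]]]] := photon_surfaceE hS hn sP'.
have [x x1] := exists_unit.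
have sub t : T t -> T' t /\ h t = g t.
  move=> Tt; have : P' (point t (h t) x) by apply: PP'; split.
  by rewrite P'E => -[].
have [T't0 hg0] := sub _ T0.
have [oT _ H] := hT; have [oT' _ H'] := hT'.
have g10 : g1 t0 = m.
  have [_ _ hd _] := H _ T0; have [_ _ gd _] := H' _ T't0.
  have hd' : is_derive t0 (1 : R) g (h1 t0).
    apply: near_eq_is_derive hd.
    by apply: filterS (open_nbhs_nbhs (conj oT T0)) => z /sub[].
  rewrite -h10 -(@derive_val _ _ _ _ _ _ _ hd').
  by rewrite (@derive_val _ _ _ _ _ _ _ gd).
have [T'T E] := M T' g g1 hT' T't0 (etrans (esym hg0) h0) g10.
apply/seteqP; split=> [|p]; last exact: PP'.
rewrite P'E => p [T'p pg x1']; split=> //; first exact: T'T.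
by rewrite pg; have [] := E _ T'p.
Qed.

Lemma surface_tangent_null T h h1 p v : profile I f T h h1 -> surface T h p ->
  null_vector f p v -> tangent_space (surface T h) p v ->
  rc v / tc v = h1 (tc p).
Proof.
move=> hT Pp nv /(tangent_surfaceP hS hn _ hT Pp)[_ ->].
have [Ip _] := surface_spacetime hT Pp.
by rewrite mulfK//; exact: (null_tc_neq0 hS Ip nv).
Qed.

Lemma photon_tangentE P p v : maximal_symmetric_photon_surface I f P -> P p ->
  tangent_space P p v -> null_vector f p v -> `|rc v / tc v| < f (rc p) /\
  forall T h h1, maximal_profile_at (tc p) (rc p) (rc v / tc v) T h h1 ->
    P = surface T h.
Proof.
move=> [sP maxP] Pp tv nv.
have [T [h [h1 [hT T0 PE]]]] := photon_surfaceE hS hn sP.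
rewrite {}PE in maxP Pp tv *.
have [Tp pE x1] := Pp; have [_ _ H] := hT; have [_ mf _ _] := H _ Tp.
have sl := surface_tangent_null hT Pp nv tv.
rewrite sl; split; first by rewrite pE.
move=> T' g g1 [hT' T'0 g0 g10 M].
have [TT' E] := M T h h1 hT Tp (esym pE) erefl.
apply/esym/maxP; first by apply: (surface_symmetric_photon hT'); exists (tc p).
move=> q [Tq qE q1]; split=> //; first exact: TT'.
by rewrite qE; have [] := E _ Tq.
Qed.

Lemma lifted_spacetime P : lifted_hypersurfaces I f P -> P `<=` spacetime I.
Proof.
move=> [[[[[_ PS _] _ _] _] _] //|[J [g [[gg _] _ _ ->]]]].
move=> p [s [Js _ pr x1]]; have [_ _ _ /(_ s Js)[[Ir _] _ _] _] := gg.
by split; rewrite // pr.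
Qed.

Lemma exists_tortoise : exists rstar : R -> R,
  forall r, I r -> is_derive r (1 : R) rstar (f r)^-1.
Proof.
have [r0 Ir0] := class_S_nonempty hS.
have [|T _ TE] := antiderivative (h := fun r => (f r)^-1) (class_S_open hS)
  (class_S_interval hS) Ir0.
  by move=> r Ir; apply: continuousV; [exact: (class_S_neq0 hS Ir)|
    exact: (class_S_continuous hS Ir)].
by exists T.
Qed.

Lemma lifts_partition : partition (@lifted_hypersurfaces R n I f) (null_lift I f)
  (null_section I f).
Proof.
have [rstar rstarE] := exists_tortoise.
split.
- apply/seteqP; split=> [[p om]|[p om]].
    move=> [P LP /(null_liftP _ (lifted_spacetime LP))[v [Pp tv nv E]]].
    apply/null_sectionP; exists v; split=> //; first exact: lifted_spacetime LP _ Pp.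
    have pS := lifted_spacetime LP Pp.
    by apply/(tangent_spacetimeP hS hn v pS)/(tangent_spaceS (lifted_spacetime LP)).
  move=> /null_sectionP[v [/= pS vx nv E]]; have [Ip x1] := pS.
  (* The angular part of the null vector decides which of the two families contains it. *)
  have [x0|x0] := pselect (xc v = 0).
    have [sg sg1 vt] := null_slope_eq Ip nv x0.
    pose kp := tc p - sg * rstar (rc p).
    have Hp : @null_surface R n I rstar sg kp p by split=> //; rewrite /kp subrK.
    have LH : lifted_hypersurfaces I f (@null_surface R n I rstar sg kp).
      by right; apply: (null_surface_maximal hS hn rstarE kp sg1); exact: exists_unit.
    exists (@null_surface R n I rstar sg kp) => //.
    apply/(null_liftP _ (lifted_spacetime LH)); exists v; split=> //.
    exact/(tangent_null_surfaceP hS hn rstarE _ Hp).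
  have mf := null_slope_lt Ip nv x0.
  have [T [h [h1 M]]] := maximal_profile hS (tc p) Ip mf.
  have LH : lifted_hypersurfaces I f (surface T h : set (ambient R n)).
    by left; exact: surface_maximal M.
  have [hT Tp hp h1p _] := M.
  exists (surface T h) => //.
  have Pp : surface T h p by split.
  apply/(null_liftP _ (lifted_spacetime LH)); exists v; split=> //.
  apply/(tangent_surfaceP hS hn _ hT Pp); split=> //.
  by rewrite h1p divfK//; exact: (null_tc_neq0 hS Ip nv).
- move=> P P' LP LP' [[p om] [/(null_liftP _ (lifted_spacetime LP))[v [/= Pp tv nv E]]
    /(null_liftP _ (lifted_spacetime LP'))[v' [/= P'p tv' _ E']]]].
  have [Ip x1] := lifted_spacetime LP Pp.
  have vv : v = v' by apply: (@flat_inj p) => //; rewrite -E -E'.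
  rewrite -{v' E'}vv in tv'.
  have t0 := null_tc_neq0 hS Ip nv.
  (* On a principal hypersurface the absolute value of the slope equals [f], on a photon surface it
     is smaller. *)
  have excl H0 : maximal_principal_null_hypersurface I f H0 -> H0 p ->
      tangent_space H0 p v -> ~ `|rc v / tc v| < f (rc p).
    move=> /(maximal_principalE hS hn rstarE)[sg [kp [sg1 ->]]] Hp.
    move=> /(tangent_null_surfaceP hS hn rstarE _ Hp)[_ vt].
    have f0 := class_S_neq0 hS Ip.
    have sg0 : sg != 0 by rewrite -sqrf_eq0 sg1 oner_neq0.
    have -> : rc v = sg * f (rc p) * tc v.
      by rewrite vt; transitivity (sg ^+ 2 * rc v); [rewrite sg1 mul1r|field].
    have sgn : `|sg| = 1.
      by apply/eqP; rewrite -(@eqrXn2 _ 2)// -normrX sg1 normr1 expr1n.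
    by rewrite mulfK// normrM sgn mul1r gtr0_norm ?ltxx// (class_S_f_gt0 hS Ip).
  case: LP LP' => [mP|mP] [mP'|mP'].
  + have [mf PE] := photon_tangentE mP Pp tv nv.
    have [_ PE'] := photon_tangentE mP' P'p tv' nv.
    have [T [h [h1 M]]] := maximal_profile hS (tc p) Ip mf.
    by rewrite (PE _ _ _ M) (PE' _ _ _ M).
  + have [mf _] := photon_tangentE mP Pp tv nv.
    by have := excl _ mP' P'p tv' mf.
  + have [mf _] := photon_tangentE mP' P'p tv' nv.
    by have := excl _ mP Pp tv mf.
  + have [sg [kp [sg1 PE]]] := maximal_principalE hS hn rstarE mP.
    have [sg' [kp' [sg1' PE']]] := maximal_principalE hS hn rstarE mP'.
    rewrite {}PE in Pp tv *; rewrite {}PE' in P'p tv' *.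
    have /(tangent_null_surfaceP hS hn rstarE _ Pp)[_ vt] := tv.
    have /(tangent_null_surfaceP hS hn rstarE _ P'p)[_ vt'] := tv'.
    have f0 := class_S_neq0 hS Ip.
    (* The common tangent vector has nonzero radial part, so it determines [sg], and the base point
       then determines [kp]. *)
    have r0 : rc v != 0.
      by apply/eqP => r0; move: t0; rewrite vt r0 mulr0 mul0r eqxx.
    have sgE : sg = sg'.
      move: vt'; rewrite vt => /mulIf; rewrite invr_eq0 => /(_ f0).
      by move=> /mulIf; apply.
    have [_ pt _] := Pp; have [_ pt' _] := P'p.
    congr (@null_surface _ _ _ _ _ _) => //.
    by move: pt'; rewrite pt sgE => /addIr.
- move=> P LP.
  suff [p [v [Pp tv nv]]] : exists p v, [/\ P p, tangent_space P p v & null_vector f p v].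
    exists (p, flat p v); apply/(null_liftP _ (lifted_spacetime LP)).
    by exists v.
  case: LP => [[[[[[p Pp] PS _] tP _] sP] _]|].
    have [vt [vr [k [e [_ _ tv nv _]]]]] := symmetric_null_tangent hS hn PS sP tP Pp.
    by exists p, (point vt vr (k *: e)).
  move=> /(maximal_principalE hS hn rstarE)[sg [kp [sg1 ->]]].
  have [r0 Ir0] := class_S_nonempty hS; have [x x1] := exists_unit.
  pose p : ambient R n := point (kp + sg * rstar r0) r0 x.
  have Pp : @null_surface R n I rstar sg kp p by split.
  exists p, (point (sg / f r0) 1 0); split=> //.
    by apply/(tangent_null_surfaceP hS hn rstarE _ Pp); rewrite !pointE dot0l mulr1.
  split; first by move=> /(congr1 (@rc R n))/eqP; rewrite rc_point oner_eq0.
  rewrite metricE !pointE dot0l mulr0 addr0 exprMn sg1; field.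
  exact: (class_S_neq0 hS Ir0).
Qed.

Lemma tangent_spaceN P p v : tangent_space P p v -> tangent_space P p (- v).
Proof.
move=> [c [c0 cP cv]]; exists (fun s => c (- s)); split.
- by rewrite oppr0.
- have cP' : \forall s \near - (0 : R), P (c s) by rewrite oppr0.
  exact: (near_comp (@oppr_continuous R R^o 0) cP').
- rewrite -oppr0 in cv.
  have D := is_derive_compv cv (derive_oppf (is_derive_id (0 : R) (1 : R))).
  by apply: (is_derive_eq D); rewrite scaleN1r.
Qed.

Lemma null_lift_not_connected P : lifted_hypersurfaces I f P ->
  ~ connected (null_lift I f P).
Proof.
move=> LP cA; have PS := lifted_spacetime LP.
have [_ _ /(_ P LP)[[p om]]] := lifts_partition.
move=> /(null_liftP _ PS)[v [/= Pp tv nv _]].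
have [Ip _] := PS p Pp.
have L w : tangent_space P p w -> null_vector f p w -> null_lift I f P (p, flat p w).
  by move=> tw nw; apply/(null_liftP _ PS); exists w.
have nvN : null_vector f p (- v).
  have [v0 vv] := nv; split; first by move=> /eqP; rewrite oppr_eq0 => /eqP.
  rewrite metricE in vv; rewrite metricE.
  have [-> -> ->] : [/\ tc (- v) = - tc v, rc (- v) = - rc v & xc (- v) = - xc v] by [].
  by rewrite !sqrrN -(scaleN1r (xc v)) dotZl dotZr !mulN1r opprK.
have A1 := L _ tv nv; have A2 := L _ (tangent_spaceN tv) nvN.
pose phi (z : ambient R n * ambient R n) := tc z.2.
have iA : is_interval (phi @` null_lift I f P).
  apply/connected_intervalP/connected_continuous_connected => //.
  apply: continuous_subspaceT => z.
  by apply: (@continuous_comp _ _ _ snd (@tc R n)); [exact: cvg_snd|exact: tc_continuous].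
have [[q om'] /(null_liftP _ PS)[w [/= Pq tw nw E]] t0] : (phi @` null_lift I f P) 0.
  have B1 : (phi @` null_lift I f P) (- f (rc p) * tc v) by exists (p, flat p v).
  have B2 : (phi @` null_lift I f P) (- (- f (rc p) * tc v)).
    by exists (p, flat p (- v)) => //; rewrite /phi/= tc_point mulrN.
  have [le0|ge0] := leP (- f (rc p) * tc v) 0.
    by apply: (iA _ _ B1 B2); rewrite le0 oppr_ge0.
  by apply: (iA _ _ B2 B1); rewrite oppr_le0 ltW.
have [Iq _] := PS q Pq.
move: t0; rewrite /phi/= E tc_point => /eqP; rewrite mulf_eq0 oppr_eq0.
by rewrite (negbTE (class_S_neq0 hS Iq)) (negbTE (null_tc_neq0 hS Iq nw)).
Qed.

End Lifts.

(** * Failure of flatness *)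

Section Lines.
Variables (R : realType) (E : normedModType R).
Implicit Types (h d : E -> R) (a w : E).

Lemma is_derive_line h a w (s : R) c : is_derive (a + s *: w) w h c ->
  is_derive s (1 : R) (fun s : R => h (a + s *: w)) c.
Proof.
move=> /is_deriveP D; apply/is_deriveP; move: D.
rewrite (_ : (fun t : R => t^-1 *: (h (a + (t *: 1 + s) *: w) - h (a + s *: w))) =
  (fun t : R => t^-1 *: (h (t *: w + (a + s *: w)) - h (a + s *: w))))//.
by apply/funext => t; rewrite scalerDl [t%:A]mulr1 addrCA.
Qed.

Lemma line_lipschitz h d a w (l K : R) :
  (forall s : R, `|s| <= `|l| -> is_derive (a + s *: w) w h (d (a + s *: w)) /\
     `|d (a + s *: w)| <= K) ->
  `|h (a + l *: w) - h a| <= K * `|l|.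
Proof.
move=> H; pose k s := h (a + s *: w).
have kd s : `|s| <= `|l| -> is_derive s (1 : R) k (d (a + s *: w)).
  by move=> /H[D _]; exact: is_derive_line.
have k0 : k 0 = h a by rewrite /k scale0r addr0.
rewrite -/(k l) -k0.
have [l0|/ltW l0] := leP 0 l.
  have [s /andP[s0 sl]|c /andP[s0 sl] ->] := @MVT_le R k (fun s => d (a + s *: w)) 0 l l0.
    by apply: kd; rewrite !ger0_norm.
  by rewrite subr0 normrM ler_wpM2r//; apply: (H c _).2; rewrite !ger0_norm.
have [s /andP[s0 sl]|c /andP[s0 sl] E1] := @MVT_le R k (fun s => d (a + s *: w)) l 0 l0.
  by apply: kd; rewrite !ler0_norm// lerN2.
rewrite distrC E1 sub0r normrM normrN ler_wpM2r//; apply: (H c _).2.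
by rewrite !ler0_norm// lerN2.
Qed.

Lemma near_parabola a w1 w2 u (W : set E) : nbhs a W ->
  exists2 d : R, 0 < d & forall eps b c s : R, `|eps| < d -> `|b| <= `|eps| ->
    `|c| <= `|eps| -> `|s| <= eps ^+ 2 -> W (a + b *: w1 + c *: w2 + s *: u).
Proof.
move=> /nbhs_ballP[rho /= rho0 We].
pose C := `|w1| + `|w2| + `|u| + 1.
have C0 : 0 < C by rewrite ltr_pwDr// !addr_ge0.
(* The bound 1 makes [eps ^+ 2] at most the absolute value of [eps], so the whole displacement is at
   most that value times [C], which is below [rho]. *)
exists (Num.min 1 (rho / C)); first by rewrite lt_min ltr01 divr_gt0.
move=> eps b c s; rewrite lt_min => /andP[eps1 epse] be ce se.
have eC : `|eps| * C < rho by rewrite -ltr_pdivlMr.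
have {}se : `|s| <= `|eps|.
  apply: (le_trans se); rewrite -real_normK ?num_real// expr2 ler_piMl//.
  exact: ltW.
apply: We; rewrite -ball_normE/= -!addrA opprD addNKr normrN.
apply: le_lt_trans eC; rewrite /C !mulrDr.
apply: (le_trans (ler_normD _ _)); rewrite -!addrA lerD ?normrZ ?ler_wpM2r//.
apply: (le_trans (ler_normD _ _)); rewrite lerD ?normrZ ?ler_wpM2r//.
by rewrite ler_wpDr ?mulr1// ler_wpM2r.
Qed.

(** The two points are the ends of a segment in the direction [w] through [a + eps ^+ 2 *: u], so
    [d] vanishes somewhere on it. If [d a] were nonzero, continuity would exclude such zeros for
    small [eps]. *)
Lemma even_derivative0 h d a w u (d1 : R) : 0 < d1 ->
  (\forall z \near a, is_derive z w h (d z)) -> {for a, continuous d} ->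
  (forall eps : R, 0 < eps -> eps < d1 ->
     h (a + eps *: w + eps ^+ 2 *: u) = h (a + (- eps) *: w + eps ^+ 2 *: u)) ->
  d a = 0.
Proof.
move=> d10 hd dc even; apply/eqP; apply: contrapT => /negP n0.
have [d2 d20 Hd] := near_parabola w 0 u (filterI hd (near_neq0 dc n0)).
pose eps := Num.min d1 d2 / 2.
have m0 : 0 < Num.min d1 d2 by rewrite lt_min d10.
have eps0 : 0 < eps by rewrite divr_gt0.
have [m1 m2] : Num.min d1 d2 <= d1 /\ Num.min d1 d2 <= d2 by rewrite !ge_min !lexx orbT.
have ev : h (a + eps *: w + eps ^+ 2 *: u) = h (a + (- eps) *: w + eps ^+ 2 *: u).
  by apply: even => //; rewrite /eps; lra.
have sub (s : R) : - eps <= s <= eps ->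
    is_derive (a + eps ^+ 2 *: u + s *: w) w h (d (a + eps ^+ 2 *: u + s *: w)) /\
    d (a + eps ^+ 2 *: u + s *: w) != 0.
  move=> se; have := Hd eps s 0 (eps ^+ 2).
  rewrite scaler0 addr0 normr0 (gtr0_norm eps0) ler_norml addrAC; apply => //.
  - by rewrite /eps; lra.
  - exact: ltW.
  - by rewrite ger0_norm ?sqr_ge0.
have nn : - eps <= eps by rewrite (@le_trans _ _ 0)// ?oppr_le0 ltW.
have [s se|c ce] := @MVT_le R (fun s => h (a + eps ^+ 2 *: u + s *: w))
    (fun s => d (a + eps ^+ 2 *: u + s *: w)) _ _ nn.
  by apply: is_derive_line; exact: (sub s se).1.
rewrite -(addrAC a) -[in X in _ - X](addrAC a) ev subrr => /esym/eqP.
rewrite mulf_eq0 (negbTE (sub c ce).2)/= subr_eq0 => /eqP e.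
by move: eps0; rewrite ltNge; apply/negP/negPn; lra.
Qed.

End Lines.

(** The range is an interval; a nondegenerate segment in it would be a countable set of positive
    Lebesgue measure. This keeps a path inside a lift in one slice. *)
Lemma countable_range_constant (R : realType) (g : R -> R) (C : set R) :
  continuous g -> countable C -> (forall s, C (g s)) -> forall s s', g s = g s'.
Proof.
move=> gc cC gC s s'; apply/eqP; apply: contrapT => /negP gs.
wlog lt_gs : s s' gs / g s < g s'.
  move=> W; have := gs; rewrite neq_lt => /orP[|lt_gs]; first exact: W.
  by apply: (W s' s) => //; rewrite eq_sym.
have ig : is_interval (range g).
  apply/connected_intervalP/connected_continuous_connected.
    by apply/connected_intervalP => ? ? _ _ ? _.
  exact: continuous_subspaceT.
have sub : `[g s, g s']%classic `<=` C.
  move=> y; rewrite /= in_itv/= => ys.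
  have [z _ <-] : range g y by apply: (ig (g s) (g s')).
  exact: gC.
have := countable_lebesgue_measure0 (sub_countable (subset_card_le sub) cC).
by rewrite lebesgue_measure_itv/= lte_fin lt_gs => /eqP; rewrite -EFinD eqe subr_eq0 gt_eqF.
Qed.

(** Coordinates are exchanged one at a time. Every coordinate of an intermediate point is one of [c]
    or [c0], so these points stay in any box around [c0] that contains [c]. *)
Lemma coord_telescope (R : realType) (q : nat) (X : 'rV[R]_q -> R) (c c0 : 'rV[R]_q)
    (B : R) :
  (forall (m : 'I_q) (c' : 'rV[R]_q), (forall j, c' 0 j = c 0 j \/ c' 0 j = c0 0 j) ->
     c' 0 m = c0 0 m ->
     `|X (c' + (c 0 m - c0 0 m) *: delta_mx 0 m) - X c'| <= B) ->
  `|X c - X c0| <= q%:R * B.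
Proof.
move=> step; pose cm (m : nat) : 'rV[R]_q := \row_j (if (j < m)%N then c 0 j else c0 0 j).
have H : forall m, (m <= q)%N -> `|X (cm m) - X c0| <= m%:R * B.
  elim=> [_|m IH mq].
    have -> : cm 0%N = c0 by apply/rowP => j; rewrite mxE.
    by rewrite subrr normr0 mul0r.
  pose j0 := Ordinal mq.
  have E : cm m.+1 = cm m + (c 0 j0 - c0 0 j0) *: delta_mx 0 j0.
    apply/rowP => j; rewrite !mxE ltnS leq_eqVlt.
    have [->|jj] := eqVneq j j0.
      by rewrite /= !eqxx ltnn/= mulr1 addrC subrK.
    have -> : (val j == m) = false by apply/negbTE; apply: contra jj => /eqP jm; apply/eqP/val_inj.
    by rewrite /= mulr0 addr0.
  have := step j0 (cm m).
  rewrite -E => S1; have {}S1 := S1 _ _.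
  have {}S1 : `|X (cm m.+1) - X (cm m)| <= B.
    apply: S1 => [j|]; rewrite mxE; last by rewrite /= ltnn.
    by case: ifP; [left|right].
  have := IH (ltnW mq) => IH'.
  rewrite -(subrKA (X (cm m))) (le_trans (ler_normD _ _))//.
  by rewrite -natr1 mulrDl mul1r addrC lerD.
have -> : c = cm q by apply/rowP => j; rewrite mxE ltn_ord.
have := H q (leqnn q); congr (`|X _ - _| <= _).
Qed.

(** The sum over all indices gives one bound valid for every [m]. *)
Lemma near_bounded (T : topologicalType) (R : realType) (q : nat) (g : 'I_q -> T -> R)
    (x : T) (m : 'I_q) : {for x, continuous (g m)} ->
  \forall y \near x, `|g m y| <= 1 + \sum_(i < q) `|g i x|.
Proof.
move=> gc; apply: filterS (near_dist gc ltr01) => y yd.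
have := ler_normD (g m y - g m x) (g m x); rewrite subrK => le1.
have le2 : `|g m x| <= \sum_(i < q) `|g i x|.
  by rewrite (bigD1 m)//= lerDl sumr_ge0.
exact: (le_trans le1 (lerD (ltW yd) le2)).
Qed.

(** * Null covectors degenerating to a radial one *)

Section NotFlat.
Variables (R : realType) (n : nat) (I : set R) (f : R -> R).
Hypothesis hS : class_S I f.
Hypothesis hn3 : (2 < n)%N.

Let hn : (1 < n)%N := ltnW hn3.

Variable r0 : R.
Hypothesis Ir0 : I r0.

Let i0 : 'I_n := Ordinal (ltnW hn).
Let i1 : 'I_n := Ordinal hn.
Let i2 : 'I_n := Ordinal hn3.
Let e0 : 'rV[R]_n := delta_mx 0 i0.
Let e1 : 'rV[R]_n := delta_mx 0 i1.
Let e2 : 'rV[R]_n := delta_mx 0 i2.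

Let dot_delta (i j : 'I_n) : dot (delta_mx 0 i) (delta_mx 0 j) = (i == j)%:R :> R.
Proof.
rewrite /dot (bigD1 i)//= big1 ?addr0; first by rewrite !mxE !eqxx mul1r.
by move=> k ki; rewrite !mxE (negbTE ki) andbF mul0r.
Qed.

(* [zc eps th] is a null covector at [p] with angular part
   [eps *: circle e1 e2 th]; the corrections by [dl eps] make nullness exact
   while keeping [zc] polynomial in [eps]. *)
Let F := f r0.
Let p : ambient R n := point 0 r0 e0.
Let dl (eps : R) := eps ^+ 2 / (4 * F * r0 ^+ 2).
Let vel (eps th : R) : ambient R n :=
  point (1 + dl eps) (F * (1 - dl eps)) ((eps / r0 ^+ 2) *: circle e1 e2 th).

Let Fn : F != 0. Proof. exact: (class_S_neq0 hS Ir0). Qed.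
Let F0 : 0 < F. Proof. exact: (class_S_f_gt0 hS Ir0). Qed.
Let r0n : r0 != 0. Proof. exact: (class_S_r_neq0 hS Ir0). Qed.

Let pS : spacetime I p.
Proof. by split; rewrite // /unit_sphere/= dot_delta eqxx. Qed.

Let circle_perp th : dot (circle e1 e2 th) e0 = 0.
Proof. by rewrite /circle dotDl !dotZl !dot_delta/= !mulr0 addr0. Qed.

Let circle1 th : dot (circle e1 e2 th) (circle e1 e2 th) = 1.
Proof. by apply: circle_unit; rewrite /unit_sphere/= dot_delta. Qed.

Let dl_ge0 eps : 0 <= dl eps.
Proof. by rewrite /dl divr_ge0 ?sqr_ge0// mulr_ge0 ?sqr_ge0// mulr_ge0 ?(ltW F0). Qed.

Let vel_null eps th : null_vector f p (vel eps th).
Proof.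
split.
  move=> /(congr1 (@tc R n)); rewrite tc_point => /eqP.
  by rewrite gt_eqF// ltr_pwDl.
rewrite metricE !pointE -/F dotZl dotZr circle1 /dl; field.
by rewrite Fn r0n.
Qed.

Let E : normedModType R := (ambient R n * ambient R n)%type.
(** [z0] is the dual of the radial vector [vel 0 th], [w1] and [w2] span the plane of the circle of
    angular parts, and [u] is the dual form of the quadratic corrections by [dl]. *)
Let z0 : E := (p, point (- F) 1 0).
Let w1 : E := (0, point 0 0 e1).
Let w2 : E := (0, point 0 0 e2).
Let u : E := (0, point (- (4 * r0 ^+ 2)^-1) (- (4 * F * r0 ^+ 2)^-1) 0).
Let zc (eps th : R) : E := z0 + (eps * cos th) *: w1 + (eps * sin th) *: w2 + eps ^+ 2 *: u.

Let zcE eps th : zc eps th = (p, flat f p (vel eps th)).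
Proof.
have pD (t r t' r' : R) (x x' : 'rV[R]_n) :
  point t r x + point t' r' x' = point (t + t') (r + r') (x + x') by [].
have pZ (a t r : R) (x : 'rV[R]_n) : a *: point t r x = point (a * t) (a * r) (a *: x) by [].
rewrite [zc _ _]surjective_pairing; congr (_, _).
  have -> : (zc eps th).1 = p + (eps * cos th) *: 0 + (eps * sin th) *: 0 + eps ^+ 2 *: 0 by [].
  by rewrite !scaler0 !addr0.
have -> : (zc eps th).2 = point (- F) 1 0 + (eps * cos th) *: point 0 0 e1
  + (eps * sin th) *: point 0 0 e2
  + eps ^+ 2 *: point (- (4 * r0 ^+ 2)^-1) (- (4 * F * r0 ^+ 2)^-1) 0.
  by [].
rewrite !pZ !pD /flat /vel !pointE -/F /dl; congr (point _ _ _).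
- by field; rewrite Fn r0n.
- by field; rewrite Fn r0n.
- rewrite [RHS]scalerA [r0 ^+ 2 * _]mulrC divfK ?expf_neq0//.
  rewrite /circle scaler0 add0r addr0.
  by rewrite scalerDr !scalerA.
Qed.

Let z00 th : zc 0 th = z0.
Proof. by rewrite /zc expr0n/= !mul0r !scale0r !addr0. Qed.

Let zc0 eps : zc eps 0 = z0 + eps *: w1 + eps ^+ 2 *: u.
Proof. by rewrite /zc cos0 sin0 mulr1 mulr0 scale0r addr0. Qed.

Let zcpi eps : zc eps pi = z0 + (- eps) *: w1 + eps ^+ 2 *: u.
Proof. by rewrite /zc cospi sinpi mulrN1 mulr0 scale0r addr0. Qed.

Let N := null_section I f : set (ambient R n * ambient R n)%type.
Let leaves := [set null_lift I f P | P in @lifted_hypersurfaces R n I f].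

Let principal_leaf : exists2 A, leaves A & A z0 /\ forall z, A z -> xc z.2 = 0.
Proof.
have [rstar rstarE] := exists_tortoise hS.
pose P := @null_surface R n I rstar 1 (- rstar r0).
have LP : lifted_hypersurfaces I f P.
  right; apply: (null_surface_maximal hS hn rstarE); first exact: expr1n.
  exact: exists_unit.
have Pp : P p by split; rewrite ?tc_point ?rc_point ?mul1r ?addNr//; case: pS.
exists (null_lift I f P); first by exists P.
split.
  apply/(null_liftP hS hn _ (lifted_spacetime LP)); exists (vel 0 0); split=> //.
  - apply/(tangent_null_surfaceP hS hn rstarE _ Pp).
    rewrite /vel !pointE mul0r scale0r dot0l; split=> //.
    by rewrite /dl expr0n/= mul0r addr0 subr0 mulr1 mul1r divff.
  - by have := zcE 0 0; rewrite z00 => /(congr1 snd).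
move=> z /(null_liftP hS hn _ (lifted_spacetime LP))[v [Pz tv nv ->]].
have [Ir _ x1] := Pz.
have /(tangent_null_surfaceP hS hn rstarE _ Pz)[_ vt] := tv.
have := null_norm hS Ir nv.2; have fn := class_S_neq0 hS Ir.
rewrite vt mul1r mulrC divfK// => /eqP; rewrite -subr_eq0 opprD addNKr oppr_eq0.
rewrite !mulf_eq0 (negbTE fn) (negbTE (class_S_r_neq0 hS Ir))/= => /eqP/dot_eq0 xv.
by rewrite xv scaler0.
Qed.

(** The slope [m] of [vel eps th] does not depend on [th], so one maximal profile serves the whole
    circle. *)
Let photon_leaf eps : eps != 0 -> exists2 A, leaves A & forall th, A (zc eps th).
Proof.
move=> eps0; pose m := F * (1 - dl eps) / (1 + dl eps).
have d0 := dl_ge0 eps.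
have mE th : rc (vel eps th) / tc (vel eps th) = m by [].
have mf : `|m| < f (rc p).
  rewrite -(mE 0); apply: (@null_slope_lt R n I f hS p _ Ir0 (vel_null eps 0)).
  rewrite /vel xc_point => /eqP; rewrite scaler_eq0 mulf_eq0 invr_eq0.
  rewrite (negbTE eps0) expf_eq0 (negbTE r0n)/= => /eqP c0.
  by have := circle1 0; rewrite c0 dot0l => /eqP; rewrite eq_sym oner_eq0.
have [T [h [h1 M]]] := maximal_profile hS (tc p) Ir0 mf.
have LH : lifted_hypersurfaces I f (surface T h : set (ambient R n)).
  by left; exact: (surface_maximal hS hn M).
have [hT Tp hp h1p _] := M.
exists (null_lift I f (surface T h)); first by exists (surface T h).
move=> th; rewrite zcE; apply/(null_liftP hS hn _ (lifted_spacetime LH)).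
have Pp : surface T h p by split; [|rewrite hp|case: pS].
exists (vel eps th); split=> //.
apply/(tangent_surfaceP hS hn _ hT Pp); split.
  by rewrite xc_point dotZl circle_perp mulr0.
rewrite h1p -(mE th) divfK// tc_point gt_eqF// ltr_pwDl//.
Qed.

Let zcN eps th : N (zc eps th).
Proof.
rewrite zcE; apply/(null_sectionP hS hn); exists (vel eps th); split=> //.
by rewrite xc_point dotZl circle_perp mulr0.
Qed.

Let zc_near (W : set E) : nbhs z0 W ->
  exists2 d : R, 0 < d & forall eps th s : R, `|eps| < d -> `|s| <= `|eps| ->
    [/\ W (zc eps th), W (z0 + s *: w1), W (z0 + s *: w1 + eps ^+ 2 *: u)
      & forall s', `|s'| <= eps ^+ 2 -> W (z0 + s *: w1 + s' *: u)].
Proof.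
move=> nW; have [d d0 Hd] := near_parabola w1 w2 u nW.
exists d => // eps th s epsd se.
have n0 : `|0 : R| <= `|eps| by rewrite normr0.
have e2' : `|eps ^+ 2| <= eps ^+ 2 by rewrite ger0_norm ?sqr_ge0.
have H0 b t : `|b| <= `|eps| -> `|t| <= eps ^+ 2 -> W (z0 + b *: w1 + t *: u).
  by move=> be te; have := Hd eps b 0 t epsd be n0 te; rewrite scale0r addr0.
split.
- apply: (Hd _ _ _ _ epsd _ _ e2'); rewrite normrM ler_piMr// ler_norml.
    by rewrite cos_geN1 cos_le1.
  by rewrite sin_geN1 sin_le1.
- by have := H0 s 0 se; rewrite normr0 scale0r addr0; apply; exact: sqr_ge0.
- exact: H0.
- by move=> s' s'e; exact: H0.
Qed.

Let zcc eps : continuous (zc eps).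
Proof.
move=> th; have cd := derive_mulf (derive_cstf eps th (1 : R)) (is_derive_cos th).
  have sd := derive_mulf (derive_cstf eps th (1 : R)) (is_derive_sin th).
  exact: is_derive1_continuous (is_derive_addv (is_derive_addv (is_derive_addv
    (is_derive_cstv z0 th (1 : R)) (is_derive_scalev w1 cd)) (is_derive_scalev w2 sd))
    (is_derive_cstv (eps ^+ 2 *: u) th (1 : R))).
Qed.

(** This coordinate recovers [eps] from the covector; the contradiction will be that the chart
    confines it to at most [eps / 2]. *)
Let xcz eps : xc (z0 + eps *: w1 + eps ^+ 2 *: u).2 0 i1 = eps.
Proof.
have -> : xc (z0 + eps *: w1 + eps ^+ 2 *: u).2 = 0 + eps *: e1 + eps ^+ 2 *: 0 by [].
by rewrite add0r scaler0 addr0 !mxE !eqxx mulr1.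
Qed.

Lemma lifts_not_flat : ~ flat_family N leaves.
Proof.
(* From here on the curve enters only through its recorded properties, such as [zc0], [zcpi] and
   [xcz]. *)
clear zcE; clearbody zc; clearbody z0 w1 w2 u.
have Nz0 : N z0 by rewrite -(z00 0).
move=> [k [q /(_ z0 Nz0)[W [phi [psi [Wz0 [[oW sphi] spsi phiW psiW fl]]]]]]].
have nW := open_nbhs_nbhs (conj oW Wz0).
have n0 (eps : R) : `|0 : R| <= `|eps| by rewrite normr0.
have coordc m j (M : 'rV[R]_m) : {for M, continuous (fun M : 'rV[R]_m => M 0 j)}.
  exact: (differentiable_continuous (differentiable_coord M 0 j)).
pose h i (z : E) : R := (phi z).2 0 i.
pose dphi v i (z : E) : R := ('D_v phi z).2 0 i.
have hd i z v : W z -> is_derive z v (h i) (dphi v i z).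
  move=> Wz; have [_ [D _]] := sphi 1%N.
  exact: (is_derive_coord 0 i (is_derive_snd (derivableP (D z v Wz)))).
have rv2c (g : E -> 'rV[R]_k * 'rV[R]_q) i z : {for z, continuous g} ->
    {for z, continuous (fun z => (g z).2 0 i)}.
  move=> gc; apply: (@continuous_comp _ _ _ (fun z => (g z).2) (fun M : 'rV[R]_q => M 0 i)).
    apply: (@continuous_comp _ _ _ g snd z gc); exact: cvg_snd.
  exact: coordc.
have phic z : W z -> {for z, continuous phi} by move=> Wz; have [C _] := sphi 0%N; exact: C.
have dphic v i : {for z0, continuous (dphi v i)}.
  by apply: rv2c; have [_ [_ /(_ v)[C _]]] := sphi 1%N; exact: C.
have [d1 d10 Hd1] := zc_near nW.
(* The label is continuous in [th] with countably many possible values, hence constant on the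
   circle; [0] and [pi] give opposite angular parts. *)
have heven i eps : eps != 0 -> `|eps| < d1 -> h i (zc eps 0) = h i (zc eps pi).
  move=> eps0 epsd; have [A LA Ath] := photon_leaf eps0.
  have [D cD AD] := fl A LA.
  apply: (@countable_range_constant R (fun th => h i (zc eps th))
    ((fun c : 'rV[R]_q => c 0 i) @` D)).
  - move=> th; have [Wth _ _ _] := Hd1 eps th 0 epsd (n0 eps).
    apply: (@continuous_comp _ _ _ (zc eps) (h i)); first exact: zcc.
    by apply: rv2c; exact: phic.
  - exact: (sub_countable (card_image_le _ _) cD).
  - move=> th; have [Wth _ _ _] := Hd1 eps th 0 epsd (n0 eps).
    have : (A `&` W) (zc eps th) by split; [exact: Ath|exact: Wth].
    by rewrite AD => -[_ _ Dz]; exists (phi (zc eps th)).2.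
have dw1 i : dphi w1 i z0 = 0.
  apply: (@even_derivative0 R E (h i) (dphi w1 i) z0 w1 u d1 d10).
  - by apply: filterS nW => z; exact: hd.
  - exact: dphic.
  - move=> eps eps0 epsd; have epsd' : `|eps| < d1 by rewrite gtr0_norm.
    by have := heven i eps (lt0r_neq0 eps0) epsd'; rewrite (zc0 eps) (zcpi eps).
pose F' := ('rV[R]_k * 'rV[R]_q)%type : normedModType R.
pose cube := [set y : 'rV[R]_k * 'rV[R]_q | `|y| < 1].
have [A0 LA0 [A0z0 A0x]] := principal_leaf.
have [D0 _ AD0] := fl A0 LA0.
have [cz0 _] := phiW z0 Nz0 Wz0.
pose X (y : 'rV[R]_k * 'rV[R]_q) : R := xc (psi y).2 0 i1.
pose dX v (y : 'rV[R]_k * 'rV[R]_q) : R := xc ('D_v psi y).2 0 i1.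
have Xd y v : cube y -> is_derive y v X (dX v y).
  move=> cy; have [_ [D _]] := spsi 1%N.
  exact: (is_derive_coord 0 i1 (is_derive_xc (is_derive_snd (derivableP (D y v cy))))).
pose dir (m : 'I_q) : 'rV[R]_k * 'rV[R]_q := (0, delta_mx 0 m).
have dXc m : {for phi z0, continuous (dX (dir m))}.
  have [_ [_ /(_ (dir m))[C _]]] := spsi 1%N.
  apply: (@continuous_comp _ _ _ (fun y => xc ('D_(dir m) psi y).2) (fun M : 'rV[R]_n => M 0 i1)).
    apply: (@continuous_comp _ _ _ (fun y => ('D_(dir m) psi y).2) (@xc R n)).
      apply: (@continuous_comp _ _ _ ('D_(dir m) psi) snd); first exact: C.
      exact: cvg_snd.
    exact: xc_continuous.
  exact: coordc.
(* [K] bounds, near [phi z0], the derivatives of the angular coordinate [X] of the inverse chart in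
   all transverse directions. *)
pose K := 1 + \sum_(m < q) `|dX (dir m) (phi z0)|.
have K0 : 0 < K by rewrite ltr_pwDl// sumr_ge0.
have ocube : open cube.
  rewrite (_ : cube = ball (0 : F') 1); first exact: ball_open.
  by apply/seteqP; split=> y0; rewrite -ball_normE/= sub0r normrN.
have nK : \forall y \near phi z0, cube y /\ forall m, `|dX (dir m) y| <= K.
  have H1 m : \forall y \near phi z0, `|dX (dir m) y| <= K.
    exact: (@near_bounded _ R q (fun m => dX (dir m)) _ m (dXc m)).
  have {}H1 : \forall y \near phi z0, forall m, `|dX (dir m) y| <= K.
    exact: (@filter_forall _ _ (fun m y => `|dX (dir m) y| <= K) (nbhs (phi z0)) _ H1).
  by apply: filterS2 (open_nbhs_nbhs (conj ocube cz0)) H1 => y ? ?; split.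
have /nbhs_ballP[rho /= rho0 Hrho] := nK.
(* Chosen so that [q K tau <= 1/4]: a change of each label by at most [2 tau eps] then moves [X] by
   at most [eps / 2]. *)
pose tau := (4 * (q%:R * K + 1))^-1.
have qK0 : 0 <= q%:R * K by rewrite mulr_ge0// ltW.
have tau0 : 0 < tau by rewrite invr_gt0 mulr_gt0// ltr_wpDl.
pose M := 1 + \sum_(i < q) `|dphi u i z0|.
have M0 : 0 < M by rewrite ltr_pwDl// sumr_ge0.
have nG : \forall z \near z0, [/\ W z, ball (phi z0) rho (phi z) &
    forall i, `|dphi w1 i z| <= tau /\ `|dphi u i z| <= M].
  have H1 i : \forall z \near z0, `|dphi w1 i z| <= tau /\ `|dphi u i z| <= M.
    have b1 := near_dist (dphic w1 i) tau0; rewrite dw1 in b1.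
    have b2 := @near_bounded _ R q (dphi u) _ i (dphic u i).
    by apply: filterS2 b1 b2 => z; rewrite subr0 => /ltW le1 le2; split.
  have {}H1 : \forall z \near z0, forall i, `|dphi w1 i z| <= tau /\ `|dphi u i z| <= M.
    exact: (@filter_forall _ _ (fun i z => `|dphi w1 i z| <= tau /\ `|dphi u i z| <= M)
      (nbhs z0) _ H1).
  have H2 : \forall z \near z0, ball (phi z0) rho (phi z).
    exact: (near_comp (phic z0 Wz0) (nbhsx_ballx (phi z0) rho rho0)).
  by near=> z; split; near: z.
have [d d0 Hd] := zc_near nG.
(* With [M eps <= tau], the displacement by [eps ^+ 2 *: u] changes each label by at most [tau eps],
   as does the displacement by [eps *: w1]. *)
pose eps := Num.min d (tau / M) / 2.
have m0 : 0 < Num.min d (tau / M) by rewrite lt_min d0 divr_gt0.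
have eps0 : 0 < eps by rewrite divr_gt0.
have [md mt] : Num.min d (tau / M) <= d /\ Num.min d (tau / M) <= tau / M.
  by rewrite !ge_min !lexx orbT.
have epsd : `|eps| < d by rewrite gtr0_norm// /eps; lra.
have epsM : M * eps <= tau.
  by rewrite mulrC -ler_pdivlMr// /eps; lra.
have hb i : `|h i (zc eps 0) - h i z0| <= 2 * tau * eps.
  have st1 : `|h i (z0 + eps *: w1) - h i z0| <= tau * `|eps|.
    apply: (line_lipschitz (d := dphi w1 i)) => s se.
    have [_ [Ws _ /(_ i)[B1 _]] _ _] := Hd eps 0 s epsd se.
    by split; [exact: hd|].
  have st2 : `|h i (z0 + eps *: w1 + eps ^+ 2 *: u) - h i (z0 + eps *: w1)| <= M * `|eps ^+ 2|.
    apply: (line_lipschitz (d := dphi u i)) => s se.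
    rewrite [X in _ <= X]ger0_norm ?sqr_ge0// in se.
    have [_ _ _ /(_ s se)[Ws _ /(_ i)[_ B1]]] := Hd eps 0 eps epsd (lexx _).
    by split; [exact: hd|].
  rewrite zc0 -(subrKA (h i (z0 + eps *: w1))) (le_trans (ler_normD _ _))//.
  rewrite (gtr0_norm eps0) in st1; rewrite (ger0_norm (sqr_ge0 eps)) in st2.
  have st3 : M * eps ^+ 2 <= tau * eps by rewrite expr2 mulrA ler_wpM2r// ltW.
  have -> : 2 * tau * eps = tau * eps + tau * eps by ring.
  exact: (lerD (le_trans st2 st3) st1).
have [[Wz bz _] _ _ _] := Hd eps 0 0 epsd (n0 eps).
set z := zc eps 0 in hb Wz bz.
have [cz pz] := phiW z (zcN eps 0) Wz.
pose c := (phi z).2; pose c0 := (phi z0).2; pose y := (phi z).1.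
have Xz : X (y, c) = eps.
  by rewrite /X /y /c -surjective_pairing pz /z zc0 xcz.
have inb (c' : 'rV[R]_q) : (forall j, `|c' 0 j - c0 0 j| < rho) ->
    ball (phi z0) rho (y, c').
  move=> cc; have [by_ _] := bz; split; first exact: by_.
  split; first exact: rho0.
  by move=> i j; rewrite ord1 /ball/= distrC; exact: cc.
have cb j : `|c 0 j - c0 0 j| < rho.
  by have [_ [_ /(_ 0 j)]] := bz; rewrite /ball/= distrC.
(* Giving the point [zc eps 0] the label of [z0] moves it into the slice of [z0], hence into the
   principal leaf [A0], where angular parts vanish. *)
have X0 : X (y, c0) = 0.
  have [|cy _] := Hrho (y, c0).
    by apply: inb => j; rewrite subrr normr0.
  have [[Ny Wy] phy] := psiW (y, c0) cy.
  have : (A0 `&` W) (psi (y, c0)).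
    rewrite AD0; split=> //; rewrite phy /=.
    have : (A0 `&` W) z0 by split.
    by rewrite AD0 => -[].
  by move=> [/A0x xz _]; rewrite /X xz mxE.
have : `|X (y, c) - X (y, c0)| <= q%:R * (K * (2 * tau * eps)).
  apply: (coord_telescope (X := fun c => X (y, c))) => m c' c'j c'm.
  set l := c 0 m - c0 0 m.
  have lb : `|l| <= 2 * tau * eps by exact: hb.
  apply: (@le_trans _ _ (K * `|l|)); last by rewrite ler_wpM2l// ltW.
  have -> : (y, c' + l *: delta_mx 0 m) = (y, c') + l *: dir m.
    have -> : (y, c') + l *: dir m = (y + l *: 0, c' + l *: delta_mx 0 m) by [].
    by rewrite scaler0 addr0.
  apply: (@line_lipschitz R F' X (dX (dir m)) (y, c')) => s sl.
  have [|cy /(_ m) dK] := Hrho ((y, c') + s *: dir m); last by split; [exact: Xd|].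
  have -> : (y, c') + s *: dir m = (y + s *: 0, c' + s *: delta_mx 0 m) by [].
  rewrite scaler0 addr0; apply: inb => j; rewrite !mxE eqxx/=.
  have [->|jm] := eqVneq j m.
    by rewrite mulr1 c'm addrAC subrr add0r; exact: (le_lt_trans sl (cb m)).
  by rewrite mulr0 addr0; case: (c'j j) => ->; rewrite ?subrr ?normr0.
rewrite Xz X0 subr0 gtr0_norm//.
have : q%:R * K * tau <= 4^-1.
  rewrite /tau invfM mulrCA ler_piMr ?invr_ge0//.
  by rewrite ler_pdivrMr ?mul1r ?lerDl// ltr_wpDl.
have -> : q%:R * (K * (2 * tau * eps)) = 2 * eps * (q%:R * K * tau) by ring.
have e20 : 0 <= 2 * eps by rewrite mulr_ge0// ltW.
move=> /(ler_wpM2l e20); lra.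
Unshelve. all: by end_near. Qed.

End NotFlat.

(** Disconnected lifts alone refute a foliation by leaves; the last clause shows that for [n > 2]
    the failure persists when leaves may be disconnected, being due to the way photon lifts
    accumulate at radial covectors. *)
Theorem corollary4p4 (R : realType) (n : nat) (I : set R) (f : R -> R)
    (hn : (1 < n)%N) (hS : class_S I f) :
  let N := null_section I f : set (ambient R n * ambient R n)%type in
  let leaves := [set null_lift I f P | P in @lifted_hypersurfaces R n I f] in
  [/\ partition (@lifted_hypersurfaces R n I f) (null_lift I f) N,
      ~ smooth_foliation N leaves
    & (2 < n)%N -> ~ flat_family N leaves].
Proof.
move=> N leaves; split; first exact: lifts_partition.
- move=> [_ conn _]; have [rstar rstarE] := exists_tortoise hS.
  have L : lifted_hypersurfaces I f (@null_surface R n I rstar 1 0).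
    by right; apply: null_surface_maximal => //; [exact: expr1n|exact: exists_unit].
  by apply: (null_lift_not_connected hS hn L); apply: conn; exists (@null_surface R n I rstar 1 0).
- by move=> hn3; have [r0 Ir0] := class_S_nonempty hS; exact: (lifts_not_flat hS hn3 Ir0).
Qed.
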